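(* Let $n,m\ge2$ be integers with $n\mid m$. Then there are topological group embeddings \[ \mathrm{Homeo}^+(\mathcal{R}_n)\hookrightarrow\mathrm{Homeo}^+(\mathcal{R}_m)\hookrightarrow\mathrm{Homeo}^+(\mathcal{B})\hookrightarrow\mathrm{Homeo}^+(\mathcal{A}), \] where $\mathcal{B}=\mathcal{R}_2$ is the basilica.
   Context: A topological group embedding is an injective group homomorphism that is a homeomorphism onto its image. For $n\ge2$ finite, $\mathrm{Homeo}^+(\mathcal{R}_n)$ (orientation-preserving homeomorphism group of the $n$-regular rabbit) and $\mathrm{Homeo}^+(\mathcal{A})$ (that of the airplane) denote the topological groups $\mathcal{U}(\mathrm{Cyc}(n),\mathrm{Aut}(O))$ and $\mathcal{K}(\mathrm{Aut}(O))$ defined as follows. $O$ is the countable dense cyclic order on $\Omega=\mathbf{Q}/\mathbf{Z}$ with automorphism group $\mathrm{Aut}(O)\le\mathrm{Sym}(\Omega)$, $[n]=\{1,\dots,n\}$ and $\mathrm{Cyc}(n)=\langle(1\,2\cdots n)\rangle\le\mathrm{Sym}([n])$. Universal group: $T$ is the biregular tree with vertex bipartition $\{A,B\}$, vertices of $A$ of degree $n$ and of $B$ of countably infinite degree; $\mathrm{out}(v)$, $\mathrm{in}(v)$ are the sets of half-edges (ordered pairs of adjacent vertices) starting, resp. ending, at $v$. A legal coloring $k$ of the half-edges by $[n]\sqcup\Omega$ restricts to bijections $\mathrm{out}(v)\to[n]$ ($v\in A$), $\mathrm{out}(v)\to\Omega$ ($v\in B$), and is constant on each $\mathrm{in}(v)$;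 fix one. $\mathcal{U}(\mathrm{Cyc}(n),\mathrm{Aut}(O))$ is the group of bipartition-preserving automorphisms $g$ of $T$ with $k|_{\mathrm{out}(g(v))}\circ g|_{\mathrm{out}(v)}\circ(k|_{\mathrm{out}(v)})^{-1}$ in $\mathrm{Cyc}(n)$ for $v\in A$ and in $\mathrm{Aut}(O)$ for $v\in B$, with the topology of pointwise convergence on vertices. Kaleidoscopic group: a dendrite is a compact, metrizable, connected, locally connected space in which any two distinct points are joined by a unique arc; the order of a point is the number of components of its complement and branch points are points of order at least $3$. $D_\infty$ is the unique dendrite all of whose branch points have infinite order and in which every arc contains branch points; $\hat b$ is the set of components of $D_\infty\setminus\{b\}$. A kaleidoscopic coloring is a map $k\colon\bigsqcup_b\hat b\to\Omega$ ($b$ ranging over branch points) restricting to a bijection $k_b\colon\hat b\to\Omega$ for each $b$ and such that for distinct branch points $b_1,b_2$ and distinct $i,j\in\Omega$ there is a branch point $b$ separating $b_1$ from $b_2$ whose components containing $b_1$ and $b_2$ have colors $i$ and $j$; fix one. $\mathcal{K}(\mathrm{Aut}(O))$ is the group of $g\in\mathrm{Homeo}(D_\infty)$ with $k_{g(b)}\circ g\circ k_b^{-1}\in\mathrm{Aut}(O)$ for all $b$, with the topology of pointwise convergence on the discrete set of branch points. *)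

(* Defs.v *)
From HB Require Import structures.
From mathcomp Require Import all_boot all_order all_algebra all_fingroup.
From mathcomp Require Import ring_quotient.
From mathcomp Require Import all_classical all_reals all_analysis.

Set Implicit Arguments.
Unset Strict Implicit.
Unset Printing Implicit Defensive.

Import Order.TTheory GRing.Theory Num.Theory numFieldNormedType.Exports.

Local Open Scope quotient_scope.
Local Open Scope classical_set_scope.

Definition is_homeomorphism (X Y : topologicalType) (f : X -> Y) : Prop :=
  continuous f /\
  exists g : Y -> X, [/\ cancel f g, cancel g f & continuous g].

(* [f] with codomain its image; as a type, [range f] carries the topology
   induced by [Y]. *)
Definition corestrict (X Y : topologicalType) (f : X -> Y) (x : X) : range f :=
  exist _ (f x) (mem_set (imageT f x)).

Definition topological_embedding (X Y : topologicalType) (f : X -> Y) : Prop :=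
  is_homeomorphism (corestrict f).

HB.mixin Record isTopologicalGroup G & monoid.Group G & Topological G := {
  topgroup_mul_continuous : continuous (fun x : G * G => (x.1 * x.2)%g);
  topgroup_inv_continuous : continuous (fun x : G => (x^-1)%g)
}.

#[short(type="topologicalGroupType")]
HB.structure Definition TopologicalGroup :=
  {G of isTopologicalGroup G & monoid.Group G & Topological G}.

Definition topological_group_embedding (G H : topologicalGroupType)
    (f : G -> H) : Prop :=
  [/\ injective f, {morph f : x y / (x * y)%g} & topological_embedding f].

Definition embeds_as_topological_group (G H : topologicalGroupType) : Prop :=
  exists f : G -> H, topological_group_embedding f.

Record sym (X : Type) := Sym {
  sym_fun :> X -> X;
  sym_inv : X -> X;
  symK : cancel sym_fun sym_inv;
  sym_invK : cancel sym_inv sym_fun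
}.

HB.instance Definition _ X := gen_eqMixin (sym X).
HB.instance Definition _ X := gen_choiceMixin (sym X).

Lemma sym_ext X (f g : sym X) : f =1 g -> f = g.
Proof.
case: f g => [f f' fK f'K] [g g' gK g'K] /= /funext fg.
rewrite -{}fg in gK g'K *.
have f'g' : f' = g' by apply/funext => x; rewrite -[in LHS](g'K x) fK.
rewrite -{}f'g' in gK g'K *.
by rewrite (Prop_irrelevance fK gK) (Prop_irrelevance f'K g'K).
Qed.

Section SymGroup.
Variable X : Type.
Implicit Types f g : sym X.

Definition sym_one : sym X := @Sym X id id (fun=> erefl) (fun=> erefl).

Definition sym_mul f g : sym X :=
  Sym (can_comp (symK f) (symK g)) (can_comp (sym_invK g) (sym_invK f)).

Definition sym_opp f : sym X := Sym (sym_invK f) (symK f).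

Lemma sym_mulA : associative sym_mul.
Proof. by move=> f g h; apply: sym_ext. Qed.
Lemma sym_mul1 : left_id sym_one sym_mul.
Proof. by move=> f; apply: sym_ext. Qed.
Lemma sym_mulr1 : right_id sym_one sym_mul.
Proof. by move=> f; apply: sym_ext. Qed.
Lemma sym_mulV : left_inverse sym_one sym_opp sym_mul.
Proof. by move=> f; apply: sym_ext => x /=; rewrite symK. Qed.
Lemma sym_mulrV : right_inverse sym_one sym_opp sym_mul.
Proof. by move=> f; apply: sym_ext => x /=; rewrite sym_invK. Qed.

HB.instance Definition _ := isGroup.Build (sym X)
  sym_mulA sym_mul1 sym_mulr1 sym_mulV sym_mulrV.

End SymGroup.

Lemma sym1E X (x : X) : (1%g : sym X) x = x. Proof. by []. Qed.
Lemma symME X (f g : sym X) x : (f * g)%g x = f (g x). Proof. by []. Qed.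
Lemma symVE X (f : sym X) x : (f^-1)%g x = sym_inv f x. Proof. by []. Qed.

Record permgroup (X : Type) := Permgroup {
  permgroup_set :> sym X -> Prop;
  permgroup1 : permgroup_set 1%g;
  permgroupM : forall f g,
    permgroup_set f -> permgroup_set g -> permgroup_set (f * g)%g;
  permgroupV : forall f, permgroup_set f -> permgroup_set (f^-1)%g
}.

(* The topology is that of pointwise convergence on [Y] only, whose points are
   regarded as discrete even if [X] carries a topology. *)
Definition pointwise_group (X : choiceType) (G : permgroup X) (Y : set X)
    (GY : forall g, G g -> forall x, Y x -> Y (g x)) : Type :=
  {g : sym X | g \in (G : set (sym X))}.

Section PointwiseGroup.
Variables (X : choiceType) (G : permgroup X) (Y : set X).
Hypothesis GY : forall g, G g -> forall x, Y x -> Y (g x).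
Local Notation PG := (pointwise_group GY).

HB.instance Definition _ := SubChoice.on PG.

Lemma permgroup_closed : group_closed (mem (G : set (sym X))).
Proof.
split; first by apply/mem_set/permgroup1.
move=> f g /set_mem Gf /set_mem Gg; apply/mem_set/permgroupM => //.
exact: permgroupV.
Qed.

HB.instance Definition _ := SubChoice_isSubGroup.Build _ _ PG permgroup_closed.

Definition evaluations (g : PG) :
    prod_topology (fun _ : Y => discrete_topology X) :=
  fun y => val g (val y).

HB.instance Definition _ :=
  Topological.copy PG (initial_topology evaluations).

Lemma evaluation_continuous (y : Y) :
  continuous (fun g : PG => val g (val y) : discrete_topology X).
Proof.
move=> g; apply: (@continuous_comp _ _ _ evaluations (proj y)).
  exact: initial_continuous.
exact: proj_continuous.
Qed.

Lemma near_evaluation (y : Y) (g : PG) :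
  nbhs g [set g' : PG | val g' (val y) = val g (val y)].
Proof.
exact: (@evaluation_continuous y g [set val g (val y)]
  (@discrete_set1 (discrete_topology X) (val g (val y)))).
Qed.

Lemma continuous_evaluations (Z : topologicalType) (F : Z -> PG) :
  (forall y : Y,
    continuous (fun z => val (F z) (val y) : discrete_topology X)) ->
  continuous F.
Proof.
move=> Fc; apply: continuous_comp_initial => z; apply/cvg_sup => y.
pose T := initial_topology
  (fun f : prod_topology (fun _ : Y => discrete_topology X) => f y).
exact: (@continuous_comp_initial _ _ _ _
  (fun z => evaluations (F z) : T) (Fc y)).
Qed.

Lemma pointwise_mul_continuous : continuous (fun x : PG * PG => (x.1 * x.2)%g).
Proof.
apply: continuous_evaluations => y [g h] /= U.
rewrite nbhs_principalE => /= Ugh.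
have Yhy : Y (val h (val y)) by apply: GY; apply: set_mem; apply: valP.
pose hy : Y := SigSub (mem_set Yhy).
exists ([set g' : PG | val g' (val hy) = val g (val hy)],
        [set h' : PG | val h' (val y) = val h (val y)]) => /=.
  by split; [exact: (near_evaluation hy)|exact: near_evaluation].
move=> [g' h'] [/= eg eh].
suff e : val (g' * h')%g (val y) = val (g * h)%g (val y).
  have : U (val (g * h)%g (val y)) by exact/principal_filterP.
  by rewrite -e.
by rewrite !valM !symME eh; exact: eg.
Qed.

Lemma pointwise_inv_continuous : continuous (fun x : PG => (x^-1)%g).
Proof.
apply: continuous_evaluations => y g U.
rewrite nbhs_principalE => /= Ug.
have Ygy : Y (val (g^-1)%g (val y)) by apply: GY; apply: set_mem; apply: valP.
pose gy : Y := SigSub (mem_set Ygy).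
apply: filterS (near_evaluation gy g) => g' /= e.
suff e' : val (g'^-1)%g (val y) = val (g^-1)%g (val y).
  have : U (val (g^-1)%g (val y)) by exact/principal_filterP.
  by rewrite -e'.
have VE (f : PG) : val (f^-1)%g (val y) = sym_inv (val f) (val y) by [].
by apply: (can_inj (symK (val g'))); move: e; rewrite !VE !sym_invK => ->.
Qed.

HB.instance Definition _ := isTopologicalGroup.Build PG
  pointwise_mul_continuous pointwise_inv_continuous.

End PointwiseGroup.

(* Q/Z: [Num.int_num_subdef] is the predicate underlying [Num.int], and [clone]
   retrieves its structure of additive subgroup. *)
Definition Omega : choiceType :=
  Quotient.quot (GRing.ZmodClosed.clone rat (@Num.int_num_subdef rat) _).

(* Three classes are in cyclic order if they have representatives that occur in
   this order within one period. *)
Definition cyclic_order (a b c : Omega) : Prop :=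
  exists x y z : rat,
    [/\ x < y, y < z & z < x + 1]%R /\
    [/\ \pi_Omega x = a, \pi_Omega y = b & \pi_Omega z = c].

Definition is_cyclic_automorphism (s : sym Omega) : Prop :=
  forall a b c, cyclic_order a b c <-> cyclic_order (s a) (s b) (s c).

Lemma is_cyclic_automorphism1 : is_cyclic_automorphism 1%g.
Proof. by []. Qed.

Lemma is_cyclic_automorphismM s t :
  is_cyclic_automorphism s -> is_cyclic_automorphism t ->
  is_cyclic_automorphism (s * t)%g.
Proof. by move=> sO tO a b c; rewrite !symME -sO -tO. Qed.

Lemma is_cyclic_automorphismV s :
  is_cyclic_automorphism s -> is_cyclic_automorphism s^-1%g.
Proof. by move=> sO a b c; rewrite [X in _ <-> X]sO !symVE !sym_invK. Qed.

Definition AutO : permgroup Omega := Permgroup is_cyclic_automorphism1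
  is_cyclic_automorphismM is_cyclic_automorphismV.

(* [n] is encoded as ['I_n], so that the cycle (1 2 ... n) is the cyclic
   successor [ordS]. *)
Definition is_rotation n (s : sym 'I_n) : Prop :=
  exists2 p : {perm 'I_n}, p \in <[perm (@ordS_inj n)]>%g & s =1 p.

Lemma is_rotation1 n : is_rotation (1%g : sym 'I_n).
Proof. by exists 1%g; [exact: group1|move=> i; rewrite perm1]. Qed.

Lemma is_rotationM n (s t : sym 'I_n) :
  is_rotation s -> is_rotation t -> is_rotation (s * t)%g.
Proof.
move=> [p Cp sp] [q Cq tq]; exists (q * p)%g; first exact: groupM.
by move=> i; rewrite symME permM tq sp.
Qed.

Lemma is_rotationV n (s : sym 'I_n) : is_rotation s -> is_rotation s^-1%g.
Proof.
move=> [p Cp sp]; exists p^-1%g; first by rewrite groupV.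
by move=> i; rewrite symVE -[in RHS](sym_invK s i) sp permK.
Qed.

Definition Cyc n : permgroup 'I_n :=
  Permgroup (@is_rotation1 n) (@is_rotationM n) (@is_rotationV n).

Definition is_tree (V : choiceType) (e : rel V) : Prop :=
  [/\ inhabited V,
      symmetric e,
      irreflexive e,
      forall x y, exists2 p, path e x p & last x p = y &
      forall c, ucycle e c -> (size c <= 2)%N].

Section HalfEdges.
Variables (V : choiceType) (e : rel V).

Definition out (v : V) : set (V * V) := [set h | e h.1 h.2 /\ h.1 = v].
Definition into (v : V) : set (V * V) := [set h | e h.1 h.2 /\ h.2 = v].

Definition is_biregular (A : pred V) (n : nat) : Prop :=
  [/\ forall x y, e x y -> A x != A y,
      forall v, A v -> (out v #= `I_n)%card &
      forall v, ~~ A v -> (out v #= [set: nat])%card].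

Definition is_legal_coloring (A : pred V) (n : nat)
    (k : V * V -> 'I_n + Omega) : Prop :=
  [/\ forall v, A v -> set_bij (out v) (range inl) k,
      forall v, ~~ A v -> set_bij (out v) (range inr) k &
      forall v h h', into v h -> into v h' -> k h = k h'].

End HalfEdges.

(* [inA] is the class A of the bipartition and its complement is the class B.
   The values of [tree_color] on pairs of nonadjacent vertices are
   irrelevant. *)
Record colored_tree (n : nat) := ColoredTree {
  vertex :> choiceType;
  adj : rel vertex;
  inA : pred vertex;
  tree_color : vertex * vertex -> 'I_n + Omega;
  adj_tree : is_tree adj;
  adj_biregular : is_biregular adj inA n;
  tree_color_legal : is_legal_coloring adj inA tree_color
}.

Section UniversalGroup.
Variables (n : nat) (T : colored_tree n).
Variables (F1 : permgroup 'I_n) (F2 : permgroup Omega).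
Local Notation k := (@tree_color n T).

(* Since [k] restricts to bijections on the sets [out v], the last two clauses
   say that k|_out(g v) o g o (k|_out(v))^-1 is the permutation [s]. *)
Definition is_universal (g : sym T) : Prop :=
  [/\ forall x y, adj (g x) (g y) = adj x y,
      forall x, inA (g x) = inA x,
      forall v, inA v -> exists2 s : sym 'I_n, F1 s &
        forall w i, adj v w -> k (v, w) = inl i -> k (g v, g w) = inl (s i) &
      forall v, ~~ inA v -> exists2 s : sym Omega, F2 s &
        forall w i, adj v w -> k (v, w) = inr i -> k (g v, g w) = inr (s i)].

Lemma is_universal1 : is_universal 1%g.
Proof.
by split => // v _; exists 1%g => //; exact: permgroup1.
Qed.

Lemma is_universalM f g :
  is_universal f -> is_universal g -> is_universal (f * g)%g.
Proof.
move=> [fe fA f1 f2] [ge gA g1 g2]; split => [x y|x|v Av|v Bv].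
- by rewrite !symME fe ge.
- by rewrite !symME fA gA.
- have [s Fs sP] := g1 _ Av; have [|t Ft tP] := f1 (g v); first by rewrite gA.
  exists (t * s)%g; first exact: permgroupM.
  by move=> w i vw kvw; rewrite !symME; apply: tP; [rewrite ge|exact: sP].
- have [s Fs sP] := g2 _ Bv; have [|t Ft tP] := f2 (g v); first by rewrite gA.
  exists (t * s)%g; first exact: permgroupM.
  by move=> w i vw kvw; rewrite !symME; apply: tP; [rewrite ge|exact: sP].
Qed.

Lemma is_universalV g : is_universal g -> is_universal g^-1%g.
Proof.
move=> [ge gA g1 g2].
have ge' x y : adj ((g^-1)%g x) ((g^-1)%g y) = adj x y.
  by rewrite -ge !symVE !sym_invK.
have gA' x : inA ((g^-1)%g x) = inA x by rewrite -gA symVE sym_invK.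
have [lA lB _] := tree_color_legal T.
split => // v; rewrite -gA' => Dv.
- have [s Fs sP] := g1 _ Dv; exists s^-1%g; first exact: permgroupV.
  move=> w i; rewrite -ge' => vw kvw.
  have [/(_ (_, _) (conj vw erefl))[j _ kj] _ _] := lA _ Dv.
  have := sP _ _ vw (esym kj); rewrite !symVE !sym_invK kvw => -[->].
  by rewrite symK -kj.
- have [s Fs sP] := g2 _ Dv; exists s^-1%g; first exact: permgroupV.
  move=> w i; rewrite -ge' => vw kvw.
  have [/(_ (_, _) (conj vw erefl))[j _ kj] _ _] := lB _ Dv.
  have := sP _ _ vw (esym kj); rewrite !symVE !sym_invK kvw => -[->].
  by rewrite symK -kj.
Qed.

Definition universal_permgroup : permgroup T :=
  Permgroup is_universal1 is_universalM is_universalV.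

Definition universal_group : topologicalGroupType :=
  @pointwise_group T universal_permgroup [set: T] (fun _ _ _ _ => I).

End UniversalGroup.

Section Dendrites.
Variables (R : realType) (D : topologicalType).

Definition is_metrizable : Prop :=
  exists (M : metricType R) (f : D -> M), is_homeomorphism f.

Definition is_locally_connected : Prop :=
  forall (x : D) (U : set D), nbhs x U ->
    exists V : set D, [/\ open V, connected V, V x & V `<=` U].

Definition unit_interval : topologicalType := set_type `[0%R : R, 1%R].

Definition is_arc (x y : D) (A : set D) : Prop :=
  exists f : unit_interval -> D,
    [/\ topological_embedding f, range f = A,
        forall t, val t = 0%R -> f t = x & forall t, val t = 1%R -> f t = y].

Definition is_dendrite : Prop :=
  [/\ compact [set: D], is_metrizable, connected [set: D],
      is_locally_connected &
      forall x y : D, x != y -> exists! A : set D, is_arc x y A].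

Definition component (b x : D) : set D := connected_component (~` [set b]) x.

Definition components_at (b : D) : set (set D) :=
  [set component b x | x in ~` [set b]].

Definition separates (b x y : D) : Prop :=
  [/\ x != b, y != b & component b x != component b y].

Definition branch_point : set D := [set b | (`I_3 #<= components_at b)%card].

(* A one-point space vacuously satisfies the other clauses; it is not the
   dendrite D_oo. *)
Definition is_D_infty : Prop :=
  [/\ is_dendrite,
      exists x y : D, x != y,
      forall b, branch_point b -> infinite_set (components_at b) &
      forall x y A, is_arc x y A -> A `&` branch_point !=set0].

(* The values of [k b C] are irrelevant unless [b] is a branch point and [C] a
   component of its complement. *)
Definition is_kaleidoscopic (k : D -> set D -> Omega) : Prop :=
  (forall b, branch_point b -> set_bij (components_at b) [set: Omega] (k b)) /\
  (forall b1 b2 (i j : Omega),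
    branch_point b1 -> branch_point b2 -> b1 != b2 -> i != j ->
    exists b, [/\ branch_point b, separates b b1 b2,
      k b (component b b1) = i & k b (component b b2) = j]).

End Dendrites.

Record kaleidoscope (R : realType) := Kaleidoscope {
  kspace :> topologicalType;
  kcolor : kspace -> set kspace -> Omega;
  kspace_D_infty : is_D_infty R kspace;
  kcolor_kaleidoscopic : is_kaleidoscopic kcolor
}.

Section KaleidoscopicGroup.
Variables (R : realType) (D : kaleidoscope R) (F : permgroup Omega).
Local Notation k := (@kcolor R D).

Definition is_homeo (g : sym D) : Prop :=
  continuous g /\ continuous (g^-1%g : sym D).

Definition is_kaleidoscopic_homeo (g : sym D) : Prop :=
  is_homeo g /\
  forall b : D, branch_point b -> exists2 s : sym Omega, F s &
    forall C, components_at b C -> k (g b) (g @` C) = s (k b C).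

Lemma image_sym_inv (g : sym D) (A : set D) : (g^-1)%g @` (g @` A) = A.
Proof.
apply/seteqP; split => [_ [_ [x Ax <-] <-]|x Ax].
  by rewrite symVE symK.
by exists (g x); [exists x|rewrite symVE symK].
Qed.

Lemma image_sym_invK (g : sym D) (A : set D) : g @` ((g^-1)%g @` A) = A.
Proof. by rewrite -{1}(invgK g) image_sym_inv. Qed.

Lemma is_homeoV g : is_homeo g -> is_homeo g^-1%g.
Proof. by move=> [gc gc']; split => //; rewrite invgK. Qed.

Lemma homeo_component_sub g b x : is_homeo g -> x <> b ->
  g @` component b x `<=` component (g b) (g x).
Proof.
move=> [gc _] xb; apply: connected_component_max.
- by exists x => //; exact: connected_component_refl.
- move=> _ [y /connected_component_sub/= yb <-] /= gyb.
  by apply: yb; exact: (can_inj (symK g)).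
- apply: connected_continuous_connected (continuous_subspaceT gc).
  exact: component_connected.
Qed.

Lemma homeo_component g b x : is_homeo g -> x <> b ->
  g @` component b x = component (g b) (g x).
Proof.
move=> gh xb; apply/seteqP; split; first exact: homeo_component_sub.
have gxb : g x <> g b by move=> /(can_inj (symK g)).
have := homeo_component_sub (is_homeoV gh) gxb; rewrite !symVE !symK.
by move=> /(@image_subset _ _ g); rewrite image_sym_invK.
Qed.

Lemma homeo_components_at g b C : is_homeo g ->
  components_at b C -> components_at (g b) (g @` C).
Proof.
move=> gh [x /= xb <-]; rewrite homeo_component //; exists (g x) => //=.
by move=> /(can_inj (symK g)).
Qed.

Lemma homeo_branch_point g b : is_homeo g ->
  branch_point b -> branch_point (g b).
Proof.
move=> gh /card_le_trans; apply.
have gI : {in components_at b &, injective (fun C => g @` C)}.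
  by move=> C C' _ _ e; rewrite -(image_sym_inv g C) e image_sym_inv.
have /card_eqPle[_ /card_le_trans] := inj_card_eq gI; apply.
by apply: subset_card_le => _ [C bC <-]; exact: homeo_components_at.
Qed.

Lemma is_kaleidoscopic_homeo1 : is_kaleidoscopic_homeo 1%g.
Proof.
split; first by split=> x; exact: cvg_id.
move=> b _; exists 1%g; first exact: permgroup1.
by move=> C _; rewrite image_id.
Qed.

Lemma is_kaleidoscopic_homeoM f g : is_kaleidoscopic_homeo f ->
  is_kaleidoscopic_homeo g -> is_kaleidoscopic_homeo (f * g)%g.
Proof.
move=> [[fc fc'] fk] [gh gk]; split.
  split => x; first exact: continuous_comp (gh.1 _) (fc _).
  exact: continuous_comp (fc' _) (gh.2 _).
move=> b bb; have [s Fs sP] := gk _ bb.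
have [t Ft tP] := fk _ (homeo_branch_point gh bb).
exists (t * s)%g; first exact: permgroupM.
move=> C bC; rewrite !symME -sP// -tP ?image_comp//.
exact: homeo_components_at.
Qed.

Lemma is_kaleidoscopic_homeoV g :
  is_kaleidoscopic_homeo g -> is_kaleidoscopic_homeo g^-1%g.
Proof.
move=> [gh gk]; have gh' := is_homeoV gh; split => // b bb.
have [s Fs sP] := gk _ (homeo_branch_point gh' bb).
exists s^-1%g; first exact: permgroupV.
move=> C bC; apply: (can_inj (symK s)).
rewrite -sP; last exact: homeo_components_at.
by rewrite image_sym_invK !symVE !sym_invK.
Qed.

Definition kaleidoscopic_permgroup : permgroup D :=
  Permgroup is_kaleidoscopic_homeo1 is_kaleidoscopic_homeoM
    is_kaleidoscopic_homeoV.

Lemma kaleidoscopic_branch_point g : kaleidoscopic_permgroup g ->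
  forall x, branch_point x -> branch_point (g x).
Proof. by move=> [gh _] x; exact: homeo_branch_point. Qed.

Definition kaleidoscopic_group : topologicalGroupType :=
  pointwise_group kaleidoscopic_branch_point.

End KaleidoscopicGroup.

Definition Homeo_plus_rabbit n (T : colored_tree n) : topologicalGroupType :=
  universal_group T (Cyc n) AutO.

Definition Homeo_plus_airplane (R : realType) (D : kaleidoscope R) :
    topologicalGroupType :=
  kaleidoscopic_group D AutO.

(* Main.v *)
From HB Require Import structures.
Require Import Defs.
From mathcomp Require Import all_boot all_order all_algebra all_fingroup.
From mathcomp Require Import ring_quotient ring lra zify.
From mathcomp Require Import all_classical all_reals all_analysis.
From mathcomp Require finmap.

Set Implicit Arguments.
Unset Strict Implicit.
Unset Printing Implicit Defensive.

Import Order.TTheory GRing.Theory Num.Theory numFieldNormedType.Exports.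

Local Open Scope quotient_scope.
Local Open Scope classical_set_scope.

(** The three groups are automorphism groups of trees that carry a cyclic order
    on the directions at each vertex.  As [Cyc n] and [AutO] are transitive,
    colorings only matter up to local permutations: a tree whose stars are
    labelled by [n] and [Omega] in an arbitrary way can be matched, vertex by
    vertex from a root, with any legally colored tree ([full_tree_iso]).  To
    embed the group [G] of the [n]-regular rabbit, it therefore suffices to
    enlarge its tree, compatibly with [G], to a structure of the kind on which
    the target group acts.

    For the [m]-regular rabbit with [m = d * n], the [n] edges at a vertex of
    class A get the labels divisible by [d], and a rotation by [r] becomes a
    rotation by [d * r].  For the basilica, every edge is subdivided, all old
    vertices get the infinite type, the [m] edges at an old vertex of class A
    sit at the points [i / m] of the circle, and a rotation by [r / m] turns
    them.  In both cases the local actions form a cocycle that is also defined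
    on the missing labels; a copy of one and the same rigid branch is hung at
    each missing label, and the cocycle says how these copies are permuted
    ([hanging_embedding]).

    For the airplane, the branch points of the dendrite, with the color of the
    component of [x] as the direction of [x] at [b], form a countable dense tree
    with cyclic orders ([branch_tree]).  Such a tree is unique by back and forth
    ([planar_tree_unique]), and its automorphisms extend to homeomorphisms
    ([extend_automorphism]), because a point of the dendrite is determined by
    its directions at the branch points.  Another tree of this kind, on which
    the group of the basilica acts, is made from the colored tree [T] as follows
    ([glued_tree]): fix [b0 <> b1] in a dense tree, keep the vertices of [T] of
    infinite degree and replace each edge by a copy of the region strictly
    between [b0] and [b1], with [b0] at the end of infinite degree.  The end of
    degree two is dropped, so that the two copies which meet there are exchanged
    by the flips of [T] without any further choice.

    All topologies are topologies of pointwise convergence, and each point of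
    the enlarged structure is moved in a way that depends on finitely many
    vertices, whence the topological embeddings ([pointwise_embedding]). *)

(** * The cyclic order of Q/Z *)

Section CyclicOrder.
Local Open Scope ring_scope.

Definition qz (x : rat) : Omega := \pi_Omega x.

Lemma qz_eq x y : qz x = qz y <-> x - y \is a Num.int.
Proof.
have := Quotient.idealrBE (GRing.ZmodClosed.clone rat (@Num.int_num_subdef rat) _) x y.
by move=> E; split=> [/eqP|] H; [rewrite E|apply/eqP; rewrite -E].
Qed.

(** The representative in [0, 1). *)
Definition qrep (a : Omega) : rat :=
  generic_quotient.repr a - (Num.floor (generic_quotient.repr a))%:~R.

Lemma qrep_ge0 a : 0 <= qrep a.
Proof. by rewrite subr_ge0 floor_le_tmp. Qed.

Lemma qrep_lt1 a : qrep a < 1.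
Proof. by rewrite ltrBlDl -[X in _ + X]/(1%:~R) -intrD; exact: floorD1_gt. Qed.

Lemma qrepK : cancel qrep qz.
Proof.
move=> a; rewrite -[RHS]reprK; apply/qz_eq.
rewrite /qrep addrAC subrr add0r rpredN; exact: intr_int.
Qed.

Lemma int_small (x : rat) : x \is a Num.int -> -1 < x -> x < 1 -> x = 0.
Proof.
move=> /intrP[m ->]; rewrite -[-1]/((-1)%:~R) -[1]/(1%:~R) !ltr_int => h1 h2.
by have -> : m = 0 by lia.
Qed.

Lemma qzK x : 0 <= x -> x < 1 -> qrep (qz x) = x.
Proof.
move=> x0 x1; apply/eqP; rewrite -subr_eq0; apply/eqP; apply: int_small.
- by apply/qz_eq; rewrite qrepK.
- by have := qrep_ge0 (qz x); lra.
- by have := qrep_lt1 (qz x); lra.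
Qed.

Lemma qrep_inj : injective qrep. Proof. exact: can_inj qrepK. Qed.

Lemma qz_shift (x : rat) (m : int) : qz (x + m%:~R) = qz x.
Proof. by apply/qz_eq; rewrite addrAC subrr add0r intr_int. Qed.

(** The translates of representatives that occur in the definition can be pushed
    into [0, 1), where they wrap around at most once. *)
Lemma cyclicE a b c : cyclic_order a b c <->
  [\/ qrep a < qrep b /\ qrep b < qrep c,
      qrep b < qrep c /\ qrep c < qrep a |
      qrep c < qrep a /\ qrep a < qrep b].
Proof.
have pK := qrepK.
split.
  case=> [x [y [z [[xy yz zx] [<- <- <-]]]]].
  set m := Num.floor x.
  have h1 : m%:~R <= x by exact: floor_le_tmp.
  have h2 : x < (m + 1)%:~R by exact: floorD1_gt.
  rewrite -/(qz x) -/(qz y) -/(qz z).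
  rewrite intrD in h2.
  have E u : qz u = qz (u - m%:~R).
    by rewrite -(qz_shift (u - m%:~R) m) addrNK.
  have E1 u : qz u = qz (u - m%:~R - 1) by rewrite E -(qz_shift (_ - 1) 1) addrNK.
  have fx : qrep (qz x) = x - m%:~R by rewrite E qzK//; lra.
  have F u : x < u -> u < x + 1 ->
      (u - m%:~R < 1 /\ qrep (qz u) = u - m%:~R) \/
      (1 <= u - m%:~R /\ qrep (qz u) = u - m%:~R - 1).
    move=> xu ux; case: (ltP (u - m%:~R) 1) => h; [left|right]; split=> //.
      by rewrite E qzK//; lra.
    by rewrite E1 qzK//; lra.
  rewrite fx.
  case: (F y) => [||[hy ->]|[hy ->]]; [lra|lra| |];
  case: (F z) => [||[hz ->]|[hz ->]]; try lra;
  [apply: Or31|apply: Or33|apply: Or32]; lra.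
have := qrep_lt1 a; have := qrep_lt1 b; have := qrep_lt1 c.
have := qrep_ge0 a; have := qrep_ge0 b; have := qrep_ge0 c.
move=> a0 b0 c0 a1 b1 c1 [] [h1 h2].
- by exists (qrep a), (qrep b), (qrep c); split; split; [lra|lra|lra|exact: pK..].
- exists (qrep a), (qrep b + 1), (qrep c + 1); split; split; [lra|lra|lra|exact: pK| |].
  + by rewrite -[RHS]pK -(qz_shift _ 1).
  + by rewrite -[RHS]pK -(qz_shift _ 1).
- exists (qrep a), (qrep b), (qrep c + 1).
  split; split; [lra|lra|lra|exact: pK|exact: pK|].
  by rewrite -[RHS]pK -(qz_shift _ 1).
Qed.

Local Notation cyc := cyclic_order.

Lemma cyclic_rot a b c : cyc a b c -> cyc b c a.
Proof. by rewrite !cyclicE => -[] [h1 h2]; [apply: Or33|apply: Or31|apply: Or32]. Qed.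

Lemma cyclic_asym a b c : cyc a b c -> ~ cyc a c b.
Proof. by rewrite !cyclicE => -[] [h1 h2] [] [h3 h4]; lra. Qed.

Lemma cyclic_neq a b c : cyc a b c -> [/\ a <> b, b <> c & a <> c].
Proof.
by rewrite cyclicE => H; split=> e; move: H; rewrite e; case=> -[]; rewrite ?ltxx//; lra.
Qed.

Lemma cyclic_trans a b c d : cyc a b c -> cyc a c d -> cyc a b d.
Proof.
rewrite !cyclicE => -[] [h1 h2] [] [h3 h4]; try lra;
by [apply: Or31; lra|apply: Or32; lra|apply: Or33; lra].
Qed.

Lemma qrep_lt_total a b : a <> b -> qrep a < qrep b \/ qrep b < qrep a.
Proof.
by move=> ab; case: (ltgtP (qrep a) (qrep b)) => [||/qrep_inj//]; [left|right].
Qed.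

Lemma cyclic_total a b c : a <> b -> b <> c -> a <> c -> cyc a b c \/ cyc a c b.
Proof.
move=> /qrep_lt_total ab /qrep_lt_total bc /qrep_lt_total ac; rewrite !cyclicE.
case: ab bc ac => [] ? [] ? [] ?; try lra;
by [left; apply: Or31; lra|left; apply: Or32; lra|left; apply: Or33; lra|
  right; apply: Or31; lra|right; apply: Or32; lra|right; apply: Or33; lra].
Qed.

Lemma cyclic_dense a b : a <> b -> exists c, cyc a c b.
Proof.
move=> ab; have a0 := qrep_ge0 a; have b0 := qrep_ge0 b.
have a1 := qrep_lt1 a; have b1 := qrep_lt1 b.
case: (qrep_lt_total ab) => h; clear ab.
  exists (qz ((qrep a + qrep b) / 2%:R)); rewrite cyclicE qzK; try lra.
  by apply: Or31; lra.
exists (qz ((qrep a + 1) / 2%:R)); rewrite cyclicE qzK; try lra.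
by apply: Or33; lra.
Qed.

Lemma neq_Omega (a : Omega) : exists b : Omega, b <> a.
Proof.
case: (eqVneq (qrep a) 0) => h.
  by exists (qz (1/2%:R)) => e; move: h; rewrite -e qzK; lra.
by exists (qz 0) => e; move: h; rewrite -e qzK ?eqxx//; lra.
Qed.

Definition translate_fun (t : rat) (a : Omega) : Omega := qz (qrep a + t).

Lemma translate_funE t x : translate_fun t (qz x) = qz (x + t).
Proof.
apply/qz_eq; have /qz_eq := qrepK (qz x).
by congr (_ \is a _); ring.
Qed.

Lemma translate_funK t : cancel (translate_fun t) (translate_fun (- t)).
Proof. by move=> a; rewrite -[a]qrepK !translate_funE addrK. Qed.

Lemma translate_funKV t : cancel (translate_fun (- t)) (translate_fun t).
Proof. by move=> a; rewrite -[a]qrepK !translate_funE addrNK. Qed.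

Definition translate t : sym Omega := Defs.Sym (translate_funK t) (translate_funKV t).

Lemma translateE t x : translate t (qz x) = qz (x + t).
Proof. exact: translate_funE. Qed.

Lemma translate_cyclic t a b c :
  cyc a b c -> cyc (translate t a) (translate t b) (translate t c).
Proof.
case=> [x [y [z [[xy yz zx] [<- <- <-]]]]].
exists (x + t), (y + t), (z + t); rewrite !translateE.
by split; split; [lra|lra|lra|by []..].
Qed.

Lemma translate_aut t : AutO (translate t).
Proof.
move=> a b c; split; first exact: translate_cyclic.
move=> /(@translate_cyclic (- t)).
by rewrite /= !translate_funK.
Qed.

Lemma AutO_transitive a b : exists2 s : sym Omega, AutO s & s a = b.
Proof.
exists (translate (qrep b - qrep a)); first exact: translate_aut.
by rewrite -[a in LHS]qrepK translateE qrepK addrCA subrr addr0 qrepK.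
Qed.

Definition partial_cyclic_iso (s : seq (Omega * Omega)) :=
  (forall p q, p \in s -> q \in s -> p.1 = q.1 <-> p.2 = q.2) /\
  (forall p q r, p \in s -> q \in s -> r \in s ->
    cyc p.1 q.1 r.1 <-> cyc p.2 q.2 r.2).

(** The last element of a finite list before [a] in the cyclic order; its image
    tells where the image of [a] has to be placed. *)
Lemma predecessor_exists (a : Omega) (s : seq (Omega * Omega)) :
  s != [::] -> (forall p, p \in s -> p.1 <> a) ->
  exists2 p, p \in s & forall q, q \in s -> ~ cyc p.1 q.1 a.
Proof.
elim: s => // x s IH _ H.
have [->|s0] := eqVneq s [::].
  exists x; rewrite ?inE// => q; rewrite inE => /eqP->.
  by move=> /cyclic_neq[].
have [p ps pP] := IH s0 (fun p ps => H p (mem_behead (s := _ :: _) ps)).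
case: (pselect (cyc p.1 x.1 a)) => h; last first.
  exists p; first by rewrite inE ps orbT.
  by move=> q; rewrite inE => /orP[/eqP->//|/pP].
exists x; first by rewrite inE eqxx.
move=> q; rewrite inE => /orP[/eqP->/cyclic_neq[]//|qs c].
apply: (pP _ qs); apply: cyclic_rot.
exact: cyclic_trans (cyclic_rot (cyclic_rot h)) (cyclic_rot (cyclic_rot c)).
Qed.

(** The other half of the placement: right after [p] there is room before any
    element of a finite list. *)
Lemma gap_exists (p : Omega) (s : seq Omega) :
  exists2 a, a <> p & forall x, x \in s -> x <> a /\ ~ cyc p x a.
Proof.
elim: s => [|x s [a ap aP]]; first by have [b] := neq_Omega p; exists b.
case: (pselect (x = p)) => [->|xp].
  exists a => // y; rewrite inE => /orP[/eqP->|/aP//].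
  by split; [exact/nesym|move/cyclic_neq => []].
case: (pselect (x = a \/ cyc p x a)) => [h|/not_orP[h1 h2]]; last first.
  by exists a => // y; rewrite inE => /orP[/eqP->|/aP].
have [b pbx] := cyclic_dense (nesym xp).
have [/nesym bp /nesym xb _] := cyclic_neq pbx.
have pba : cyc p b a.
  by case: h => [<-//|h]; apply: cyclic_trans h.
exists b => // y; rewrite inE => /orP[/eqP->|ys].
  by split=> //; exact: cyclic_asym.
have [ya nc] := aP _ ys; split=> [yb|c]; first by rewrite -yb in pba.
by apply: nc; exact: cyclic_trans c pba.
Qed.

(** The position of [a] relative to a list is determined by the predecessor of
    [a] in it, since going around from [a] meets the predecessor last. *)
Lemma predecessor_cyclicE (a p x y : Omega) : a <> p -> x <> a -> y <> a ->
  ~ cyc p x a -> ~ cyc p y a ->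
  cyc a x y <-> [/\ x <> y, x <> p & y = p \/ cyc p x y].
Proof.
move=> ap xa ya hx hy; split.
  move=> c; have [ax xy ay] := cyclic_neq c.
  have xp : x <> p.
    by move=> e; apply: hy; rewrite -e; exact: cyclic_rot.
  split=> //; case: (pselect (y = p)) => [|yp]; [by left|right].
  have [//|] := cyclic_total (nesym xp) xy (nesym yp).
  move=> /cyclic_rot c'; case: hy.
  apply: cyclic_rot; apply: cyclic_rot.
  exact: cyclic_trans (cyclic_rot (cyclic_rot c)) c'.
case=> xy xp [->|c].
  have [//|c] := cyclic_total (nesym xa) xp ap.
  by case: hx; exact: cyclic_rot.
have yp : y <> p by move=> e; have [_ _] := cyclic_neq c; rewrite e.
case: (cyclic_total (nesym xa) xy (nesym ya)) => // c'.
have h : cyc p a x by case: (cyclic_total (nesym ap) (nesym xa) (nesym xp)).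
case: (cyclic_asym (cyclic_trans (cyclic_rot c) (cyclic_rot (cyclic_rot h)))).
exact: cyclic_rot (cyclic_rot c').
Qed.

(** Homogeneity of the cyclic order: the image of [a] is put right after the
    image of the predecessor of [a]. *)
Lemma partial_cyclic_iso_extend (s : seq (Omega * Omega)) a :
  partial_cyclic_iso s -> (forall p, p \in s -> p.1 <> a) ->
  exists2 a', (forall p, p \in s -> p.2 <> a') &
    partial_cyclic_iso ((a, a') :: s).
Proof.
move=> [sE sC] sa.
have [a' a'P a'C] : exists2 a', (forall p, p \in s -> p.2 <> a') &
    forall p q, p \in s -> q \in s -> cyc a p.1 q.1 <-> cyc a' p.2 q.2.
  have [s0|s0] := eqVneq s [::].
    by exists a; rewrite s0.
  have [p ps pP] := predecessor_exists s0 sa.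
  have [a' a'p a'P] := gap_exists p.2 [seq q.2 | q <- s].
  have a'P' q : q \in s -> q.2 <> a' /\ ~ cyc p.2 q.2 a'.
    by move=> qs; apply: a'P; exact: map_f.
  exists a' => [q /a'P'[]//|q r qs rs].
  have E1 := @predecessor_cyclicE a p.1 q.1 r.1 (nesym (sa _ ps)) (sa _ qs)
    (sa _ rs) (pP _ qs) (pP _ rs).
  have [h1 h2] := a'P' _ qs; have [h3 h4] := a'P' _ rs.
  have E2 := @predecessor_cyclicE a' p.2 q.2 r.2 a'p h1 h3 h2 h4.
  rewrite {}E1 {}E2.
  split=> -[e1 e2 e3]; split.
  - by move/(sE _ _ qs rs).
  - by move/(sE _ _ qs ps).
  - by case: e3 => [/(sE _ _ rs ps)|/(sC _ _ _ ps qs rs)]; [left|right].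
  - by move/(sE _ _ qs rs).
  - by move/(sE _ _ qs ps).
  - by case: e3 => [/(sE _ _ rs ps)|/(sC _ _ _ ps qs rs)]; [left|right].
exists a' => //; split=> [p q|p q r]; rewrite !inE.
  move=> /orP[/eqP->|ps] /orP[/eqP->|qs] //=.
  - by split=> e; [case: (sa _ qs)|case: (a'P _ qs)].
  - by split=> e; [case: (sa _ ps)|case: (a'P _ ps)].
  - exact: sE.
have F (u v : Omega) : ~ cyc u u v by move/cyclic_neq => -[].
have F2 (u v : Omega) : ~ cyc u v v by move/cyclic_neq => -[].
have F3 (u v : Omega) : ~ cyc u v u by move/cyclic_neq => -[].
move=> /orP[/eqP->|ps] /orP[/eqP->|qs] /orP[/eqP->|rs] //=; try by split=> [/F|/F].
- by split=> [/F3|/F3].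
- exact: a'C.
- by split=> [/F2|/F2].
- have [h h'] := a'C _ _ rs ps; split=> c; apply: cyclic_rot; apply: cyclic_rot.
    by apply: h; exact: cyclic_rot.
  by apply: h'; exact: cyclic_rot.
- have [h h'] := a'C _ _ ps qs; split=> c; apply: cyclic_rot.
    by apply: h; exact: cyclic_rot (cyclic_rot c).
  by apply: h'; exact: cyclic_rot (cyclic_rot c).
- exact: sC.
Qed.

End CyclicOrder.

(** * Embeddings of groups with a pointwise topology *)

Lemma set_val_continuous (X : topologicalType) (A : set X) :
  continuous (fun x : A => val x).
Proof. exact: initial_continuous. Qed.

Lemma corestrict_continuous (X Y : topologicalType) (f : X -> Y) :
  continuous f -> continuous (corestrict f).
Proof. by move=> fc; apply: continuous_comp_initial. Qed.

(** A homeomorphism onto the image is an injection that induces the topology. *)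
Lemma initial_topological_embedding (X Y : topologicalType) (f : X -> Y) :
  injective f -> continuous f ->
  continuous (id : initial_topology f -> X) -> topological_embedding f.
Proof.
move=> fI fc idc; split; first exact: corestrict_continuous.
have inv (z : range f) : exists x, f x = val z.
  by have /set_mem[x _ e] := valP z; exists x.
pose J z : initial_topology f := projT1 (cid (inv z)).
have JK z : f (J z) = val z by exact: (projT2 (cid (inv z))).
exists J; split=> [x|z|].
- by apply: fI; rewrite JK.
- by apply: val_inj; rewrite /= JK.
have Jc : continuous J.
  apply: continuous_comp_initial.
  have -> : f \o J = (fun z => val z) by apply/funext => z; exact: JK.
  exact: set_val_continuous.
by move=> z; exact: continuous_comp (Jc z) (idc (J z)).
Qed.

Section PointwiseEmbedding.
Variables (X X' : choiceType) (G : permgroup X) (G' : permgroup X').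
Variables (Y : set X) (Y' : set X').
Variables (GY : forall g, G g -> forall x, Y x -> Y (g x)).
Variables (GY' : forall g, G' g -> forall x, Y' x -> Y' (g x)).
Variable Phi : pointwise_group GY -> pointwise_group GY'.

Hypothesis Phi_finite : forall y', Y' y' -> exists2 s : seq X,
  (forall x, x \in s -> Y x) &
  forall g h : pointwise_group GY, (forall x, x \in s -> val g x = val h x) ->
    val (Phi g) y' = val (Phi h) y'.
Hypothesis Phi_determined : forall y, Y y -> exists2 y', Y' y' &
  forall g h : pointwise_group GY, val (Phi g) y' = val (Phi h) y' -> val g y = val h y.
Hypothesis Y_determines : forall g h : pointwise_group GY,
  (forall y, Y y -> val g y = val h y) -> g = h.

(** Continuity only needs that the image at one point is known from finitely many
    values, and continuity of the inverse that each value can be read off from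
    the image at one point. *)
Lemma pointwise_embedding :
  {morph Phi : x y / (x * y)%g} -> topological_group_embedding Phi.
Proof.
move=> PhiM.
have Phi_inj : injective Phi.
  move=> g h e; apply: Y_determines => y Yy.
  by have [y' _] := Phi_determined Yy; apply; rewrite e.
split=> //; apply: initial_topological_embedding => //.
  apply: (@continuous_evaluations _ _ _ GY' _ Phi) => y' g U.
  rewrite nbhs_principalE => Ug.
  have [s sY sP] := Phi_finite (set_mem (valP y')).
  have : nbhs g [set h : pointwise_group GY | forall x, x \in s -> val h x = val g x].
    elim: s sY {sP} => [|x s IH] sY; first exact: filterE.
    have Yx : Y x by apply: sY; rewrite inE eqxx.
    have := near_evaluation (SigSub (mem_set Yx) : Y) g.
    have := IH (fun x xs => sY x (mem_behead (s := _ :: _) xs)).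
    apply: filterS2 => h h1 h2 z; rewrite inE => /orP[/eqP->//|]; exact: h1.
  apply: filterS => h /sP; move: Ug.
  by move=> /principal_filterP Ug e; rewrite -e in Ug.
apply: (@continuous_evaluations _ _ _ GY (initial_topology Phi) id) => y g U.
rewrite nbhs_principalE => /principal_filterP Ug.
have [y' Yy' H] := Phi_determined (set_mem (valP y)).
have N := near_evaluation (SigSub (mem_set Yy') : Y') (Phi g).
have N' := @initial_continuous _ _ Phi g _ N.
apply: (@filterS _ (nbhs (g : initial_topology Phi)) _ _ _ _ N') => h /= e.
by suff -> : val h (val y) = val g (val y) by []; exact: H.
Qed.

End PointwiseEmbedding.

(** * Dense trees with cyclic orders on the directions *)

(** [m] lies on the segment from [x] to [y], ends included. *)
Definition btw (X L : Type) (dir : X -> X -> L) (m x y : X) :=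
  [\/ m = x, m = y | dir m x <> dir m y].

(** The abstract form of a set of branch points: [dir b x] is the direction in
    which [x] is seen from [b], and its value at [x = b] is meaningless. *)
Record planar_tree := PlanarTree {
  point_of :> choiceType;
  dir : point_of -> point_of -> Omega;
  dir_across : forall b c x, b <> c -> x <> b -> dir b x <> dir b c ->
    dir c x = dir c b;
  dir_dense : forall x y, x <> y -> exists b, [/\ b <> x, b <> y & dir b x <> dir b y];
  dir_median : forall x y z, exists m,
    [/\ btw dir m x y, btw dir m y z & btw dir m x z];
  dir_surj : forall b i, exists2 x, x <> b & dir b x = i;
  planar_tree_countable : exists h : point_of -> nat, injective h;
  planar_tree_inhabited : inhabited point_of
}.

Lemma partial_cyclic_iso_sub s s' : {subset s' <= s} ->
  partial_cyclic_iso s -> partial_cyclic_iso s'.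
Proof.
move=> ss' [h1 h2]; split=> [p q ps qs|p q r ps qs rs].
  by apply: h1; exact: ss'.
by apply: h2; exact: ss'.
Qed.

Lemma partial_cyclic_iso2 (u u' v v' : Omega) : u <> v -> u' <> v' ->
  partial_cyclic_iso [:: (u, u'); (v, v')].
Proof.
move=> uv uv'; split=> [p q|p q r]; rewrite !inE.
  by move=> /orP[]/eqP-> /orP[]/eqP-> /=; split=> // e; exfalso; auto.
have F (a b c : Omega) : [\/ a = b, b = c | a = c] -> ~ cyclic_order a b c.
  by move=> H /cyclic_neq[n1 n2 n3]; case: H.
move=> /orP[]/eqP-> /orP[]/eqP-> /orP[]/eqP-> /=; split=> c; exfalso; move: c; apply: F;
  by [apply: Or31|apply: Or32|apply: Or33].
Qed.

Lemma partial_cyclic_iso1 (u u' : Omega) : partial_cyclic_iso [:: (u, u')].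
Proof.
split=> [p q|p q r]; rewrite !inE => /eqP-> /eqP-> //= /eqP->.
by split=> /cyclic_neq[].
Qed.

Lemma seq_argmin (I : eqType) (f : I -> nat) (s : seq I) : s != [::] ->
  exists2 b, b \in s & forall c, c \in s -> (f b <= f c)%N.
Proof.
elim: s => // x s IH _; have [->|s0] := eqVneq s [::].
  by exists x; rewrite ?inE// => c; rewrite inE => /eqP->.
have [b bs bP] := IH s0; have [h|h] := leqP (f x) (f b).
  exists x; rewrite ?inE ?eqxx// => c; rewrite inE => /orP[/eqP->//|/bP].
  exact: leq_trans h.
exists b; first by rewrite inE bs orbT.
by move=> c; rewrite inE => /orP[/eqP->|/bP//]; exact: ltnW.
Qed.

Lemma count_lt (I : eqType) (P Q : pred I) (s : seq I) x :
  {in s, subpred P Q} -> x \in s -> Q x -> ~~ P x -> (count P s < count Q s)%N.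
Proof.
move=> PQ xs Qx nPx; elim: s PQ xs => // y s IH PQ; rewrite inE.
have leq : (count P s <= count Q s)%N.
  rewrite (_ : count P s = count (predI P Q) s); first by apply: sub_count => z /andP[].
  apply: eq_in_count => z zs /=.
  by apply/idP/andP => [Pz|[]//]; split=> //; apply: PQ; rewrite ?inE ?zs ?orbT.
have hy : (P y <= Q y)%N.
  by case: (P y) (PQ y) => //; rewrite inE eqxx => /(_ isT isT) ->.
move=> /orP[/eqP e|xs] /=.
  by subst y; rewrite Qx (negPf nPx) add0n add1n ltnS.
by rewrite -addnS leq_add// IH// => z zs; apply: PQ; rewrite inE zs orbT.
Qed.

Section PartialIsomorphisms.
Variables M N : planar_tree.
Implicit Types (s : seq (M * N)) (p q r : M * N).

(** The matching of the directions at [p] that [s] induces. *)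
Definition star s p : seq (Omega * Omega) :=
  [seq (dir p.1 q.1, dir p.2 q.2) | q <- s & q.1 != p.1].

Definition partial_iso s :=
  (forall p q, p \in s -> q \in s -> p.1 = q.1 <-> p.2 = q.2) /\
  (forall p, p \in s -> partial_cyclic_iso (star s p)).

Definition median_closed s := forall p q r, p \in s -> q \in s -> r \in s ->
  exists2 m, m \in s & [/\ btw (@dir M) m.1 p.1 q.1, btw (@dir M) m.1 q.1 r.1 &
                         btw (@dir M) m.1 p.1 r.1].

Lemma star_in s p q : q \in s -> q.1 <> p.1 -> (dir p.1 q.1, dir p.2 q.2) \in star s p.
Proof.
move=> qs /eqP n; apply/mapP; exists q => //.
by rewrite mem_filter n.
Qed.

Lemma partial_iso_dir s p q r : partial_iso s -> p \in s -> q \in s -> r \in s ->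
  q.1 <> p.1 -> r.1 <> p.1 ->
  dir p.1 q.1 = dir p.1 r.1 <-> dir p.2 q.2 = dir p.2 r.2.
Proof.
move=> [_ sP] ps qs rs qp rp; have [E _] := sP p ps.
exact: (E _ _ (star_in qs qp) (star_in rs rp)).
Qed.

Lemma median_closed_cons s x : median_closed s ->
  (forall q r, q \in s -> r \in s -> exists2 m, m \in x :: s &
    [/\ btw (@dir M) m.1 x.1 q.1, btw (@dir M) m.1 q.1 r.1 & btw (@dir M) m.1 x.1 r.1]) ->
  median_closed (x :: s).
Proof.
have sym m u v : btw (@dir M) m u v -> btw (@dir M) m v u.
  by case=> [->|->|n]; [apply: Or32|apply: Or31|apply: Or33; exact/nesym].
move=> cl H p q r; rewrite !inE.
have xs : x \in x :: s by rewrite inE eqxx.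
move=> /orP[/eqP->|ps] /orP[/eqP->|qs] /orP[/eqP->|rs].
- by exists x => //; split; apply: Or31.
- by exists x => //; split; apply: Or31.
- by exists x => //; split; [apply: Or31|apply: Or32|apply: Or31].
- exact: H.
- by exists x => //; split; [apply: Or32|apply: Or31|apply: Or32].
- have [m ms [h1 h2 h3]] := H _ _ ps rs.
  by exists m => //; split=> //; exact: sym.
- have [m ms [h1 h2 h3]] := H _ _ ps qs.
  by exists m => //; split=> //; exact: sym.
- have [m ms h] := cl _ _ _ ps qs rs.
  by exists m => //; rewrite inE ms orbT.
Qed.

(** Adding a pair leaves the star of [p] unchanged if the new points are seen
    from [p] in directions that are already matched. *)
Lemma partial_iso_cons s x y : partial_iso s ->
  (forall q, q \in s -> q.1 <> x /\ q.2 <> y) ->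
  (forall p, p \in s -> (dir p.1 x, dir p.2 y) \in star s p \/
     partial_cyclic_iso ((dir p.1 x, dir p.2 y) :: star s p)) ->
  partial_cyclic_iso [seq (dir x q.1, dir y q.2) | q <- s] ->
  partial_iso ((x, y) :: s).
Proof.
move=> [sE sP] nxy H Hx; split=> [p q|p]; rewrite !inE.
  move=> /orP[/eqP->|ps] /orP[/eqP->|qs] //=; last exact: sE.
  - by have [n1 n2] := nxy _ qs; split=> e; [case: n1|case: n2].
  - by have [n1 n2] := nxy _ ps; split=> e; [case: n1|case: n2].
move=> /orP[/eqP->|ps].
  apply: partial_cyclic_iso_sub Hx => z /mapP[q]; rewrite mem_filter => /andP[n].
  rewrite inE => /orP[/eqP e|qs ->]; last by apply/mapP; exists q.
  by move: n; rewrite e /= eqxx.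
case: (H p ps) => h.
  apply: partial_cyclic_iso_sub (sP p ps) => z /mapP[q]; rewrite mem_filter => /andP[n].
  rewrite inE => /orP[/eqP e|qs] ->; first by rewrite e.
  by apply: star_in => //; exact/eqP.
apply: partial_cyclic_iso_sub h => z /mapP[q]; rewrite mem_filter => /andP[n].
rewrite !inE => /orP[/eqP e|qs] ->; first by rewrite e eqxx.
by apply/orP; right; apply: star_in => //; exact/eqP.
Qed.

(** If [x] is alone in its direction at [b], then every other point of the domain
    sees [x] where it sees [b], so that only the star of [b] grows; homogeneity
    of the cyclic order chooses the direction of the image. *)
Lemma extend_fresh s b x : partial_iso s -> median_closed s -> b \in s ->
  x <> b.1 -> (forall q, q \in s -> q.1 <> b.1 -> dir b.1 q.1 <> dir b.1 x) ->
  exists y, partial_iso ((x, y) :: s) /\ median_closed ((x, y) :: s).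
Proof.
move=> si sc bs xb fresh; have [sE sP] := si.
have [|a' a'P a'I] := partial_cyclic_iso_extend (a := dir b.1 x) (sP b bs).
  by move=> p /mapP[q]; rewrite mem_filter => /andP[/eqP n qs] -> /=; exact: fresh.
have [y yb dy] := dir_surj b.2 a'.
have bE q : q \in s -> q.1 <> b.1 <-> q.2 <> b.2.
  by move=> qs; split=> n e; apply: n; exact/(sE _ _ qs bs).
have fresh' q : q \in s -> q.1 <> b.1 -> dir b.2 q.2 <> dir b.2 y.
  by move=> qs n; rewrite dy; exact: (a'P _ (star_in qs n)).
have side q : q \in s -> q.1 <> b.1 -> dir q.1 x = dir q.1 b.1.
  by move=> qs n; apply: dir_across => //; [exact/nesym|exact/nesym/fresh].
have side' q : q \in s -> q.1 <> b.1 -> dir q.2 y = dir q.2 b.2.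
  move=> qs n; have /(bE _ qs) n' := n.
  by apply: dir_across => //; [exact/nesym|exact/nesym/fresh'].
have away q : q \in s -> dir x q.1 = dir x b.1.
  move=> qs; have [->//|n] := pselect (q.1 = b.1).
  by apply: dir_across => //; [exact/nesym|exact/fresh].
have away' q : q \in s -> dir y q.2 = dir y b.2.
  move=> qs; have [/(sE _ _ qs bs)->//|n] := pselect (q.1 = b.1).
  have /(bE _ qs) n' := n.
  by apply: dir_across => //; [exact/nesym|exact/fresh'].
exists y; split.
- apply: partial_iso_cons => //.
  + move=> q qs; have [e|n] := pselect (q.1 = b.1).
      rewrite e; split; first exact/nesym.
      by have /(sE _ _ qs bs) -> := e; exact/nesym.
    by split=> e; [apply: (fresh _ qs n)|apply: (fresh' _ qs n)]; rewrite e.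
  + move=> p ps; have [e|n] := pselect (p.1 = b.1).
      right; have e2 : p.2 = b.2 by apply/(sE _ _ ps bs).
      by rewrite -dy in a'I; rewrite /star e e2.
    by left; rewrite side// side'//; apply: star_in => //; exact/nesym.
  + apply: partial_cyclic_iso_sub (partial_cyclic_iso1 (dir x b.1) (dir y b.2)).
    by move=> z /mapP[q qs ->]; rewrite away// away'// inE.
- apply: median_closed_cons => // q r qs rs.
  have [m ms [h1 h2 h3]] := sc _ _ _ bs qs rs.
  have mv : m.1 <> x.
    have [->|n] := pselect (m.1 = b.1); first exact/nesym.
    by move=> e; apply: (fresh _ ms n); rewrite e.
  have shift u : u \in s -> btw (@dir M) m.1 b.1 u.1 -> btw (@dir M) m.1 x u.1.
    move=> us h; have [e|n] := pselect (m.1 = b.1).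
      have [eu|nu] := pselect (u.1 = b.1); first by apply: Or32; rewrite e eu.
      by apply: Or33; rewrite e; exact/nesym/fresh.
    case: h => [//|->|h]; first exact: Or32.
    by apply: Or33; rewrite side.
  exists m; first by rewrite inE ms orbT.
  by split=> //=; exact: shift.
Qed.

(** If the region between [b] and [c] contains no point of the domain, then every
    point of the domain sees [x] where it sees [b] or [c], and [x] sees only two
    directions, so any point between the images can be chosen. *)
Lemma extend_between s b c x : partial_iso s -> median_closed s ->
  b \in s -> c \in s -> b.1 <> c.1 -> x <> b.1 -> x <> c.1 -> dir x b.1 <> dir x c.1 ->
  (forall q, q \in s -> (q.1 = b.1 \/ dir b.1 q.1 <> dir b.1 c.1) \/
                        (q.1 = c.1 \/ dir c.1 q.1 <> dir c.1 b.1)) ->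
  exists y, [/\ partial_iso ((x, y) :: s), median_closed ((x, y) :: s) &
    forall q, q \in s -> dir x q.1 = dir x b.1 \/ dir x q.1 = dir x c.1].
Proof.
move=> si sc bs cs bc xb xc bxc sides; have [sE sP] := si.
have bc' : b.2 <> c.2 by move/(sE _ _ bs cs).
have [y [yb yc byc]] := dir_dense bc'.
have bE p q : p \in s -> q \in s -> p.1 <> q.1 <-> p.2 <> q.2.
  by move=> ps qs; split=> n e; apply: n; exact/(sE _ _ ps qs).
(* consequences of [q0] lying on the side of [b0], to be used in both trees *)
have near (X : planar_tree) (b0 c0 x0 q0 : X) : b0 <> c0 -> x0 <> b0 -> x0 <> c0 ->
    dir x0 b0 <> dir x0 c0 -> q0 = b0 \/ dir b0 q0 <> dir b0 c0 ->
    [/\ q0 <> x0, dir x0 q0 = dir x0 b0 & q0 <> b0 -> dir q0 x0 = dir q0 b0].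
  move=> n1 n2 n3 n4 H; have e : dir b0 c0 = dir b0 x0.
    by apply: dir_across => //; exact/nesym.
  case: H => [->|]; first by split=> //; exact/nesym.
  rewrite e => h; have [eq|nq] := pselect (q0 = b0).
    by rewrite eq; split=> //; exact/nesym.
  split.
  - by move=> eq; apply: h; rewrite eq.
  - by apply: dir_across => //; exact/nesym.
  - by move=> _; apply: dir_across => //; exact/nesym.
have nearb q : q \in s -> q.1 = b.1 \/ dir b.1 q.1 <> dir b.1 c.1 ->
    q.2 = b.2 \/ dir b.2 q.2 <> dir b.2 c.2.
  move=> qs; have [e _|n [//|h]] := pselect (q.1 = b.1); first by left; apply/(sE _ _ qs bs).
  by right; move/(partial_iso_dir si bs qs cs n (nesym bc)).
have nearc q : q \in s -> q.1 = c.1 \/ dir c.1 q.1 <> dir c.1 b.1 ->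
    q.2 = c.2 \/ dir c.2 q.2 <> dir c.2 b.2.
  move=> qs; have [e _|n [//|h]] := pselect (q.1 = c.1); first by left; apply/(sE _ _ qs cs).
  by right; move/(partial_iso_dir si cs qs bs n bc).
have xcb := nesym bxc; have ycb := nesym byc; have cb := nesym bc; have cb' := nesym bc'.
have toward (X : planar_tree) (b0 c0 x0 : X) : b0 <> c0 -> x0 <> b0 -> x0 <> c0 ->
    dir x0 b0 <> dir x0 c0 -> dir b0 x0 = dir b0 c0.
  by move=> n1 n2 n3 n4; apply/esym/dir_across => //; exact/nesym.
exists y; split.
- apply: partial_iso_cons => //.
  + move=> q qs; case: (sides q qs) => h.
      have [] := near _ _ _ _ _ bc xb xc bxc h.
      by have [] := near _ _ _ _ _ bc' yb yc byc (nearb q qs h).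
    have [] := near _ _ _ _ _ cb xc xb xcb h.
    by have [] := near _ _ _ _ _ cb' yc yb ycb (nearc q qs h).
  + have aux b0 c0 p : b0 \in s -> c0 \in s -> b0.1 <> c0.1 -> x <> b0.1 -> x <> c0.1 ->
        dir x b0.1 <> dir x c0.1 -> y <> b0.2 -> y <> c0.2 ->
        dir y b0.2 <> dir y c0.2 -> p \in s ->
        p.1 = b0.1 \/ dir b0.1 p.1 <> dir b0.1 c0.1 ->
        p.2 = b0.2 \/ dir b0.2 p.2 <> dir b0.2 c0.2 ->
        (dir p.1 x, dir p.2 y) \in star s p.
      move=> b0s c0s n1 n2 n3 n4 m2 m3 m4 ps h h'.
      have n1' := (bE _ _ b0s c0s).1 n1.
      have [e|n] := pselect (p.1 = b0.1).
        have e2 : p.2 = b0.2 by apply/(sE _ _ ps b0s).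
        rewrite e e2 (toward _ _ _ _ n1 n2 n3 n4) (toward _ _ _ _ n1' m2 m3 m4) -e -e2.
        by apply: star_in => //; rewrite e; exact/nesym.
      have [_ _ /(_ n) ->] := near _ _ _ _ _ n1 n2 n3 n4 h.
      have [_ _ ->] := near _ _ _ _ _ n1' m2 m3 m4 h'; last by apply/(bE _ _ ps b0s).
      by apply: star_in => //; exact/nesym.
    move=> p ps; left; case: (sides p ps) => h.
      by apply: (aux b c) => //; exact: nearb.
    by apply: (aux c b) => //; exact: nearc.
  + apply: partial_cyclic_iso_sub (partial_cyclic_iso2 bxc byc).
    move=> z /mapP[q qs ->]; rewrite !inE; case: (sides q qs) => h.
      have [_ -> _] := near _ _ _ _ _ bc xb xc bxc h.
      by have [_ -> _] := near _ _ _ _ _ bc' yb yc byc (nearb q qs h); rewrite eqxx.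
    have [_ -> _] := near _ _ _ _ _ cb xc xb xcb h.
    by have [_ -> _] := near _ _ _ _ _ cb' yc yb ycb (nearc q qs h); rewrite eqxx orbT.
- have aux b0 c0 q r : b0 \in s -> c0 \in s -> b0.1 <> c0.1 -> x <> b0.1 -> x <> c0.1 ->
      dir x b0.1 <> dir x c0.1 -> q \in s -> r \in s ->
      q.1 = b0.1 \/ dir b0.1 q.1 <> dir b0.1 c0.1 ->
      r.1 = b0.1 \/ dir b0.1 r.1 <> dir b0.1 c0.1 ->
      exists2 m, m \in (x, y) :: s &
        [/\ btw (@dir M) m.1 x q.1, btw (@dir M) m.1 q.1 r.1 & btw (@dir M) m.1 x r.1].
    move=> b0s c0s n1 n2 n3 n4 qs rs hq hr.
    have [m ms [h1 h2 h3]] := sc _ _ _ b0s qs rs.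
    have [mb|mb] := pselect (m.1 = b0.1).
      have sh u : u.1 = b0.1 \/ dir b0.1 u.1 <> dir b0.1 c0.1 -> btw (@dir M) m.1 x u.1.
        move=> [->|h]; first by apply: Or32.
        apply: Or33; rewrite mb (toward _ _ _ _ n1 n2 n3 n4); exact/nesym.
      by exists m; [rewrite inE ms orbT|split=> //; exact: sh].
    have hm : m.1 = b0.1 \/ dir b0.1 m.1 <> dir b0.1 c0.1.
      right => e; case: h1 => [//|e'|n].
        by case: hq => [|]; rewrite -e'.
      case: hq => [e'|hq]; first by rewrite e' in n.
      by apply: (n); apply/esym/dir_across; [exact/nesym|by move=> e2; rewrite e2 in n|rewrite e].
    have [mx _ /(_ mb) em] := near _ _ _ _ _ n1 n2 n3 n4 hm.
    exists m; first by rewrite inE ms orbT.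
    have sh u : btw (@dir M) m.1 b0.1 u -> btw (@dir M) m.1 x u.
      by case=> [//|->|h]; [exact: Or32|apply: Or33; rewrite em].
    by split=> //; exact: sh.
  apply: median_closed_cons => // q r qs rs.
  case: (sides q qs) => hq; case: (sides r rs) => hr.
  + exact: (aux b c).
  + exists (x, y); first by rewrite inE eqxx.
    split=> /=; [exact: Or31| |exact: Or31]; apply: Or33.
    have [_ -> _] := near _ _ _ _ _ bc xb xc bxc hq.
    by have [_ -> _] := near _ _ _ _ _ cb xc xb xcb hr.
  + exists (x, y); first by rewrite inE eqxx.
    split=> /=; [exact: Or31| |exact: Or31]; apply: Or33.
    have [_ -> _] := near _ _ _ _ _ bc xb xc bxc hr.
    by have [_ -> _] := near _ _ _ _ _ cb xc xb xcb hq.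
  + exact: (aux c b).
- move=> q qs; case: (sides q qs) => h; [left|right].
    by have [] := near _ _ _ _ _ bc xb xc bxc h.
  by have [] := near _ _ _ _ _ cb xc xb xcb h.
Qed.

End PartialIsomorphisms.

(** * Back and forth *)

Section BackAndForth.
Variables M N : planar_tree.
Implicit Types (s : seq (M * N)) (p q r : M * N).

(** If no point of the domain sees [x] in a fresh direction, then [x] lies in
    the region between two points of the domain with no other point of the
    domain in it: take [b] having the fewest points of the domain on its side
    towards [x], then the one among these that is closest to [b]. *)
Lemma locate s x : median_closed s -> s != [::] ->
  (forall q, q \in s -> q.1 <> x) ->
  (forall b, b \in s -> exists2 q, q \in s & q.1 <> b.1 /\ dir b.1 q.1 = dir b.1 x) ->
  exists b c, [/\ b \in s /\ c \in s, b.1 <> c.1, dir b.1 c.1 = dir b.1 x,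
    dir c.1 b.1 = dir c.1 x &
    forall q, q \in s -> (q.1 = b.1 \/ dir b.1 q.1 <> dir b.1 c.1) \/
                        (q.1 = c.1 \/ dir c.1 q.1 <> dir c.1 b.1)].
Proof.
move=> sc s0 xs dense.
pose side (b q : M * N) := (q.1 != b.1) && `[< dir b.1 q.1 = dir b.1 x >] : bool.
have [b bs bmin] := seq_argmin (fun b => count (side b) s) s0.
have sideP b0 q : side b0 q <-> q.1 <> b0.1 /\ dir b0.1 q.1 = dir b0.1 x.
  by split=> [/andP[/eqP n /asboolP]|[/eqP n /asboolP h]]; [|apply/andP].
have back c : c \in s -> side b c -> dir c.1 b.1 = dir c.1 x.
  move=> cs cS; have /sideP[cb ec] := cS; apply: contrapT => n.
  have := bmin _ cs; rewrite leqNgt => /negP; apply.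
  apply: (@count_lt _ _ _ _ c) => // [q qs /sideP[qc eq]|].
    apply/sideP; split.
      by move=> e; apply: n; rewrite -e.
    rewrite -ec; apply: dir_across => //.
    by rewrite eq; exact/nesym.
  by apply/negP => /sideP[].
have [c0 c0s /sideP c0S] := dense b bs.
pose between (b q c : M * N) := (q.1 != c.1) && `[< dir q.1 b.1 <> dir q.1 c.1 >] : bool.
have sS0 : seq.filter (side b) s != [::].
  by rewrite -has_filter; apply/hasP; exists c0.
have [c] := seq_argmin (fun c => count (fun q => between b q c) (seq.filter (side b) s)) sS0.
rewrite mem_filter => /andP[cS cs] cmin; have /sideP[cb ec] := cS.
have none q : q \in s -> side b q -> q.1 <> c.1 -> dir q.1 b.1 = dir q.1 c.1.
  move=> qs qS qc; apply: contrapT => nq; have /sideP[qb eq] := qS.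
  have := cmin q; rewrite mem_filter qS qs => /(_ isT); rewrite leqNgt => /negP; apply.
  apply: (@count_lt _ _ _ _ q).
  - move=> r; rewrite mem_filter => /andP[/sideP[rb _] _] /andP[/eqP rq /asboolP nr].
    have rc : r.1 <> c.1.
      move=> e; apply: nr; rewrite e; apply: dir_across => //; exact/nesym.
    apply/andP; split; first exact/eqP.
    apply/asboolP; suff -> : dir r.1 c.1 = dir r.1 q.1 by [].
    apply: dir_across; [exact/nesym|exact/nesym|].
    suff <- : dir q.1 b.1 = dir q.1 r.1 by exact/nesym.
    by apply: dir_across => //; exact/nesym.
  - by rewrite mem_filter qS.
  - by apply/andP; split; [exact/eqP|exact/asboolP].
  - by rewrite negb_and eqxx.
exists b, c; split=> //; [exact/nesym|exact: back|].
move=> r rs; have [e|rb] := pselect (r.1 = b.1); first by left; left.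
have [e|n] := pselect (dir b.1 r.1 = dir b.1 c.1); last by left; right.
right; have [e'|rc] := pselect (r.1 = c.1); [by left|right] => ecr.
have rS : side b r by apply/sideP; rewrite e.
have [m ms [h1 h2 h3]] := sc _ _ _ bs cs rs.
have [mb|mb] := pselect (m.1 = b.1).
  case: h2 => [mc|mr|]; [by apply: cb; rewrite -mc|by apply: rb; rewrite -mr|].
  by rewrite mb e; apply.
have [mc|mc] := pselect (m.1 = c.1).
  case: h3 => [//|mr|]; first by apply: rc; rewrite -mr.
  by rewrite mc ecr; apply.
case: h1 => // nm; apply: (nm); apply: none => //.
apply/sideP; split => //.
by rewrite -ec; apply/esym; apply: dir_across => //; exact/nesym.
Qed.

(** A point that is neither in a fresh direction nor on a segment of the domain
    branches off from a segment at a median, which is added first. *)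
Lemma extend_point s x : partial_iso s -> median_closed s ->
  exists s', [/\ partial_iso s', median_closed s', {subset s <= s'} &
    exists2 p, p \in s' & p.1 = x].
Proof.
move=> si sc.
have [[p ps px]|xs] := pselect (exists2 p, p \in s & p.1 = x).
  by exists s; split=> //; exists p.
have {}xs q : q \in s -> q.1 <> x by move=> qs e; apply: xs; exists q.
have [s0|s0] := eqVneq s [::].
  have [y] := planar_tree_inhabited N.
  exists [:: (x, y)]; split.
  - split=> [p q|p]; rewrite !inE => /eqP-> //; first by move=> /eqP->.
    by rewrite /star /= eqxx.
  - move=> p q r; rewrite !inE => /eqP-> /eqP-> /eqP->.
    by exists (x, y); rewrite ?inE//; split; apply: Or31.
  - by rewrite s0.
  - by exists (x, y); rewrite ?inE.
have [[b bs fresh]|nf] := pselect (exists2 b, b \in s &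
    forall q, q \in s -> q.1 <> b.1 -> dir b.1 q.1 <> dir b.1 x).
  have [y [h1 h2]] := extend_fresh si sc bs (nesym (xs _ bs)) fresh.
  exists ((x, y) :: s); split=> //.
    by move=> q qs; rewrite inE qs orbT.
  by exists (x, y); rewrite ?inE ?eqxx.
have [|b [c [[bs cs] bc eb ec sides]]] := locate sc s0 xs.
  move=> b bs; apply: contrapT => h; apply: nf; exists b => // q qs n e.
  by apply: h; exists q.
have xb := nesym (xs _ bs); have xc := nesym (xs _ cs).
have [n|e] := pselect (dir x b.1 <> dir x c.1).
  have [y [h1 h2 _]] := extend_between si sc bs cs bc xb xc n sides.
  exists ((x, y) :: s); split=> //.
    by move=> q qs; rewrite inE qs orbT.
  by exists (x, y); rewrite ?inE ?eqxx.
have {}e : dir x b.1 = dir x c.1 by apply: contrapT.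
have [m [h1 h2 h3]] := dir_median b.1 c.1 x.
have mb : m <> b.1 by move=> em; case: h2 => [em'|//|]; [apply: bc; rewrite -em|
  move=> em'; apply: xb; rewrite -em|rewrite em eb].
have mc : m <> c.1 by move=> em; case: h3 => [//|em'|]; [apply: xc; rewrite -em'|rewrite em ec].
have mx : m <> x by move=> em; case: h1 => [//|//|]; rewrite em e.
case: h1 => // h1; case: h2 => // h2; case: h3 => // h3.
have [m' [i1 c1 tw]] := extend_between si sc bs cs bc mb mc h1 sides.
have ms : (m, m') \in (m, m') :: s by rewrite inE eqxx.
have [|y [h4 h5]] := extend_fresh i1 c1 ms (nesym mx).
  move=> q; rewrite inE => /orP[/eqP->//|qs] _ /=.
  by case: (tw q qs) => ->.
exists ((x, y) :: (m, m') :: s); split=> //.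
  by move=> q qs; rewrite !inE qs !orbT.
by exists (x, y); rewrite ?inE ?eqxx.
Qed.

End BackAndForth.

Definition swap (M N : Type) (s : seq (M * N)) := [seq (p.2, p.1) | p <- s].

Lemma mem_swap (M N : eqType) (s : seq (M * N)) p :
  (p \in swap s) = ((p.2, p.1) \in s).
Proof.
apply/mapP/idP => [[q qs ->]|ps]; first by case: q qs.
by exists (p.2, p.1) => //; case: p ps.
Qed.

Lemma swap_partial_iso (M N : planar_tree) (s : seq (M * N)) :
  partial_iso s -> partial_iso (swap s).
Proof.
move=> [sE sP]; split=> [p q|p]; rewrite !mem_swap.
  by move=> ps qs; have /= [h1 h2] := sE _ _ ps qs; split.
move=> ps; have [h1 h2] := sP _ ps.
have H z : z \in star (swap s) p -> (z.2, z.1) \in star s (p.2, p.1).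
  move=> /mapP[q]; rewrite mem_filter mem_swap => /andP[/eqP n qs] -> /=.
  apply: (star_in (p := (p.2, p.1)) qs) => /= e; apply: n.
  by apply/(sE _ _ qs ps).
split=> [z w /H hz /H hw|z w t /H hz /H hw /H ht].
  by have /= [? ?] := h1 _ _ hz hw; split.
by have /= [? ?] := h2 _ _ _ hz hw ht; split.
Qed.

Lemma swap_median_closed (M N : planar_tree) (s : seq (M * N)) :
  partial_iso s -> median_closed s -> median_closed (swap s).
Proof.
move=> si sc p q r; rewrite !mem_swap => ps qs rs.
have [sE _] := si.
have [m ms [h1 h2 h3]] := sc _ _ _ ps qs rs.
have H u v : (u.2, u.1) \in s -> (v.2, v.1) \in s -> btw (@dir M) m.1 u.2 v.2 ->
    btw (@dir N) m.2 u.1 v.1.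
  move=> us vs; have [e _|nu] := pselect (m.1 = u.2).
    by apply: Or31; exact: (sE _ _ ms us).1 e.
  have [e _|nv] := pselect (m.1 = v.2).
    by apply: Or32; exact: (sE _ _ ms vs).1 e.
  case=> // n; apply: Or33 => e; apply: n.
  exact: (partial_iso_dir si ms us vs (nesym nu) (nesym nv)).2 e.
exists (m.2, m.1); first by rewrite mem_swap; case: m ms {H h1 h2 h3}.
by split; apply: H.
Qed.

Section Uniqueness.
Variables M N : planar_tree.

Definition closed_partial_iso := {s : seq (M * N) | partial_iso s /\ median_closed s}.

Lemma extend_both (g : closed_partial_iso) (x : M) (y : N) : exists g' : closed_partial_iso,
  [/\ {subset projT1 g <= projT1 g'}, exists2 p, p \in projT1 g' & p.1 = x &
      exists2 p, p \in projT1 g' & p.2 = y].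
Proof.
case: g => s [si sc] /=.
have [s1 [i1 c1 ss1 [p ps1 px]]] := extend_point x si sc.
have [s2 [i2 c2 ss2 [q qs2 qy]]] :=
  extend_point y (swap_partial_iso i1) (swap_median_closed i1 c1).
have sub r : r \in s1 -> r \in swap s2.
  by move=> rs; rewrite mem_swap; apply: ss2; rewrite mem_swap; case: r rs.
exists (exist _ (swap s2) (conj (swap_partial_iso i2) (swap_median_closed i2 c2))).
split=> /=.
- by move=> r rs; apply: sub; exact: ss1.
- by exists p => //; exact: sub.
- by exists (q.2, q.1); rewrite ?mem_swap//; case: q qs2 qy.
Qed.

Lemma enumeration (P : planar_tree) : exists e : nat -> P, forall x, exists n, e n = x.
Proof.
have [h hI] := planar_tree_countable P; have [x0] := planar_tree_inhabited P.
have H n : exists x, (exists x', h x' = n) -> h x = n.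
  by have [[x' e]|ne] := pselect (exists x', h x' = n); [exists x'|exists x0].
exists (fun n => projT1 (cid (H n))) => x; exists (h x).
by apply: hI; apply: (projT2 (cid (H (h x)))); exists x.
Qed.

(** Back and forth; the permutation of the directions at [b] is recovered from
    the bijection because every direction contains a point. *)
Theorem planar_tree_unique : exists (f : M -> N) (g : N -> M),
  [/\ cancel f g, cancel g f &
   forall b, exists2 s : sym Omega, AutO s &
     forall x, x <> b -> dir (f b) (f x) = s (dir b x)].
Proof.
have [eM eMP] := enumeration M; have [eN eNP] := enumeration N.
have g0 : closed_partial_iso by exists [::].
pose step n (g : closed_partial_iso) := projT1 (cid (extend_both g (eM n) (eN n))).
have stepP n g := projT2 (cid (extend_both g (eM n) (eN n))).
pose G := fix G n := if n is n'.+1 then step n' (G n') else g0.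
have Gmono m n : (m <= n)%N -> {subset projT1 (G m) <= projT1 (G n)}.
  move=> /subnK <-; elim: (n - m)%N => // k IH p /IH; rewrite addSn /=.
  by case: (stepP (k + m)%N (G (k + m)%N)) => h _ _; exact: h.
pose U p := exists n, p \in projT1 (G n).
have U2 p q : U p -> U q -> exists n, p \in projT1 (G n) /\ q \in projT1 (G n).
  move=> [m pm] [n qn]; exists (maxn m n).
  by split; [exact: Gmono (leq_maxl _ _) _ pm|exact: Gmono (leq_maxr _ _) _ qn].
have U3 p q r : U p -> U q -> U r -> exists n,
    [/\ p \in projT1 (G n), q \in projT1 (G n) & r \in projT1 (G n)].
  move=> /U2 H /H [m [pm qm]] [n rn]; exists (maxn m n); split.
  - exact: Gmono (leq_maxl _ _) _ pm.
  - exact: Gmono (leq_maxl _ _) _ qm.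
  - exact: Gmono (leq_maxr _ _) _ rn.
have Uf x : exists y, U (x, y).
  have [n <-] := eMP x; have [_ [[x' y] ps /= e] _] := stepP n (G n).
  by exists y, n.+1; rewrite -e.
have Ug y : exists x, U (x, y).
  have [n <-] := eNP y; have [_ _ [[x y'] ps /= e]] := stepP n (G n).
  by exists x, n.+1; rewrite -e.
pose f x := projT1 (cid (Uf x)); pose g y := projT1 (cid (Ug y)).
have fP x : U (x, f x) := projT2 (cid (Uf x)).
have gP y : U (g y, y) := projT2 (cid (Ug y)).
have UE p q : U p -> U q -> p.1 = q.1 <-> p.2 = q.2.
  by move=> /U2 H /H [n [pn qn]]; have [[+ _] _] := projT2 (G n); apply.
have gf : cancel f g by move=> x; have [_] := UE _ _ (gP (f x)) (fP x); apply.
have fg : cancel g f by move=> y; have [+ _] := UE _ _ (fP (g y)) (gP y); apply.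
exists f, g; split=> // b.
have fI := can_inj gf.
have dirE x y : x <> b -> y <> b -> dir b x = dir b y <-> dir (f b) (f x) = dir (f b) (f y).
  move=> xb yb; have [n [pn qn rn]] := U3 _ _ _ (fP b) (fP x) (fP y).
  have [si _] := projT2 (G n); exact: (partial_iso_dir si pn qn rn xb yb).
have dirC x y z : x <> b -> y <> b -> z <> b ->
    cyclic_order (dir b x) (dir b y) (dir b z) <->
    cyclic_order (dir (f b) (f x)) (dir (f b) (f y)) (dir (f b) (f z)).
  move=> xb yb zb; have [n [pn qn rn]] := U3 _ _ _ (fP b) (fP x) (fP y).
  have [m tm] := fP z; have mn := Gmono _ _ (leq_maxl n m); have mm := Gmono _ _ (leq_maxr n m).
  have [[_ sP] _] := projT2 (G (maxn n m)); have [_ C] := sP _ (mn _ pn).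
  exact: (C _ _ _ (star_in (p := (b, f b)) (mn _ qn) xb)
    (star_in (p := (b, f b)) (mn _ rn) yb) (star_in (p := (b, f b)) (mm _ tm) zb)).
pose r i := projT1 (cid2 (dir_surj b i)).
have rb i : r i <> b by rewrite /r; case: cid2.
have rE i : dir b (r i) = i by rewrite /r; case: cid2.
pose s i := dir (f b) (f (r i)).
have sE x : x <> b -> dir (f b) (f x) = s (dir b x).
  by move=> xb; apply/dirE => //; rewrite rE.
pose r' j := projT1 (cid2 (dir_surj (f b) j)).
have rb' j : r' j <> f b by rewrite /r'; case: cid2.
have rE' j : dir (f b) (r' j) = j by rewrite /r'; case: cid2.
pose t j := dir b (g (r' j)).
have gb j : g (r' j) <> b by move=> e; apply: (rb' j); rewrite -e fg.
have st : cancel s t.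
  move=> i; rewrite /t -[RHS]rE; apply/dirE => //.
  by rewrite fg rE'.
have ts : cancel t s.
  by move=> j; rewrite -sE// fg rE'.
exists (Defs.Sym st ts) => // i j k.
by rewrite -[in X in X <-> _](rE i) -[in X in X <-> _](rE j) -[in X in X <-> _](rE k); exact: dirC.
Qed.

End Uniqueness.

(** * Discrete trees *)

Section Trees.
Variables (V : choiceType) (e : rel V).
Hypothesis eT : is_tree e.

(** [x] and [y] are in the same component of the complement of [v]. *)
Definition avoids (v x y : V) :=
  exists p, [/\ path e x p, last x p = y & v \notin x :: p].

Lemma edge_sym x y : e x y = e y x.
Proof. by have [_ s _ _ _] := eT. Qed.

Lemma edge_neq x y : e x y -> x <> y.
Proof. by have [_ _ i _ _] := eT; move=> + xy; rewrite xy i. Qed.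

Lemma uniq_path x y : exists p, [/\ path e x p, last x p = y & uniq (x :: p)].
Proof.
have [_ _ _ c _] := eT; have [p xp <-] := c x y.
by have [p' xp' up' _] := shortenP xp; exists p'.
Qed.

Lemma avoids_refl v x : x <> v -> avoids v x x.
Proof. by move=> /eqP xv; exists [::]; rewrite inE eq_sym xv. Qed.

Lemma avoids_sym v x y : avoids v x y -> avoids v y x.
Proof.
move=> [p [xp <- vp]]; exists (rev (belast x p)); split.
- by rewrite rev_path (eq_path (e' := e))// => a b; rewrite edge_sym.
- by case: p {xp vp} => //= z p; rewrite rev_cons last_rcons.
- by rewrite -rev_rcons -lastI mem_rev.
Qed.

Lemma avoids_trans v x y z : avoids v x y -> avoids v y z -> avoids v x z.
Proof.
move=> [p [xp <- vp]] [q [yq <- vq]]; exists (p ++ q); split.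
- by rewrite cat_path xp.
- by rewrite last_cat.
- by move: vp vq; rewrite !inE mem_cat !negb_or => /andP[-> ->] /andP[_ ->].
Qed.

Lemma avoids_edge v x y : e x y -> v <> x -> v <> y -> avoids v x y.
Proof. by move=> xy /eqP vx /eqP vy; exists [:: y]; rewrite /= xy !inE negb_or vx vy. Qed.

(** A path between two neighbors of [v] that avoids [v] would close up to a cycle
    through [v]. *)
Lemma edge_avoids_uniq v u w : e v u -> e v w -> avoids v u w -> u = w.
Proof.
move=> vu vw [p [up pw vp]]; have [_ _ _ _ acyc] := eT.
move: pw; case/shortenP: up => p' up' uu sub pw.
suff : (size (v :: u :: p') <= 2)%N by case: p' {up' uu sub} pw => [|y q] /= pw.
apply: acyc; apply/andP; split.
  by rewrite /= vu rcons_path up' pw edge_sym vw.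
rewrite cons_uniq uu andbT.
apply: contra vp; rewrite !inE => /orP[->//|/sub ->]; exact: orbT.
Qed.

Lemma step_exists v x : exists y, x <> v -> e v y /\ avoids v y x.
Proof.
have [[|y p] [vp px /andP[n1 n2]]] := uniq_path v x.
  by exists v => n; case: n.
by exists y => _; move: vp => /andP[vy yp]; split=> //; exists p.
Qed.

(** The first vertex on the way from [v] to [x]. *)
Definition step v x := projT1 (cid (step_exists v x)).

Lemma stepP v x : x <> v -> e v (step v x) /\ avoids v (step v x) x.
Proof. exact: (projT2 (cid (step_exists v x))). Qed.

Lemma avoids_neq v x y : avoids v x y -> x <> v /\ y <> v.
Proof.
move=> [p [_ <- vp]]; split=> h; first by rewrite h inE eqxx in vp.
by have := mem_last x p; rewrite h (negPf vp).
Qed.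

Lemma step_uniq v x y : e v y -> avoids v y x -> step v x = y.
Proof.
move=> vy yx; have [_ xv] := avoids_neq yx; have [h1 h2] := stepP xv.
apply: (edge_avoids_uniq h1 vy); exact: avoids_trans h2 (avoids_sym yx).
Qed.

Lemma step_edge v y : e v y -> step v y = y.
Proof.
by move=> vy; apply: step_uniq => //; apply: avoids_refl; exact/nesym/edge_neq.
Qed.

Lemma step_eq v x y : avoids v x y -> step v x = step v y.
Proof.
move=> xy; have [xv yv] := avoids_neq xy; have [h1 h2] := stepP xv.
by apply/esym/step_uniq => //; exact: avoids_trans h2 xy.
Qed.

(** A path to [b] from the far side of [b] cannot meet [c]. *)
Lemma step_across b c x : b <> c -> x <> b -> step b x <> step b c ->
  step c x = step c b.
Proof.
move=> bc xb n; apply: step_eq.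
have [p [xp pb up]] := uniq_path x b.
exists p; split=> //; apply/negP => cp; apply: n; apply: step_eq.
move: cp; rewrite inE => /orP[/eqP->|cp]; first exact: avoids_refl.
case/splitPr: cp xp pb up => p1 p2; rewrite cat_path /= => /and3P[xp1 p1c cp2].
rewrite last_cat /= => pb up.
exists (rcons p1 c); split.
- by rewrite rcons_path xp1.
- by rewrite last_rcons.
- have : b \in c :: p2 by rewrite -pb mem_last.
  rewrite inE => /orP[/eqP//|bp2].
  move: up; rewrite -cat_rcons cat_uniq => /andP[_ /and3P[_ /hasPn/(_ b bp2) nb _]].
  by rewrite inE negb_or nb andbT; apply/eqP => bx; apply: xb.
Qed.

Lemma step_move v x y : e x y -> v <> x -> v <> y -> step v x = step v y.
Proof. by move=> xy vx vy; apply: step_eq; exact: avoids_edge. Qed.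

Lemma step_back a b : b <> a -> b <> step a b -> step (step a b) b <> a.
Proof.
move=> ba bs h; have [h1 h2] := stepP ba; have [h3 h4] := stepP bs.
rewrite {}h in h3 h4.
have [p [sp pb up]] := uniq_path (step a b) b.
have [q [sq qb aq]] := h2.
move: qb; case/shortenP: sq => q' sq' uq' sub qb.
case: q' sq' uq' sub qb => [|z q'] /=; first by move=> _ _ _ /esym.
move=> /andP[sz zq'] /and3P[n1 n2 n3] sub qb.
have az : a <> z.
  by move=> h; move: aq; rewrite inE negb_or h => /andP[_]; rewrite (sub z)// inE eqxx.
apply: az; apply: (edge_avoids_uniq _ sz); first by rewrite edge_sym.
apply: avoids_trans h4 (avoids_sym _); exists q'; split=> //.
Qed.

(** Walking from [a] to [b], the median is the first vertex at which the ways to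
    [b] and to [c] separate. *)
Lemma step_median a b c : exists m,
  [/\ btw step m a b, btw step m b c & btw step m a c].
Proof.
have [p [ap pb up]] := uniq_path a b.
elim: p a ap pb up => [|a' p IH] a /=.
  by move=> _ -> _; exists b; split; [apply: Or31|apply: Or31|apply: Or31].
move=> /andP[aa' a'p] pb /andP[ap up].
have sab : step a b = a' by apply: step_uniq => //; exists p.
have [h|h] := pselect (btw step a b c).
  by exists a; split=> //; apply: Or31.
have ac : a <> c by move=> h'; apply: h; apply: Or32.
have ab : a <> b by move=> h'; apply: h; apply: Or31.
have sac : step a b = step a c by apply: contrapT => n; apply: h; apply: Or33.
have [m [h1 h2 h3]] := IH a' a'p pb up.
have ma : m <> a.
  by move=> ma; rewrite ma in h2; case: h2.
have H u : u <> a -> step a u = a' -> btw step m a' u -> btw step m a u.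
  move=> ua su; have [-> _|ma'] := pselect (m = a').
    have [->|ua'] := pselect (u = a'); first exact: Or32.
    apply: Or33; rewrite (step_edge (v := a')); last by rewrite edge_sym.
    by have := step_back ua; rewrite su => /(_ ua') /nesym.
  case=> [//|->|n]; first exact: Or32.
  by apply: Or33; rewrite (step_move aa').
exists m; split=> //; apply: H => //; try exact/nesym.
by rewrite -sac.
Qed.

Section Rooted.
Variable r : V.

Lemma depth_exists x : exists n, exists2 p, path e x p /\ last x p = r & size p = n.
Proof. by have [p [xp pr _]] := uniq_path x r; exists (size p), p. Qed.

Definition depth x : nat := ex_minn
  (P := fun n => `[< exists2 p, path e x p /\ last x p = r & size p = n >])
  (let: ex_intro n h := depth_exists x in ex_intro _ n (asboolT h)).

Lemma depth_root : depth r = 0%N.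
Proof.
rewrite /depth; case: ex_minnP => n _ /(_ 0%N).
by rewrite leqn0 => h; apply/eqP/h/asboolP; exists [::].
Qed.

(** A shortest path is free of repetitions, so its first vertex is the step. *)
Lemma depth_step x : x <> r -> depth x = (depth (step x r)).+1.
Proof.
move=> xr; have [h1 _] := stepP (nesym xr).
rewrite /depth; case: ex_minnP => n /asboolP[p [xp pr] pn] nmin.
case: ex_minnP => m /asboolP[q [sq qr] qm] mmin.
apply/eqP; rewrite eqn_leq; apply/andP; split.
  by apply: nmin; apply/asboolP; exists (step x r :: q); rewrite /= ?h1 ?qm.
move: pr; case/shortenP: xp => p' xp' up' sub pr.
have np' : (size p' <= n)%N.
  rewrite -pn; apply: uniq_leq_size => //; by move: up' => /andP[].
case: p' xp' up' sub pr np' => [|y p']; first by move=> _ _ _ /= /xr.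
move=> /= /andP[xy yp'] /andP[xn up'] _ pr np'.
have sxy : step x r = y by apply: step_uniq => //; exists p'.
apply: leq_trans np'; rewrite ltnS; apply: mmin; apply/asboolP.
by exists p'; rewrite ?sxy.
Qed.

Lemma edge_parent x y : e x y -> (x <> r /\ y = step x r) \/ (y <> r /\ x = step y r).
Proof.
move=> xy; have yx : e y x by rewrite edge_sym.
have [xr|xr] := pselect (x = r).
  right; rewrite -xr step_edge//; split=> //; exact/nesym/edge_neq.
have [h|h] := pselect (step x r = y); [by left|right].
have yr : y <> r by move=> yr; apply: h; rewrite -yr step_edge.
split=> //; rewrite -[LHS](step_edge yx); apply/esym/step_across.
- exact: edge_neq.
- exact/nesym.
- by rewrite (step_edge xy).
Qed.

End Rooted.

Lemma step_morph (g : sym V) : (forall x y, e (g x) (g y) = e x y) ->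
  forall v x, x <> v -> step (g v) (g x) = g (step v x).
Proof.
move=> ge v x xv; have [h1 [p [h2 h3 h4]]] := stepP xv.
apply: step_uniq; first by rewrite ge.
exists (map g p); split.
- by rewrite path_map; apply: sub_path h2 => a b /= ab; rewrite ge.
- by rewrite last_map h3.
- by rewrite -map_cons mem_map//; exact: can_inj (symK g).
Qed.

End Trees.

(** * Colored trees and regions of dense trees *)

Section ColoredTrees.
Variables (n : nat) (T : colored_tree n).
Local Notation k := (@tree_color n T).
Local Notation E := (@adj n T).
Let tT := adj_tree T.

Lemma adj_side (x y : T) : E x y -> inA y = ~~ inA x.
Proof. by have [+ _ _] := adj_biregular T => /[apply]; case: (inA x); case: (inA y). Qed.

Lemma color_inj (v x y : T) : E v x -> E v y -> k (v, x) = k (v, y) -> x = y.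
Proof.
have [lA lB _] := tree_color_legal T => vx vy e.
have [Av|Bv] := boolP (inA v).
  have [_ ki _] := lA _ Av.
  by have [] : (v, x) = (v, y) by apply: ki => //; apply/mem_set.
have [_ ki _] := lB _ Bv.
by have [] : (v, x) = (v, y) by apply: ki => //; apply/mem_set.
Qed.

Lemma colorA (v x : T) : inA v -> E v x -> exists i, k (v, x) = inl i.
Proof.
have [lA _ _] := tree_color_legal T => /lA[f _ _] vx.
by have [i _ <-] := f (v, x) (conj vx erefl); exists i.
Qed.

Lemma colorB (v x : T) : ~~ inA v -> E v x -> exists i, k (v, x) = inr i.
Proof.
have [_ lB _] := tree_color_legal T => /lB[f _ _] vx.
by have [i _ <-] := f (v, x) (conj vx erefl); exists i.
Qed.

Lemma neighborA (v : T) i : inA v -> exists2 x, E v x & k (v, x) = inl i.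
Proof.
have [lA _ _] := tree_color_legal T => /lA[_ _ s].
by have [[a b] [/= ab av] <-] := s (inl i) (imageT _ _); subst a; exists b.
Qed.

Lemma neighborB (v : T) i : ~~ inA v -> exists2 x, E v x & k (v, x) = inr i.
Proof.
have [_ lB _] := tree_color_legal T => /lB[_ _ s].
by have [[a b] [/= ab av] <-] := s (inr i) (imageT _ _); subst a; exists b.
Qed.

(** A vertex is determined by the colors read along the way to a root. *)
Lemma colored_tree_countable : exists h : T -> nat, injective h.
Proof.
have [[r] _ _ _ _] := tT.
pose code (c : 'I_n + Omega) : 'I_n + rat :=
  match c with inl i => inl i | inr o => inr (qrep o) end.
have codeI : injective code.
  by move=> [i|o] [j|q] //= []; [move=> -> | move=> /qrep_inj ->].
pose word := fix word m x := if m is m'.+1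
  then code (k (step tT x r, x)) :: word m' (step tT x r) else [::].
have wordI m x y : depth tT r x = m -> depth tT r y = m -> word m x = word m y -> x = y.
  elim: m x y => [|m IH] x y dx dy.
    have [->|xr] := pselect (x = r); last by rewrite depth_step// in dx.
    by have [->//|yr] := pselect (y = r); rewrite depth_step// in dy.
  have xr : x <> r by move=> e; rewrite e depth_root in dx.
  have yr : y <> r by move=> e; rewrite e depth_root in dy.
  rewrite depth_step// in dx; rewrite depth_step// in dy.
  move=> [/codeI e /(IH _ _ (succn_inj dx) (succn_inj dy)) e'].
  have [h1 _] := stepP tT (nesym xr); have [h2 _] := stepP tT (nesym yr).
  rewrite (edge_sym tT) in h1; rewrite (edge_sym tT) -e' in h2.
  by apply: (color_inj h1 h2); rewrite e e'.
exists (fun x => pickle (depth tT r x, word (depth tT r x) x)).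
move=> x y /(pcan_inj pickleK) [dxy]; rewrite -dxy; exact: wordI.
Qed.

End ColoredTrees.

Section Edges.
Variables (n : nat) (T : colored_tree n).

(** Edges are oriented from class A to class B. *)
Definition edge : choiceType := {h : T * T | inA h.1 && adj h.1 h.2}.
Implicit Types h : edge.

Lemma edge_eq h h' : (val h).1 = (val h').1 -> (val h).2 = (val h').2 -> h = h'.
Proof.
by move=> e1 e2; apply: val_inj; rewrite [LHS]surjective_pairing e1 e2 -surjective_pairing.
Qed.

Lemma edgeP h : [/\ inA (val h).1, ~~ inA (val h).2 & adj (val h).1 (val h).2].
Proof. by have /andP[a e] := valP h; rewrite (adj_side e) a. Qed.

Section Action.
Variables (F1 : permgroup 'I_n) (F2 : permgroup Omega) (g : sym T).
Hypothesis gU : is_universal F1 F2 g.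

Lemma act_edge_proof h : inA (g (val h).1) && adj (g (val h).1) (g (val h).2).
Proof. by have [gE gA _ _] := gU; rewrite gA gE (valP h). Qed.

Definition act_edge h : edge :=
  exist (fun h : T * T => is_true (inA h.1 && adj h.1 h.2))
    (g (val h).1, g (val h).2) (act_edge_proof h).

Lemma act_edge_inj : injective act_edge.
Proof.
move=> h h' /(congr1 val) /= [] /(can_inj (symK g)) e1 /(can_inj (symK g)) e2.
exact: edge_eq.
Qed.

End Action.

End Edges.

Section Regions.
Variables (M : planar_tree) (b0 b1 : M).
Hypothesis b01 : b0 <> b1.

Definition inside (i : M) : bool :=
  `[< [/\ i <> b0, i <> b1, dir b0 i = dir b0 b1 & dir b1 i = dir b1 b0] >].

Definition closed_region (i : M) := [\/ i = b0, i = b1 | inside i].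

(** Seen from outside the region or from one of its ends, the rest of the region
    lies in a single direction. *)
Lemma inside_between i p q : closed_region p -> closed_region q ->
  i <> p -> i <> q -> dir i p <> dir i q -> inside i.
Proof.
move=> cp cq ip iq pq.
have F p' : closed_region p' -> p' <> b0 -> dir b0 p' = dir b0 b1.
  by case=> [//|->//|/asboolP[]].
have G p' : closed_region p' -> p' <> b1 -> dir b1 p' = dir b1 b0.
  by case=> [->//|//|/asboolP[]].
have i0 : i <> b0.
  by move=> e; apply: pq; rewrite e (F p)//; [rewrite (F q)//|]; rewrite -e; exact/nesym.
have i1 : i <> b1.
  by move=> e; apply: pq; rewrite e (G p)//; [rewrite (G q)//|]; rewrite -e; exact/nesym.
apply/asboolP; split=> //; apply: contrapT => n; apply: pq.
  have H p' : closed_region p' -> i <> p' -> dir i p' = dir i b0.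
    move=> cp' ip'; have [->//|p0] := pselect (p' = b0).
    by apply: dir_across => //; [exact/nesym|rewrite F//; exact/nesym].
  by rewrite (H p)// (H q).
have H p' : closed_region p' -> i <> p' -> dir i p' = dir i b1.
  move=> cp' ip'; have [->//|p1] := pselect (p' = b1).
  by apply: dir_across => //; [exact/nesym|rewrite G//; exact/nesym].
by rewrite (H p)// (H q).
Qed.

Lemma inside_exists : exists i, inside i.
Proof.
have [i [i0 i1 n]] := dir_dense b01; exists i.
by apply: (@inside_between i b0 b1) => //; [exact: Or31|exact: Or32].
Qed.

End Regions.

(** * Uniqueness of labelled trees up to local permutations *)

Section LocalPermutations.
Variable n : nat.
Local Notation L := ('I_n + Omega)%type.

(** The labels around a vertex of class A ([t = true]) are those of ['I_n], around
    a vertex of class B those of [Omega]. *)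
Definition has_type (t : bool) (l : L) : bool := if l is inl _ then t else ~~ t.

Variables (F1 : permgroup 'I_n) (F2 : permgroup Omega).

(** Functions on labels of which only the values on the labels of type [t]
    matter. *)
Definition local_perm (t : bool) (h : L -> L) : Prop :=
  if t then exists2 s : sym 'I_n, F1 s & forall i, h (inl i) = inl (s i)
  else exists2 s : sym Omega, F2 s & forall c, h (inr c) = inr (s c).

Lemma local_perm_id t : local_perm t id.
Proof. by case: t; exists 1%g => //; exact: permgroup1. Qed.

Lemma local_perm_type t h l : local_perm t h -> has_type t l -> has_type t (h l).
Proof. by case: t => -[s _ sP]; case: l => // i _; rewrite sP. Qed.

Lemma local_perm_inj t h l l' : local_perm t h -> has_type t l -> has_type t l' ->
  h l = h l' -> l = l'.
Proof.
by case: t => -[s _ sP]; case: l => // i _; case: l' => // j _;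
  rewrite !sP => -[] /(can_inj (symK s)) ->.
Qed.

Lemma local_perm_surj t h l : local_perm t h -> has_type t l ->
  exists2 l', has_type t l' & h l' = l.
Proof.
by case: t => -[s _ sP]; case: l => // i _;
  [exists (inl (sym_inv s i))|exists (inr (sym_inv s i))]; rewrite // sP sym_invK.
Qed.

Definition transitive_groups :=
  (forall i j, exists2 s : sym 'I_n, F1 s & s i = j) /\
  (forall c d, exists2 s : sym Omega, F2 s & s c = d).

Lemma local_perm_transitive t a b : transitive_groups -> has_type t a -> has_type t b ->
  exists2 h, local_perm t h & h a = b.
Proof.
move=> [tr1 tr2]; case: t; case: a => // i _; case: b => // j _.
  have [s Fs e] := tr1 i j.
  by exists (fun l => if l is inl k then inl (s k) else l); rewrite ?e//; exists s.
have [s Fs e] := tr2 i j.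
by exists (fun l => if l is inr k then inr (s k) else l); rewrite ?e//; exists s.
Qed.

End LocalPermutations.

(** Trees are given by a parent function and a level, which makes induction from
    the root available and replaces the absence of cycles.  The labelling of a
    star is only injective: the missing labels are the places where branches can
    be hung. *)
Record labelled_tree (n : nat) := LabelledTree {
  node :> Type;
  nadj : node -> node -> Prop;
  ntype : node -> bool;
  label : node -> node -> 'I_n + Omega;
  origin : node;
  parent : node -> node;
  level : node -> nat;
  nadj_sym : forall x y, nadj x y -> nadj y x;
  nadj_parent : forall x, x <> origin -> nadj x (parent x);
  nadjE : forall x y, nadj x y -> (x <> origin /\ y = parent x) \/ (y <> origin /\ x = parent y);
  level_root : level origin = 0%N;
  level_parent : forall x, x <> origin -> level x = (level (parent x)).+1;
  ntype_adj : forall x y, nadj x y -> ntype y = ~~ ntype x;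
  label_type : forall x y, nadj x y -> has_type (ntype x) (label x y);
  label_inj : forall x y z, nadj x y -> nadj x z -> label x y = label x z -> y = z
}.

Definition full_tree n (X : labelled_tree n) :=
  forall (x : X) l, has_type (ntype x) l -> exists2 y, nadj x y & label x y = l.

Section Isomorphism.
Variables (n : nat) (F1 : permgroup 'I_n) (F2 : permgroup Omega).
Hypothesis Ftr : transitive_groups F1 F2.
Variables X Y : labelled_tree n.
Hypotheses (Xfull : full_tree X) (Yfull : full_tree Y).
Hypothesis XYroot : ntype (origin X) = ntype (origin Y).
Local Notation L := ('I_n + Omega)%type.
Local Notation P := (local_perm F1 F2).

Lemma level0 (Z : labelled_tree n) (x : Z) : level x = 0%N -> x = origin Z.
Proof. by move=> e; apply: contrapT => xr; rewrite level_parent in e. Qed.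

Lemma neighbor_total (y : Y) l : exists z, has_type (ntype y) l -> nadj y z /\ label y z = l.
Proof.
have [h|h] := boolP (has_type (ntype y) l); last by exists y.
by have [z ? ?] := Yfull h; exists z.
Qed.
Let nb y l := projT1 (cid (neighbor_total y l)).
Let nbP y l : has_type (ntype y) l -> nadj y (nb y l) /\ label y (nb y l) = l :=
  projT2 (cid (neighbor_total y l)).

Lemma alignment_total t (a b : L) :
  exists h, has_type t a -> has_type t b -> P t h /\ h a = b.
Proof.
have [ha|na] := boolP (has_type t a); last by exists id.
have [hb|n_b] := boolP (has_type t b); last by exists id.
by have [h ? ?] := local_perm_transitive Ftr ha hb; exists h.
Qed.
Let al t a b := projT1 (cid (alignment_total t a b)).
Let alP t a b : has_type t a -> has_type t b -> P t (al t a b) /\ al t a b a = b :=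
  projT2 (cid (alignment_total t a b)).

(* the image of [x] together with the permutation that aligns the labels around
   [x] with those around its image *)
Let st := fix st (m : nat) (x : X) : Y * (L -> L) :=
  if m is m'.+1 then
    let y := (st m' (parent x)).1 in
    let y' := nb y ((st m' (parent x)).2 (label (parent x) x)) in
    (y', al (ntype x) (label x (parent x)) (label y' y))
  else (origin Y, id).
Let psi x := (st (level x) x).1.
Let al_at x := (st (level x) x).2.

Lemma psi_root : psi (origin X) = origin Y.
Proof. by rewrite /psi level_root. Qed.

Lemma psi_child x : x <> origin X ->
  psi x = nb (psi (parent x)) (al_at (parent x) (label (parent x) x)).
Proof. by move=> xr; rewrite /psi /al_at (level_parent xr). Qed.

Lemma al_at_child x : x <> origin X ->
  al_at x = al (ntype x) (label x (parent x)) (label (psi x) (psi (parent x))).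
Proof. by move=> xr; rewrite {1}/al_at psi_child// (level_parent xr). Qed.

(** The induction invariant.  A child cannot be sent to the parent of the image,
    because the alignment already matches the parents. *)
Definition aligned_at x :=
  [/\ ntype (psi x) = ntype x, P (ntype x) (al_at x), level (psi x) = level x &
   x <> origin X -> [/\ nadj (psi (parent x)) (psi x), parent (psi x) = psi (parent x),
     psi x <> origin Y,
     label (psi (parent x)) (psi x) = al_at (parent x) (label (parent x) x) &
     label (psi x) (psi (parent x)) = al_at x (label x (parent x))]].

Lemma aligned x : aligned_at x.
Proof.
move: {2}(level x) (erefl (level x)) => m; elim: m x => [|m IH] x lx.
  have xr := level0 lx; split => [|||//]; rewrite xr.
  - by rewrite psi_root XYroot.
  - by rewrite /al_at level_root; exact: local_perm_id.
  - by rewrite psi_root !level_root.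
have xr : x <> origin X by move=> e; rewrite e level_root in lx.
have xp := nadj_parent xr; have px := nadj_sym xp.
move: (lx); rewrite (level_parent xr) => -[lp].
set p := parent x in xp px lp *; have [tp Pp lvp Hp] := IH p lp.
have ok : has_type (ntype (psi p)) (al_at p (label p x)).
  by rewrite tp; apply: local_perm_type Pp _; exact: label_type.
have [a1 a2] := nbP ok; rewrite -psi_child// in a1 a2.
have child : psi x <> origin Y /\ psi p = parent (psi x).
  case: (nadjE a1) => // -[pr e].
  have prX : p <> origin X by move=> e'; apply: pr; rewrite e' psi_root.
  have [b1 b2 _ _ b5] := Hp prX.
  rewrite e b2 b5 in a2.
  have := local_perm_inj Pp (label_type (nadj_parent prX)) (label_type px) a2.
  move/(label_inj (nadj_parent prX) px) => e'.
  by have := level_parent prX; rewrite e' lx lp; lia.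
have tx : ntype (psi x) = ntype x by rewrite (ntype_adj a1) tp (ntype_adj px).
have okx : has_type (ntype x) (label (psi x) (psi p)).
  by rewrite -tx; exact/label_type/nadj_sym.
have [c1 c2] := alP (label_type xp) okx.
split=> // [||_].
- by rewrite al_at_child.
- by rewrite level_parent; [rewrite -child.2 lvp lp lx|exact: child.1].
- split=> //; [by rewrite -child.2|exact: child.1|by rewrite al_at_child].
Qed.

Lemma psi_adj x y : nadj x y -> nadj (psi x) (psi y) /\
  label (psi x) (psi y) = al_at x (label x y).
Proof.
case/nadjE => -[nr ->].
  by have [_ _ _ /(_ nr) [/nadj_sym]] := aligned x.
by have [_ _ _ /(_ nr) []] := aligned y.
Qed.

Lemma psi_inj : injective psi.
Proof.
move=> x x'; have [_ _ lx _] := aligned x; have [_ _ lx' _] := aligned x'.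
move=> e; have ll : level x' = level x by rewrite -lx -lx' e.
move: {2}(level x) (erefl (level x)) ll => m; elim: m x x' e {lx lx'} => [|m IH] x x' e lx ll.
  by rewrite (level0 lx) (level0 (etrans ll lx)).
have xr : x <> origin X by move=> e'; rewrite e' level_root in lx.
have xr' : x' <> origin X by move=> e'; rewrite lx e' level_root in ll.
have [_ _ _ /(_ xr) [a1 a2 _ a4 _]] := aligned x.
have [_ _ _ /(_ xr') [b1 b2 _ b4 _]] := aligned x'.
have ep : parent x = parent x'.
  move: lx ll; rewrite (level_parent xr) (level_parent xr') => -[lx] [ll].
  by apply: IH => //; rewrite -a2 -b2 e.
have px := nadj_sym (nadj_parent xr); have px' := nadj_sym (nadj_parent xr').
rewrite -ep -e a4 in b4; rewrite -ep in px'.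
have [_ Pp _ _] := aligned (parent x).
by apply: (label_inj px px'); exact: (local_perm_inj Pp (label_type px) (label_type px') b4).
Qed.

Lemma psi_surj y : exists x, psi x = y.
Proof.
move: {2}(level y) (erefl (level y)) => m; elim: m y => [|m IH] y ly.
  by exists (origin X); rewrite psi_root (level0 ly).
have yr : y <> origin Y by move=> e; rewrite e level_root in ly.
move: (ly); rewrite (level_parent yr) => -[/IH [p pE]].
have py := nadj_sym (nadj_parent yr); rewrite -pE in py.
have [tp Pp lp Hp] := aligned p.
have [|l lt le] := local_perm_surj Pp (l := label (psi p) y).
  by rewrite -tp; exact: label_type.
have [x px xl] := Xfull lt; have [a1 a2] := psi_adj px.
by exists x; apply: (label_inj a1 py); rewrite a2 xl.
Qed.

(** The tree is unique because transitivity allows, at every vertex, to align the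
    label of the parent; the labels of the children follow. *)
Theorem full_tree_iso : exists (f : X -> Y) (g : Y -> X),
  [/\ cancel f g, cancel g f, forall x, ntype (f x) = ntype x,
      forall x y, nadj (f x) (f y) <-> nadj x y &
      forall x, exists2 h, P (ntype x) h &
        forall y, nadj x y -> label (f x) (f y) = h (label x y)].
Proof.
pose g y := projT1 (cid (psi_surj y)).
have gK : cancel g psi by move=> y; exact: (projT2 (cid (psi_surj y))).
have Kg : cancel psi g by move=> x; apply: psi_inj; rewrite gK.
exists psi, g; split=> // [x|x y|x].
- by have [] := aligned x.
- split=> [h|/psi_adj[]//].
  have par z : psi z <> origin Y -> parent (psi z) = psi (parent z) /\ z <> origin X.
    move=> zr; have zX : z <> origin X by move=> e; apply: zr; rewrite e psi_root.
    by have [_ _ _ /(_ zX) []] := aligned z.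
  case: (nadjE h) => -[/par [-> nr] /psi_inj ->].
    exact: nadj_parent.
  exact/nadj_sym/nadj_parent.
- exists (al_at x); first by have [] := aligned x.
  by move=> y /psi_adj[].
Qed.

End Isomorphism.

(** * Hanging branches at the missing labels *)

Section ColoredToLabelled.
Variables (n : nat) (T : colored_tree n) (r : T).
Let tT := adj_tree T.
Local Notation k := (@tree_color n T).

Lemma colored_nadjE (x y : T) : adj x y ->
  (x <> r /\ y = step tT x r) \/ (y <> r /\ x = step tT y r).
Proof. exact: edge_parent. Qed.

Lemma colored_parent (x : T) : x <> r -> adj x (step tT x r).
Proof. by move=> /nesym/(stepP tT)[]. Qed.

Lemma colored_type (x y : T) : adj x y -> has_type (inA x) (k (x, y)).
Proof.
move=> xy; have [Ax|Bx] := boolP (inA x).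
  by have [i ->] := colorA Ax xy.
by have [c ->] := colorB Bx xy.
Qed.

Lemma colored_sym (x y : T) : adj x y -> adj y x.
Proof. by rewrite (edge_sym tT). Qed.

Definition labelled_of_colored : labelled_tree n :=
  @LabelledTree n T (fun x y => adj x y) (@inA n T) (fun x y => k (x, y)) r
    (fun x => step tT x r) (depth tT r) colored_sym colored_parent colored_nadjE
    (depth_root tT r) (@depth_step _ _ tT r) (@adj_side n T) colored_type (@color_inj n T).

Lemma labelled_of_colored_full : full_tree labelled_of_colored.
Proof.
move=> x [i|c] /= tx.
  by have [y xy e] := neighborA i tx; exists y.
by have [y xy e] := neighborB c tx; exists y.
Qed.

End ColoredToLabelled.

Section Hanging.
Variables (n : nat) (i0 : 'I_n) (Z : labelled_tree n).
Local Notation L := ('I_n + Omega)%type.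

(** Vertices of the hanging branches are pairs of a vertex [z] and a word, read
    from its end: the last letter is a label missing at [z], and the other
    letters avoid the base label, which leads back towards [z].  The empty word
    gives [z] itself. *)
Definition word_type (z : Z) (w : seq L) : bool := ntype z (+) odd (size w).

Definition base_label (t : bool) : L := if t then inl i0 else inr (qz 0).

Lemma base_label_type t : has_type t (base_label t). Proof. by case: t. Qed.

Definition missing (z : Z) (a : L) := forall z', nadj z z' -> label z z' <> a.

Fixpoint hangs (z : Z) (w : seq L) : Prop :=
  match w with
  | [::] => True
  | a :: w' => [/\ has_type (word_type z w') a,
      if w' is [::] then missing z a else a <> base_label (word_type z w') &
      hangs z w']
  end.

Definition hung := {p : Z * seq L | hangs p.1 p.2}.

Lemma hung_eq (p q : hung) : sval p = sval q -> p = q.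
Proof.
case: p q => [p hp] [q hq] /= e; subst q; congr (exist _ _ _); exact: Prop_irrelevance.
Qed.

Definition Hung z w (h : hangs z w) : hung := exist (fun p => hangs p.1 p.2) (z, w) h.

Definition inZ (z : Z) : hung := @Hung z [::] I.

Definition wadj (p q : Z * seq L) : Prop :=
  [\/ [/\ p.2 = [::], q.2 = [::] & nadj p.1 q.1],
      p.1 = q.1 /\ (exists a, p.2 = a :: q.2) |
      p.1 = q.1 /\ (exists a, q.2 = a :: p.2)].

Definition wlabel (p q : Z * seq L) : L :=
  if (size p.2 < size q.2)%N then (if q.2 is a :: _ then a else inl i0)
  else if p.2 is [::] then label p.1 q.1 else base_label (word_type p.1 p.2).

Definition wparent (p : Z * seq L) : Z * seq L :=
  if p.2 is a :: w then (p.1, w) else (parent p.1, [::]).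

Lemma wparent_hangs (p : hung) : hangs (wparent (sval p)).1 (wparent (sval p)).2.
Proof. by case: p => [[z [|a w]] //= []]. Qed.

Definition hparent (p : hung) : hung :=
  exist (fun p => hangs p.1 p.2) (wparent (sval p)) (wparent_hangs p).

Definition hadj (p q : hung) := wadj (sval p) (sval q).
Definition htype (p : hung) := word_type (sval p).1 (sval p).2.
Definition hlabel (p q : hung) := wlabel (sval p) (sval q).
Definition hroot : hung := inZ (origin Z).
Definition hlevel (p : hung) := (level (sval p).1 + size (sval p).2)%N.

Lemma hadj_sym p q : hadj p q -> hadj q p.
Proof.
case=> [[h1 h2 /nadj_sym h3]|[e [a h]]|[e [a h]]].
- by apply: Or31.
- by apply: Or33; split=> //; exists a.
- by apply: Or32; split=> //; exists a.
Qed.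

Lemma hroot_neq z h : @Hung z [::] h <> hroot -> z <> origin Z.
Proof. by move=> n0 e; apply: n0; apply: hung_eq; rewrite /= e. Qed.

Lemma hadj_parent p : p <> hroot -> hadj p (hparent p).
Proof.
case: p => [[z [|a w]] h] pr; last by apply: Or32; split=> //; exists a.
by apply: Or31; split=> //; apply: nadj_parent; exact: hroot_neq pr.
Qed.

Lemma hadjE p q : hadj p q -> (p <> hroot /\ q = hparent p) \/ (q <> hroot /\ p = hparent q).
Proof.
case: p q => [[z w] hz] [[z' w'] hz'] /=.
case=> /= [[e e' /nadjE zz]|[e [a e']]|[e [a e']]].
- subst w w'; case: zz => -[nr e]; [left|right]; split.
  + by move=> /(congr1 sval)[].
  + by apply: hung_eq; rewrite /= e.
  + by move=> /(congr1 sval)[].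
  + by apply: hung_eq; rewrite /= e.
- subst z' w; left; split; first by move=> /(congr1 sval).
  exact: hung_eq.
- subst z' w'; right; split; first by move=> /(congr1 sval).
  exact: hung_eq.
Qed.

Lemma hlevel_root : hlevel hroot = 0%N.
Proof. by rewrite /hlevel /= level_root. Qed.

Lemma hlevel_parent p : p <> hroot -> hlevel p = (hlevel (hparent p)).+1.
Proof.
case: p => [[z [|a w]] h] pr; rewrite /hlevel /= ?addn0 ?addnS//.
by rewrite level_parent//; exact: hroot_neq pr.
Qed.

Lemma htype_adj p q : hadj p q -> htype q = ~~ htype p.
Proof.
rewrite /hadj /htype; case: (sval p) (sval q) => [z w] [z' w'] [] /=.
- by case=> -> -> /ntype_adj; rewrite /word_type /= !addbF.
- by case=> <- [a ->]; rewrite /word_type /= addbN negbK.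
- by case=> <- [a ->]; rewrite /word_type /= addbN.
Qed.

Lemma hlabel_type p q : hadj p q -> has_type (htype p) (hlabel p q).
Proof.
rewrite /hadj /htype /hlabel /wlabel; case: p q => [[z w] hz] [[z' w'] hz'] /= [] /=.
- by case=> -> -> /label_type; rewrite /word_type /= addbF.
- case=> _ [a ->] /=; rewrite ltnNge leqnSn /=; exact: base_label_type.
- move=> [e [a e']]; subst z' w'; rewrite /= ltnSn.
  by case: hz'.
Qed.

Lemma hlabel_inj p q q' : hadj p q -> hadj p q' -> hlabel p q = hlabel p q' -> q = q'.
Proof.
case: p q q' => [[z w] h] [[z1 w1] h1] [[z2 w2] h2]; rewrite /hadj /hlabel /wlabel /=.
case=> /= [[e1 e1' a1]|[e1 [l1 e1']]|[e1 [l1 e1']]];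
case=> /= [[e2 e2' a2]|[e2 [l2 e2']]|[e2 [l2 e2']]]; subst => //=; rewrite ?ltnn ?ltnSn //=.
- by move=> e; apply: hung_eq; rewrite /= (label_inj a1 a2 e).
- by move=> e; have [_ m _] := h2; case: (m _ a1).
- by move=> _; apply: hung_eq; case: e2' => _ /= ->.
- by rewrite ltnNge leqnSn /= => e; have [_ m _] := h2; case: m.
- by move=> e; have [_ m _] := h1; case: (m _ a2).
- by rewrite ltnNge leqnSn /= => e; have [_ m _] := h1; case: m.
- by move=> e; apply: hung_eq; rewrite /= e.
Qed.

Definition hung_tree : labelled_tree n :=
  @LabelledTree n hung hadj htype hlabel hroot hparent hlevel hadj_sym hadj_parent
    hadjE hlevel_root hlevel_parent htype_adj hlabel_type hlabel_inj.

Lemma hung_tree_full : full_tree hung_tree.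
Proof.
move=> [[z w] h] l /= tl; case: w h tl => [|a w] h; rewrite /htype /= => tl.
  have [[z' zz' e]|nz] := pselect (exists2 z', nadj z z' & label z z' = l).
    exists (inZ z'); first by apply: Or31.
    by rewrite /hlabel /wlabel.
  have hl : hangs z [:: l] by split=> // z' zz' e; apply: nz; exists z'.
  by exists (Hung hl) => //; apply: Or33; split=> //; exists l.
have [e|nb] := pselect (l = base_label (word_type z (a :: w))).
  have hw : hangs z w by case: h.
  exists (Hung hw); first by apply: Or32; split=> //; exists a.
  by rewrite /hlabel /wlabel /= ltnNge leqnSn.
have hl : hangs z (l :: a :: w) by split.
exists (Hung hl); first by apply: Or33; split=> //; exists l.
by rewrite /hlabel /wlabel /= ltnSn.
Qed.

End Hanging.

(** * Extending an action to the hanging branches *)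

Section HangingAction.
Variables (n : nat) (i0 : 'I_n) (F1 : permgroup 'I_n) (F2 : permgroup Omega).
Local Notation L := ('I_n + Omega)%type.
Local Notation P := (local_perm F1 F2).

(** The labels of the edges at [z] determine the cocycle on these labels only; its
    values on the missing labels are the additional datum that makes the action
    extend to the hanging branches. *)
Record local_action (G : topologicalGroupType) (Z : labelled_tree n) := LocalAction {
  act_on : G -> Z -> Z;
  cocycle : G -> Z -> L -> L;
  act_on1 : forall z, act_on 1%g z = z;
  act_onM : forall g h z, act_on (g * h)%g z = act_on g (act_on h z);
  act_on_adj : forall g z z', nadj z z' -> nadj (act_on g z) (act_on g z');
  act_on_type : forall g z, ntype (act_on g z) = ntype z;
  cocycle_perm : forall g z, P (ntype z) (cocycle g z);
  cocycle_label : forall g z z', nadj z z' ->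
    label (act_on g z) (act_on g z') = cocycle g z (label z z');
  cocycleM : forall g h z l, has_type (ntype z) l ->
    cocycle (g * h)%g z l = cocycle g (act_on h z) (cocycle h z l)
}.

Variables (G : topologicalGroupType) (Z : labelled_tree n) (A : local_action G Z).

Lemma cocycle1 z l : has_type (ntype z) l -> cocycle A 1%g z l = l.
Proof.
move=> tl; apply: (local_perm_inj (cocycle_perm A 1%g z)) => //.
  by apply: local_perm_type tl; exact: cocycle_perm.
by rewrite -{1}(act_on1 A z) -cocycleM// mulg1.
Qed.

Lemma act_onK g z : act_on A g^-1%g (act_on A g z) = z.
Proof. by rewrite -act_onM mulVg act_on1. Qed.

Lemma act_onVK g z : act_on A g (act_on A g^-1%g z) = z.
Proof. by rewrite -act_onM mulgV act_on1. Qed.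

(* only the letter next to [z] is moved *)
Fixpoint act_word (s : L -> L) (w : seq L) : seq L :=
  match w with
  | [::] => [::]
  | a :: w' => (if w' is [::] then s a else a) :: act_word s w'
  end.

Lemma size_act_word s w : size (act_word s w) = size w.
Proof. by elim: w => //= a w ->. Qed.

Lemma word_type_act g z w :
  word_type (act_on A g z) (act_word (cocycle A g z) w) = word_type z w.
Proof. by rewrite /word_type size_act_word act_on_type. Qed.

Lemma missing_act g z a : has_type (ntype z) a -> missing z a ->
  missing (act_on A g z) (cocycle A g z a).
Proof.
move=> ta m z' zz' e.
pose y := act_on A g^-1%g z'.
have zy : nadj z y by rewrite -(act_onK g z); exact: act_on_adj.
apply: (m y zy); apply: (local_perm_inj (cocycle_perm A g z)) => //.
  exact: label_type.
by rewrite -cocycle_label// act_onVK.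
Qed.

Lemma act_word_hangs g z w : hangs i0 z w ->
  hangs i0 (act_on A g z) (act_word (cocycle A g z) w).
Proof.
elim: w => //= a w IH [ta ma /IH hw]; split=> //.
- rewrite word_type_act; case: w ta {ma IH hw} => //.
  rewrite /word_type /= addbF; apply: local_perm_type; exact: cocycle_perm.
- case: w ta ma {IH hw} => [ta|b w _]; last first.
    by have /= -> := word_type_act g z (b :: w).
  by apply: missing_act; rewrite /word_type /= addbF in ta.
Qed.

Definition hact g (p : hung i0 Z) : hung i0 Z :=
  exist (fun p => hangs i0 p.1 p.2)
    (act_on A g (sval p).1, act_word (cocycle A g (sval p).1) (sval p).2)
    (act_word_hangs g (svalP p)).

Lemma hactM g h p : hact (g * h)%g p = hact g (hact h p).
Proof.
apply: hung_eq; case: p => [[z w] hw] /=; rewrite act_onM; congr (_, _).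
elim: w hw => //= a w IH [ta ma /IH ->]; congr (_ :: _).
case: w ta {ma IH} => // ta; apply: cocycleM.
by rewrite /word_type /= addbF in ta.
Qed.

Lemma hact1 p : hact 1%g p = p.
Proof.
apply: hung_eq; case: p => [[z w] hw] /=; rewrite act_on1; congr (_, _).
elim: w hw => //= a w IH [ta ma /IH ->]; congr (_ :: _).
case: w ta {ma IH} => // ta; apply: cocycle1.
by rewrite /word_type /= addbF in ta.
Qed.

Lemma hact_adj g p q : hadj p q -> hadj (hact g p) (hact g q).
Proof.
case: p q => [[z w] hz] [[z' w'] hz'] [] /=.
- by case=> /= e e' zz; subst w w'; apply: Or31; split=> //=; exact: act_on_adj.
- move=> [/= e [a e']]; subst z' w; apply: Or32; split=> //=.
  by case: w' {hz hz'} => [|b w']; [exists (cocycle A g z a)|exists a].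
- move=> [/= e [a e']]; subst z' w'; apply: Or33; split=> //=.
  by case: w {hz hz'} => [|b w']; [exists (cocycle A g z a)|exists a].
Qed.

Lemma hact_type g p : htype (hact g p) = htype p.
Proof. exact: word_type_act. Qed.

(** On the hanging branches the action is rigid, hence locally trivial. *)
Definition hcocycle g (p : hung i0 Z) : L -> L :=
  if (sval p).2 is [::] then cocycle A g (sval p).1 else id.

Lemma hcocycle_perm g p : P (htype p) (hcocycle g p).
Proof.
case: p => [[z [|a w]] h]; rewrite /hcocycle /htype /=; last exact: local_perm_id.
by rewrite /word_type /= addbF; exact: cocycle_perm.
Qed.

Lemma hcocycle_label g p q : hadj p q ->
  hlabel (hact g p) (hact g q) = hcocycle g p (hlabel p q).
Proof.
case: p q => [[z w] hz] [[z' w'] hz']; rewrite /hadj /hlabel /hcocycle /wlabel /=.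
rewrite !size_act_word; case=> [/= [e e' zz]|[/= e [a e']]|[/= e [a e']]].
- by subst w w'; rewrite /= cocycle_label.
- by subst z' w; rewrite /= ltnNge leqnSn /= -/(act_word _ (a :: w')) word_type_act.
- by subst z' w'; rewrite /= ltnSn; case: w {hz hz'}.
Qed.

Variable T : colored_tree n.
Hypothesis Ftr : transitive_groups F1 F2.

Lemma root_exists t : exists r : T, inA r = t.
Proof.
have [[x] _ _ _ _] := adj_tree T.
have [y xy] : exists y : T, adj x y.
  have [Ax|Bx] := boolP (inA x).
    by have [y] := neighborA i0 Ax; exists y.
  by have [y] := neighborB (qz 0) Bx; exists y.
have := adj_side xy; case ex: (inA x) => ey; case: t;
  by [exists x|exists y].
Qed.

(** With the words hung at its missing labels, [Z] becomes a full tree, which is a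
    copy of [T].  The last clause is what continuity needs: a hanging branch is
    moved according to one value of the action and one value of the cocycle. *)
Theorem hanging_embedding : exists (Phi : G -> universal_group T F1 F2) (psi : Z -> T),
  [/\ {morph Phi : g h / (g * h)%g}, injective psi,
      forall g z, val (Phi g) (psi z) = psi (act_on A g z) &
      forall t : T, exists z l, has_type (ntype z) l /\
        forall g g', act_on A g z = act_on A g' z -> cocycle A g z l = cocycle A g' z l ->
          val (Phi g) t = val (Phi g') t].
Proof.
have [r rE] := root_exists (ntype (origin Z)).
have rE' : ntype (origin (hung_tree i0 Z)) = ntype (origin (labelled_of_colored r)).
  by rewrite /= rE /htype /word_type /= addbF.
have [f [f' [fK f'K ft fadj flab]]] := full_tree_iso Ftr (@hung_tree_full _ i0 Z)
  (@labelled_of_colored_full _ T r) rE'.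
pose a g (x : T) : T := f (hact g (f' x)).
have aM g h x : a (g * h)%g x = a g (a h x) by rewrite /a fK hactM.
have a1 x : a 1%g x = x by rewrite /a hact1 f'K.
have aK g : cancel (a g) (a g^-1%g) by move=> x; rewrite -aM mulVg a1.
have aVK g : cancel (a g^-1%g) (a g) by move=> x; rewrite -aM mulgV a1.
pose s g : sym T := Defs.Sym (aK g) (aVK g).
have fadj' x y : adj x y <-> hadj (f' x) (f' y).
  by have := fadj (f' x) (f' y); rewrite !f'K.
have ft' x : htype (f' x) = inA x by have := ft (f' x); rewrite f'K.
have sadj g x y : adj x y -> adj (a g x) (a g y).
  by move=> /fadj' xy; apply/fadj; exact: hact_adj.
have saE g x y : adj (a g x) (a g y) = adj x y.
  apply/idP/idP; last exact: sadj.
  by move/(sadj g^-1%g); rewrite !aK.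
have sA g x : inA (a g x) = inA x.
  have := ft (hact g (f' x)); rewrite /= -[f _]/(a g x) => ->.
  by rewrite hact_type ft'.
(* the local action at [v] is conjugate, by alignments, to the one at [f' v] *)
have loc g v : exists2 h, P (inA v) h &
    forall w, adj v w -> tree_color (a g v, a g w) = h (tree_color (v, w)).
  have [h1 P1 H1] := flab (f' v); have [h2 P2 H2] := flab (hact g (f' v)).
  rewrite /= ft' in P1; rewrite /= hact_type ft' in P2.
  have P3 := hcocycle_perm g (f' v); rewrite ft' in P3.
  have H w : adj v w -> tree_color (v, w) = h1 (hlabel (f' v) (f' w)) /\
      tree_color (a g v, a g w) = h2 (hcocycle g (f' v) (hlabel (f' v) (f' w))).
    move=> /fadj' vw; have := H1 _ vw; rewrite /= !f'K => ->; split=> //.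
    by have := H2 _ (hact_adj g vw); rewrite /= hcocycle_label.
  have [Av|Bv] := boolP (inA v).
    rewrite Av in P1 P2 P3.
    have [[s1 F1s E1] [s2 F2s E2] [s3 F3s E3]] := And3 P1 P2 P3.
    exists (fun l => if l is inl i then inl ((s2 * s3 * s1^-1)%g i) else l).
      exists (s2 * s3 * s1^-1)%g => //.
      by apply: permgroupM; [exact: permgroupM|exact: permgroupV].
    move=> w vw; have [-> ->] := H w vw; have := hlabel_type ((fadj' v w).1 vw).
    rewrite ft' Av; case: (hlabel (f' v) (f' w)) => // i _.
    by rewrite E1 E3 E2 /= !symK.
  rewrite (negPf Bv) in P1 P2 P3.
  have [[s1 F1s E1] [s2 F2s E2] [s3 F3s E3]] := And3 P1 P2 P3.
  exists (fun l => if l is inr i then inr ((s2 * s3 * s1^-1)%g i) else l).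
    exists (s2 * s3 * s1^-1)%g => //.
    by apply: permgroupM; [exact: permgroupM|exact: permgroupV].
  move=> w vw; have [-> ->] := H w vw; have := hlabel_type ((fadj' v w).1 vw).
  rewrite ft' (negPf Bv); case: (hlabel (f' v) (f' w)) => // i _.
  by rewrite E1 E3 E2 /= !symK.
have sU g : universal_permgroup T F1 F2 (s g).
  split=> [x y|x|v Av|v Bv] /=; [exact: saE|exact: sA| |].
    have [h] := loc g v; rewrite Av => -[p Fp hp] hw.
    by exists p => // w i vw kw; rewrite hw// kw hp.
  have [h] := loc g v; rewrite (negPf Bv) => -[p Fp hp] hw.
  by exists p => // w i vw kw; rewrite hw// kw hp.
exists (fun g => SigSub (mem_set (sU g))), (fun z => f (inZ i0 z)).
split.
- by move=> g h; apply: val_inj; apply: sym_ext => x; rewrite valM symME /=; exact: aM.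
- by move=> z z' /(can_inj fK) /(congr1 sval) [].
- by move=> g z; rewrite /= /a fK; congr f; exact: hung_eq.
- move=> t; case E : (f' t) => [[z w] h].
  have [l [tl lP]] : exists l, has_type (ntype z) l /\
      forall g g', cocycle A g z l = cocycle A g' z l ->
      act_word (cocycle A g z) w = act_word (cocycle A g' z) w.
    elim: w h {E} => [_|b w IH [tb _ hw]] /=.
      by exists (base_label i0 (ntype z)); split=> //; exact: base_label_type.
    case: w tb hw IH => [tb _ _|c w tb hw IH].
      exists b; split; first by rewrite /word_type /= addbF in tb.
      by move=> g g' ->.
    have [l [tl lP]] := IH hw; exists l; split=> // g g' /lP e.
    by congr (_ :: _).
  exists z, l; split=> // g g' e1 e2 /=; rewrite /a E; congr f.
  by apply: hung_eq => /=; rewrite e1 (lP _ _ e2).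
Qed.

End HangingAction.

(** * From the n-regular rabbit to the m-regular one *)

Section Rotations.
Variable n : nat.

Definition sym_of_perm (p : {perm 'I_n}) : sym 'I_n :=
  Defs.Sym (permK p) (permKV p).

Definition rotation (k : nat) : sym 'I_n := sym_of_perm (perm (@ordS_inj n) ^+ k).

Lemma rotation_is_rotation k : Cyc n (rotation k).
Proof. by exists (perm (@ordS_inj n) ^+ k)%g => //; exact: mem_cycle. Qed.

Lemma rotationE k (i : 'I_n) : val (rotation k i) = ((i + k) %% n)%N.
Proof.
rewrite /=; elim: k => [|k IH]; first by rewrite expg0 perm1 addn0 modn_small.
by rewrite expgSr permM permE /= IH -addn1 modnDml addn1 addnS.
Qed.

Lemma is_rotationE (s : sym 'I_n) : is_rotation s ->
  exists k, forall i, val (s i) = ((i + k) %% n)%N.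
Proof.
by move=> [p /cycleP[k ->] sE]; exists k => i; rewrite sE -rotationE.
Qed.

Lemma Cyc_transitive (i j : 'I_n) : exists2 s : sym 'I_n, Cyc n s & s i = j.
Proof.
exists (rotation (j + (n - i))); first exact: rotation_is_rotation.
apply: val_inj; rewrite rotationE addnCA subnKC; last exact/ltnW.
by rewrite modnDr modn_small.
Qed.

Lemma rabbit_transitive : transitive_groups (Cyc n) AutO.
Proof. by split; [exact: Cyc_transitive|exact: AutO_transitive]. Qed.

End Rotations.

Section LocalActions.
Variables (n : nat) (T : colored_tree n).
Local Notation k := (@tree_color n T).
Local Notation G := (Homeo_plus_rabbit T).

Lemma rabbitP (g : G) : is_universal (Cyc n) AutO (val g).
Proof. exact: set_mem (valP g). Qed.

Lemma rabbit_adj (g : G) x y : adj x y -> adj (val g x) (val g y).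
Proof. by have [-> _ _ _] := rabbitP g. Qed.

Lemma rabbit_inA (g : G) x : inA (val g x) = inA x.
Proof. by have [_ -> _ _] := rabbitP g. Qed.

Lemma neighbor_exists (v : T) l : exists w, has_type (inA v) l -> adj v w /\ k (v, w) = l.
Proof.
have [|_] := boolP (has_type (inA v) l); last by exists v.
case: l => [i|c] tl; first by have [w ? ?] := neighborA i tl; exists w.
by have [w ? ?] := neighborB c tl; exists w.
Qed.

Definition neighbor v l := projT1 (cid (neighbor_exists v l)).

Lemma neighborP v l : has_type (inA v) l -> adj v (neighbor v l) /\ k (v, neighbor v l) = l.
Proof. exact: (projT2 (cid (neighbor_exists v l))). Qed.

Lemma neighborK v w : adj v w -> neighbor v (k (v, w)) = w.
Proof.
by move=> vw; have [a e] := neighborP (colored_type vw); exact: color_inj a vw e.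
Qed.

(** The local action of [g] at [v]; being read off from the colors of [T], it is a
    cocycle. *)
Definition loc (g : G) v l := k (val g v, val g (neighbor v l)).

Lemma locE (g : G) v w : adj v w -> k (val g v, val g w) = loc g v (k (v, w)).
Proof. by move=> vw; rewrite /loc neighborK. Qed.

Lemma loc_type (g : G) v l : has_type (inA v) l -> has_type (inA v) (loc g v l).
Proof.
move=> /neighborP[a _]; rewrite -(rabbit_inA g); apply: colored_type; exact: rabbit_adj.
Qed.

Lemma locM (g h : G) v l : has_type (inA v) l -> loc (g * h)%g v l = loc g (val h v) (loc h v l).
Proof.
move=> tl; have [a e] := neighborP tl.
by rewrite {3}/loc -locE; [|exact: rabbit_adj]; rewrite /loc valM !symME.
Qed.

Lemma loc_perm (g : G) v : local_perm (Cyc n) AutO (inA v) (loc g v).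
Proof.
have [_ _ gA gB] := rabbitP g; rewrite /local_perm; case: ifPn => [Av|Bv].
  have [s sF sP] := gA v Av; exists s => // i.
  have [a e] := @neighborP v (inl i) Av; exact: sP.
have [s sF sP] := gB v Bv; exists s => // c.
have [a e] := @neighborP v (inr c) Bv; exact: sP.
Qed.

Variable i0 : 'I_n.
Hypothesis i00 : val i0 = 0%N.

(** The angle of the rotation by which [g] acts around [v]. *)
Definition angle (g : G) v : nat := if loc g v (inl i0) is inl i then val i else 0%N.

Lemma angleP (g : G) v i : inA v ->
  exists2 j, loc g v (inl i) = inl j & val j = ((i + angle g v) %% n)%N.
Proof.
move=> Av; have := loc_perm g v; rewrite Av => -[s /is_rotationE[q qP] sP].
exists (s i); first exact: sP.
by rewrite /angle sP !qP i00 add0n modnDmr.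
Qed.

Lemma angleM (g h : G) v : inA v -> angle (g * h)%g v = ((angle h v + angle g (val h v)) %% n)%N.
Proof.
move=> Av; have Ahv : inA (val h v) by rewrite rabbit_inA.
have [j ej _] := angleP h i0 Av.
rewrite {1}/angle locM// ej; have [j' -> ->] := angleP g j Ahv.
by congr ((_ + _) %% _)%N; rewrite /angle ej.
Qed.

End LocalActions.

(** The first hypothesis gives injectivity and the continuity of the inverse.  The
    second one gives continuity, because a hanging branch is moved according to
    one value of the action and one value of the cocycle. *)
Lemma hanging_topological_embedding (n m : nat) (T : colored_tree n) (U : colored_tree m)
    (i0 : 'I_m) (Z : labelled_tree m)
    (A : local_action (Cyc m) AutO (Homeo_plus_rabbit T) Z) :
  (forall v : T, exists z : Z, forall g g', act_on A g z = act_on A g' z -> val g v = val g' v) ->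
  (forall (z : Z) l, has_type (ntype z) l -> exists s : seq T,
     forall g g' : Homeo_plus_rabbit T, (forall x, x \in s -> val g x = val g' x) ->
       act_on A g z = act_on A g' z /\ cocycle A g z l = cocycle A g' z l) ->
  embeds_as_topological_group (Homeo_plus_rabbit T) (Homeo_plus_rabbit U).
Proof.
move=> sees finite.
have [Phi [psi [PhiM psiI PhiE Philoc]]] := hanging_embedding i0 A U (@rabbit_transitive m).
exists Phi; apply: (@pointwise_embedding T U _ _ [set: T] [set: U] _ _ Phi) => //.
- move=> t _; have [z [l [tl zl]]] := Philoc t.
  have [s sP] := finite z l tl; exists s => // g h /sP[]; exact: zl.
- move=> v _; have [z zP] := sees v; exists (psi z) => // g h.
  by rewrite !PhiE => /psiI; exact: zP.
- by move=> g h gh; apply: val_inj; apply: sym_ext => v; exact: gh.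
Qed.

Section Multiples.
Variables (n d : nat) (T : colored_tree n).
Hypotheses (n0 : (0 < n)%N) (d0 : (0 < d)%N).
Local Notation m := (d * n)%N.
Local Notation G := (Homeo_plus_rabbit T).
Let tT := adj_tree T.
Let i0 : 'I_n := Ordinal n0.

Lemma spread_proof (i : 'I_n) : (d * i < m)%N.
Proof. by rewrite ltn_pmul2l. Qed.

Definition spread (l : 'I_n + Omega) : 'I_m + Omega :=
  match l with inl i => inl (Ordinal (spread_proof i)) | inr c => inr c end.

Lemma spread_inj : injective spread.
Proof.
move=> [i|c] [j|c'] //= [] => [/eqP|-> //].
by rewrite eqn_pmul2l// => /eqP e; congr inl; exact: val_inj.
Qed.

Lemma spread_type t l : has_type t (spread l) = has_type t l.
Proof. by case: l. Qed.

Variable r : T.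

Lemma spread_label_type (x y : T) : adj x y -> has_type (inA x) (spread (tree_color (x, y))).
Proof. by rewrite spread_type; exact: colored_type. Qed.

Lemma spread_label_inj (x y z : T) : adj x y -> adj x z ->
  spread (tree_color (x, y)) = spread (tree_color (x, z)) -> y = z.
Proof. by move=> xy xz /spread_inj; exact: color_inj. Qed.

Definition spread_tree : labelled_tree m :=
  @LabelledTree m T (fun x y => adj x y) (@inA n T) (fun x y => spread (tree_color (x, y)))
    r (fun x => step tT x r) (depth tT r) (@colored_sym n T) (@colored_parent n T r)
    (@colored_nadjE n T r) (depth_root tT r) (@depth_step _ _ tT r) (@adj_side n T)
    spread_label_type spread_label_inj.

(** Rotations by [r] become rotations by [d * r], also on the labels that are not
    multiples of [d]; the stars of class B have no missing label. *)
Definition spread_cocycle (g : G) (v : spread_tree) (l : 'I_m + Omega) : 'I_m + Omega :=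
  match l with
  | inl j => inl (rotation m (d * angle i0 g v) j)
  | inr c => spread (loc g v (inr c))
  end.

Lemma spread_cocycle_perm (g : G) v :
  local_perm (Cyc m) AutO (ntype v) (spread_cocycle g v).
Proof.
have := loc_perm g v; rewrite /local_perm /=; case: ifPn => [Av _|Bv [s sF sP]].
  by exists (rotation m (d * angle i0 g v)) => //; exact: rotation_is_rotation.
by exists s => // c; rewrite /= sP.
Qed.

Lemma spread_cocycle_label (g : G) (v w : spread_tree) : nadj v w ->
  spread (tree_color (val g v, val g w)) =
  spread_cocycle g v (spread (tree_color (v, w))).
Proof.
move=> vw; rewrite (locE g vw) /spread_cocycle.
case E : (tree_color (v, w)) => [i|c] //=.
have Av : inA v by have := colored_type vw; rewrite E.
have [j -> jE] := angleP (erefl : val i0 = 0%N) g i Av.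
congr inl; apply: val_inj; rewrite rotationE /= jE.
by rewrite -mulnDr muln_modr.
Qed.

Lemma spread_cocycleM (g h : G) (v : spread_tree) l : has_type (ntype v) l ->
  spread_cocycle (g * h)%g v l = spread_cocycle g (val h v) (spread_cocycle h v l).
Proof.
case: l => [j|c] tl.
  congr inl; apply: val_inj; rewrite !rotationE (angleM _ _ _ tl)//.
  by rewrite muln_modr modnDmr mulnDr modnDml addnA.
rewrite /= locM//; have := @loc_type n T h v (inr c) tl.
by case: (loc h v (inr c)) => [i|c'] //=; move: tl => /= /negPf ->.
Qed.

Definition spread_action : local_action (Cyc m) AutO G spread_tree :=
  @LocalAction m (Cyc m) AutO G spread_tree (fun g => val g) spread_cocycle
    (fun z => erefl) (fun g h z => erefl) (@rabbit_adj n T) (@rabbit_inA n T)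
    spread_cocycle_perm spread_cocycle_label spread_cocycleM.

Lemma rabbit_embeds_multiple (U : colored_tree m) :
  embeds_as_topological_group (Homeo_plus_rabbit T) (Homeo_plus_rabbit U).
Proof.
have m0 : (0 < m)%N by rewrite muln_gt0 d0.
apply: (@hanging_topological_embedding _ _ T U (Ordinal m0) _ spread_action).
- by move=> v; exists v.
- move=> v l tl.
  exists [:: v; neighbor v (inl i0); neighbor v (if l is inr c then inr c else inl i0)].
  move=> g g' gg'; have ev : val g v = val g' v by apply: gg'; rewrite inE eqxx.
  split=> //=; rewrite /spread_cocycle; case: l tl gg' => [j|c] tl gg'.
    have e1 : val g (neighbor v (inl i0)) = val g' (neighbor v (inl i0)).
      by apply: gg'; rewrite !inE eqxx !orbT.
    by rewrite /angle /loc ev e1.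
  by rewrite /loc ev gg'// !inE eqxx !orbT.
Qed.

End Multiples.

Lemma rabbit_embeds_dvdn (n m : nat) (Tn : colored_tree n) (Tm : colored_tree m) :
  (0 < n)%N -> (0 < m)%N -> (n %| m)%N ->
  embeds_as_topological_group (Homeo_plus_rabbit Tn) (Homeo_plus_rabbit Tm).
Proof.
move=> n0 m0 /dvdnP[d md]; subst m.
have d0 : (0 < d)%N by move: m0; rewrite muln_gt0 => /andP[].
have [[r] _ _ _ _] := adj_tree Tn.
exact: rabbit_embeds_multiple.
Qed.

(** * From the m-regular rabbit to the basilica *)

Section Subdivision.
Variables (m : nat) (T : colored_tree m) (r : T).
Hypothesis m0 : (0 < m)%N.
Let tT := adj_tree T.
Local Notation G := (Homeo_plus_rabbit T).
Local Notation k := (@tree_color m T).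
Local Notation edge := (edge T).
Let i0 : 'I_m := Ordinal m0.
Implicit Types h : edge.

Definition incident h (x : T) := x = (val h).1 \/ x = (val h).2.

Definition opposite h (x : T) := if inA x then (val h).2 else (val h).1.

Lemma incidentE h x : incident h x ->
  (val h).1 = (if inA x then x else opposite h x) /\
  (val h).2 = (if inA x then opposite h x else x).
Proof.
have [Av Bw _] := edgeP h; rewrite /opposite => -[->|->]; first by rewrite Av.
by rewrite (negPf Bw).
Qed.

Lemma opposite_adj h x : incident h x -> adj x (opposite h x).
Proof.
have [Av Bw vw] := edgeP h; rewrite /opposite => -[->|->]; first by rewrite Av.
by rewrite (negPf Bw); exact: colored_sym.
Qed.

Lemma oppositeK h x : incident h x -> opposite h (opposite h x) = x.
Proof.
have [Av Bw _] := edgeP h; rewrite /opposite => -[->|->]; first by rewrite Av (negPf Bw).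
by rewrite (negPf Bw) Av.
Qed.

Lemma incident_inj h h' x : incident h x -> incident h' x ->
  opposite h x = opposite h' x -> h = h'.
Proof.
by move=> /incidentE[e1 e2] /incidentE[e1' e2'] e; apply: edge_eq; rewrite ?e1 ?e2 ?e1' ?e2' e.
Qed.

Lemma edge_between (x y : T) : adj x y -> exists h, incident h x /\ opposite h x = y.
Proof.
move=> xy; have [Ax|Bx] := boolP (inA x).
  have H : inA x && adj x y by rewrite Ax.
  by exists (exist (fun h : T * T => is_true (inA h.1 && adj h.1 h.2)) (x, y) H);
    rewrite /opposite Ax; split=> //; left.
have H : inA y && adj y x by rewrite (adj_side xy) Bx colored_sym.
by exists (exist (fun h : T * T => is_true (inA h.1 && adj h.1 h.2)) (y, x) H);
  rewrite /opposite (negPf Bx); split=> //; right.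
Qed.

Lemma edge_root h : exists x, [/\ incident h x, x <> r & step tT x r = opposite h x].
Proof.
have [Av Bw vw] := edgeP h; case: (edge_parent tT r vw) => -[n e].
  by exists (val h).1; rewrite /opposite Av; split=> //; left.
by exists (val h).2; rewrite /opposite (negPf Bw); split=> //; right.
Qed.

Definition far h := projT1 (cid (edge_root h)).
Definition near h := opposite h (far h).

Lemma farP h : [/\ incident h (far h), far h <> r & step tT (far h) r = near h].
Proof. exact: (projT2 (cid (edge_root h))). Qed.

Lemma far_inj : injective far.
Proof.
move=> h h' e; have [a1 _ a3] := farP h; have [b1 _ b3] := farP h'.
by rewrite -e in b1; apply: (incident_inj a1 b1); rewrite -/(near h) -a3 e b3 /near.
Qed.

Lemma incident_near h : incident h (near h).
Proof. by rewrite /near /opposite; case: ifP => _; [right|left]. Qed.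

Lemma incident_cases h x : incident h x -> x = far h \/ x = near h.
Proof.
move=> hx; have [/incidentE[e1 e2] _ _] := farP h; rewrite /near.
by case: hx; rewrite ?e1 ?e2; case: ifP => _ ->; [left|right|right|left].
Qed.

Lemma up_exists x : exists h, x <> r -> far h = x.
Proof.
have [xr|xr] := pselect (x = r).
  have [y xy] : exists y : T, adj x y.
    have [Ax|Bx] := boolP (inA x).
      by have [y] := neighborA i0 Ax; exists y.
    by have [y] := neighborB (qz 0) Bx; exists y.
  by have [h _] := edge_between xy; exists h.
have [h [hx hs]] := edge_between (colored_parent xr); exists h => _.
case: (incident_cases hx) => [//|e]; exfalso.
have [h1 h2 h3] := farP h.
have fo : far h = step tT x r by rewrite -hs e [RHS]oppositeK.
have d1 := depth_step tT xr; have d2 := depth_step tT h2.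
by move: d1 d2; rewrite h3 -e -fo; lia.
Qed.

Definition up x := projT1 (cid (up_exists x)).

Lemma far_up x : x <> r -> far (up x) = x.
Proof. exact: (projT2 (cid (up_exists x))). Qed.

(** The [m] edges at a vertex of class A are spread evenly over the circle. *)
Definition to_circle (l : 'I_m + Omega) : 'I_2 + Omega :=
  inr (match l with inl i => qz ((val i)%:R / m%:R)%R | inr c => c end).

Lemma to_circle_inj t l l' : has_type t l -> has_type t l' ->
  to_circle l = to_circle l' -> l = l'.
Proof.
case: t; case: l => [i|c] // _; case: l' => [j|c'] // _ [].
  have m0' : (0 < m%:R :> rat)%R by rewrite ltr0n.
  have H (x : 'I_m) : qrep (qz ((val x)%:R / m%:R)%R) = ((val x)%:R / m%:R)%R.
    rewrite qzK ?divr_ge0 ?ler0n//.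
    by rewrite ltr_pdivrMr// mul1r ltr_nat; exact: ltn_ord.
  move=> /(congr1 qrep); rewrite !H => /mulIf e; congr inl; apply: val_inj.
  by apply/eqP; rewrite -(eqr_nat rat); apply/eqP/e; rewrite invr_eq0 gt_eqF.
by move=> ->.
Qed.

(** The subdivided tree: former vertices of both classes have infinite type, and
    the midpoints of the edges have type A. *)
Definition sub_node : Type := (T + edge)%type.

Definition sub_adj (a b : sub_node) : Prop :=
  match a, b with
  | inl x, inr h | inr h, inl x => incident h x
  | _, _ => False
  end.

Definition sub_type (a : sub_node) := if a is inr _ then true else false.

Definition sub_label (a b : sub_node) : 'I_2 + Omega :=
  match a, b with
  | inl x, inr h => to_circle (k (x, opposite h x))
  | _, inl x => inl (if inA x then ord0 else ord_max)
  | _, _ => inl ord0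
  end.

Definition sub_parent (a : sub_node) : sub_node :=
  match a with inl x => inr (up x) | inr h => inl (near h) end.

Definition sub_level (a : sub_node) : nat :=
  match a with inl x => (depth tT r x).*2 | inr h => (depth tT r (near h)).*2.+1 end.

Lemma sub_adj_sym a b : sub_adj a b -> sub_adj b a.
Proof. by case: a b => [x|h] [y|h']. Qed.

Lemma sub_adj_parent a : a <> inl r -> sub_adj a (sub_parent a).
Proof.
case: a => [x|h] n0 /=; last exact: incident_near.
have xr : x <> r by move=> e; apply: n0; rewrite e.
by have [h1 _ _] := farP (up x); rewrite far_up in h1.
Qed.

Lemma sub_adjE a b : sub_adj a b ->
  (a <> inl r /\ b = sub_parent a) \/ (b <> inl r /\ a = sub_parent b).
Proof.
have F h : inr h = sub_parent (inl (far h)) /\ inl (far h) <> inl r :> sub_node.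
  have [_ h2 _] := farP h; split; last by case.
  by congr inr; apply: far_inj; rewrite far_up.
case: a b => [x|h] [y|h'] //= /incident_cases[->|->].
- by left; have [-> ?] := F h'.
- by right.
- by right; have [-> ?] := F h.
- by left.
Qed.

Lemma sub_level_root : sub_level (inl r) = 0%N.
Proof. by rewrite /= depth_root. Qed.

Lemma sub_level_parent a : a <> inl r -> sub_level a = (sub_level (sub_parent a)).+1.
Proof.
case: a => [x|h] n0 //=.
have xr : x <> r by move=> e; apply: n0; rewrite e.
have [_ _] := farP (up x); rewrite far_up// => <-.
by rewrite (depth_step tT xr) doubleS.
Qed.

Lemma sub_type_adj a b : sub_adj a b -> sub_type b = ~~ sub_type a.
Proof. by case: a b => [x|h] [y|h']. Qed.

Lemma sub_label_type a b : sub_adj a b -> has_type (sub_type a) (sub_label a b).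
Proof. by case: a b => [x|h] [y|h']. Qed.

Lemma sub_label_inj a b c : sub_adj a b -> sub_adj a c ->
  sub_label a b = sub_label a c -> b = c.
Proof.
case: a b c => [x|h] [y|h1] [z|h2] //=.
  move=> x1 x2 /(to_circle_inj (colored_type (opposite_adj x1)) (colored_type (opposite_adj x2))).
  by move=> /(color_inj (opposite_adj x1) (opposite_adj x2))/(incident_inj x1 x2) ->.
move=> /incidentE[e1 e2] /incidentE[e3 e4].
by move: e1 e2 e3 e4; case: (inA y); case: (inA z) => // e1 e2 e3 e4 _; congr inl; congruence.
Qed.

Definition subdivision : labelled_tree 2 :=
  @LabelledTree 2 sub_node sub_adj sub_type sub_label (inl r) sub_parent sub_level
    sub_adj_sym sub_adj_parent sub_adjE sub_level_root sub_level_parent sub_type_adj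
    sub_label_type sub_label_inj.

Definition sub_act (g : G) (a : subdivision) : subdivision :=
  match a with inl x => inl (val g x) | inr h => inr (act_edge (rabbitP g) h) end.

Definition turn (g : G) (v : T) : rat := ((angle i0 g v)%:R / m%:R)%R.

(** At a midpoint the two labels are those of the classes of its ends, which are
    preserved. *)
Definition sub_cocycle (g : G) (a : subdivision) (l : 'I_2 + Omega) : 'I_2 + Omega :=
  match a, l with
  | inl v, inr c => if inA v then inr (translate (turn g v) c) else to_circle (loc g v (inr c))
  | _, _ => l
  end.

Lemma sub_act1 a : sub_act 1%g a = a.
Proof. by case: a => [x|h] //=; congr inr; exact: edge_eq. Qed.

Lemma sub_actM (g h : G) a : sub_act (g * h)%g a = sub_act g (sub_act h a).
Proof. by case: a => [x|e] //=; congr inr; exact: edge_eq. Qed.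

Lemma incident_act (g : G) h x : incident h x -> incident (act_edge (rabbitP g) h) (val g x).
Proof. by case=> ->; [left|right]. Qed.

Lemma opposite_act (g : G) h x :
  opposite (act_edge (rabbitP g) h) (val g x) = val g (opposite h x).
Proof. by rewrite /opposite rabbit_inA; case: ifP. Qed.

Lemma sub_act_adj (g : G) (a b : subdivision) : nadj a b -> nadj (sub_act g a) (sub_act g b).
Proof. by case: a b => [x|h] [y|h'] //=; exact: incident_act. Qed.

Lemma sub_act_type (g : G) (a : subdivision) : ntype (sub_act g a) = ntype a.
Proof. by case: a. Qed.

Lemma sub_cocycle_perm (g : G) (a : subdivision) :
  local_perm (Cyc 2) AutO (ntype a) (sub_cocycle g a).
Proof.
case: a => [v|h] /=; last by exists 1%g => //; exact: (@permgroup1 _ (Cyc 2)).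
have := loc_perm g v; rewrite /local_perm; case: (inA v) => [_|[s sO sP]].
  by exists (translate (turn g v)) => //; exact: translate_aut.
by exists s => // c; rewrite sP.
Qed.

Lemma qz_modn (i : nat) : qz ((i %% m)%N%:R / m%:R)%R = qz (i%:R / m%:R)%R.
Proof.
have m0' : (m%:R != 0 :> rat)%R by rewrite pnatr_eq0 -lt0n.
rewrite [in RHS](divn_eq i m) natrD natrM mulrDl mulfK// addrC.
by rewrite -[(i %/ m)%:R%R]/((i %/ m)%:Z%:~R%R) qz_shift.
Qed.

Lemma sub_cocycle_label (g : G) (a b : subdivision) : nadj a b ->
  label (sub_act g a) (sub_act g b) = sub_cocycle g a (label a b).
Proof.
case: a b => [x|h] [y|h'] //= xh; last by rewrite rabbit_inA.
rewrite opposite_act (locE g (opposite_adj xh)).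
have := colored_type (opposite_adj xh); case: ifP => [Ax|Bx].
  case: (k _) => // i _; have [j -> jE] := angleP (erefl : val i0 = 0%N) g i Ax.
  rewrite -[RHS]/(inr (translate (turn g x) (qz ((val i)%:R / m%:R)%R))).
  by rewrite translateE /to_circle jE qz_modn natrD mulrDl.
by case: (k _).
Qed.

Lemma qz_addl (x y z : rat) : qz y = qz z -> qz (x + y)%R = qz (x + z)%R.
Proof. by move=> /qz_eq yz; apply/qz_eq; rewrite opprD addrACA subrr add0r. Qed.

Lemma translate_turnM (g h : G) (v : T) c : inA v ->
  translate (turn (g * h)%g v) c = translate (turn g (val h v)) (translate (turn h v) c).
Proof.
move=> Av; rewrite -[c]qrepK !translateE /turn angleM//.
rewrite -[X in _ = qz X]addrA; apply: qz_addl.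
by rewrite qz_modn natrD mulrDl.
Qed.

Lemma sub_cocycleM (g h : G) a l : has_type (ntype a) l ->
  sub_cocycle (g * h)%g a l = sub_cocycle g (sub_act h a) (sub_cocycle h a l).
Proof.
case: a => [v|e] //=; case: l => // c _; rewrite rabbit_inA.
have [Av|Bv] := boolP (inA v); first by congr inr; exact: translate_turnM.
rewrite locM ?(negPf Bv)//=.
have := @loc_type m T h v (inr c); rewrite (negPf Bv) => /(_ isT).
by case: (loc h v (inr c)) => // c' _.
Qed.

Definition sub_action : local_action (Cyc 2) AutO G subdivision :=
  @LocalAction 2 (Cyc 2) AutO G subdivision sub_act sub_cocycle sub_act1 sub_actM
    sub_act_adj sub_act_type sub_cocycle_perm sub_cocycle_label sub_cocycleM.

Lemma subdivision_embeds (U : colored_tree 2) :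
  embeds_as_topological_group (Homeo_plus_rabbit T) (Homeo_plus_rabbit U).
Proof.
apply: (@hanging_topological_embedding _ _ T U ord0 _ sub_action).
- by move=> v; exists (inl v) => g g' [].
- move=> [v|h] l tl; last first.
    exists [:: (val h).1; (val h).2] => g g' gg'; split=> //=.
    congr inr; apply: edge_eq => /=; apply: gg'; rewrite !inE eqxx ?orbT//.
  exists [:: v; neighbor v (inl i0); neighbor v (if l is inr c then inr c else inl i0)].
  move=> g g' gg'; have ev : val g v = val g' v by apply: gg'; rewrite inE eqxx.
  split; first by rewrite /= ev.
  have e1 : val g (neighbor v (inl i0)) = val g' (neighbor v (inl i0)).
    by apply: gg'; rewrite !inE eqxx !orbT.
  case: l tl gg' => //= c tl gg'.
  have e2 : val g (neighbor v (inr c)) = val g' (neighbor v (inr c)).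
    by apply: gg'; rewrite !inE eqxx !orbT.
  by rewrite /turn /angle /loc ev e1 e2.
Qed.

End Subdivision.

Lemma rabbit_embeds_basilica (m : nat) (T : colored_tree m) (U : colored_tree 2) :
  (0 < m)%N -> embeds_as_topological_group (Homeo_plus_rabbit T) (Homeo_plus_rabbit U).
Proof.
move=> m0; have [[r] _ _ _ _] := adj_tree T.
exact: subdivision_embeds r m0 U.
Qed.

(** * The dense tree glued along the colored tree of the basilica *)

Section Glue.
Variables (T : colored_tree 2) (M : planar_tree) (b0 b1 : M).
Hypothesis b01 : b0 <> b1.
Local Notation k := (@tree_color 2 T).
Local Notation E := (@adj 2 T).
Local Notation inA := (@inA 2 T).
Let tT := adj_tree T.
Local Notation step := (step tT).

Definition bvertex : choiceType := {w : T | ~~ inA w}.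
Local Notation edge := (edge T).
Definition region : choiceType := {i : M | inside b0 b1 i}.
Definition glued : choiceType := (bvertex + edge * region)%type.
Implicit Types (x y z : glued) (w : bvertex) (h : edge) (i : region).

(** A point of a glued piece sits on an edge; seen from a vertex off this edge,
    both ends of the edge are in the same direction. *)
Definition vertex_of z : T :=
  match z with inl w => val w | inr (h, _) => (val h).1 end.
Definition bvertex_of z : T :=
  match z with inl w => val w | inr (h, _) => (val h).2 end.

Definition end_towards h (u : T) : M :=
  if step (val h).1 u == (val h).2 then b0 else b1.

(** The retraction onto the piece glued along [h], as a point of the closed region
    between [b0] and [b1]: what lies beyond the kept end of [h] goes to [b0], and
    what lies beyond the other end to [b1]. *)
Definition retract h z : M :=
  match z with
  | inr (h', i) => if h' == h then val i else end_towards h (bvertex_of z)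
  | inl w => end_towards h (val w)
  end.

Definition omega_color (v x : T) : Omega :=
  match k (v, x) with inr c => c | inl _ => qz 0 end.

Definition glued_dir (b z : glued) : Omega :=
  match b with
  | inl w => omega_color (val w) (step (val w) (vertex_of z))
  | inr (h, i) => dir (val i) (retract h z)
  end.

Lemma omega_color_inj (w x y : T) : ~~ inA w -> E w x -> E w y ->
  omega_color w x = omega_color w y -> x = y.
Proof.
move=> Bw wx wy; rewrite /omega_color.
have [c kc] := colorB Bw wx; have [d kd] := colorB Bw wy; rewrite kc kd => e.
by apply: (color_inj wx wy); rewrite kc kd e.
Qed.

Lemma bvertex_ofP z : ~~ inA (bvertex_of z).
Proof. by case: z => [w|[h i]] /=; [exact: (valP w)|have [] := edgeP h]. Qed.

Lemma neq_side (v w : T) : inA v -> ~~ inA w -> v <> w.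
Proof. by move=> Av Bw e; move: Bw; rewrite -e Av. Qed.

Lemma vertex_ofE w z : vertex_of z = val w -> z = inl w.
Proof.
case: z => [w' /val_inj ->//|[h i] /= e].
by have [a _ _] := edgeP h; have := valP w; rewrite /= -e a.
Qed.

Lemma retract_self h i : retract h (inr (h, i)) = val i.
Proof. by rewrite /= eqxx. Qed.

Lemma retract_other h z : ~ (exists i, z = inr (h, i)) ->
  retract h z = end_towards h (bvertex_of z).
Proof.
case: z => [//|[h' i]] n /=; case: eqP => // e.
by case: n; exists i; rewrite e.
Qed.

Lemma retract_region h z : closed_region b0 b1 (retract h z).
Proof.
have [[i ->]|n] := pselect (exists i, z = inr (h, i)).
  by rewrite retract_self; apply: Or33; exact: valP.
by rewrite retract_other// /end_towards; case: ifP => _; [exact: Or31|exact: Or32].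
Qed.

Lemma insideP (p : M) : inside b0 b1 p -> p <> b0 /\ p <> b1.
Proof. by move=> /asboolP[]. Qed.

Lemma retract_inside h z : inside b0 b1 (retract h z) ->
  exists2 i, z = inr (h, i) & val i = retract h z.
Proof.
have [[i ->]|n] := pselect (exists i, z = inr (h, i)).
  by rewrite retract_self => _; exists i.
rewrite retract_other// /end_towards; case: ifP => _ /insideP[]; by [].
Qed.

Lemma retract_eq h i z : retract h z = val i -> z = inr (h, i).
Proof.
move=> e; have [|j zj vj] := @retract_inside h z; first by rewrite e; exact: valP.
by rewrite zj; congr (inr (_, _)); apply: val_inj; rewrite vj.
Qed.

Lemma step_vertex_bvertex (v : T) z : v <> vertex_of z -> inA v ->
  step v (vertex_of z) = step v (bvertex_of z).
Proof.
case: z => [//|[h i]] /= vh Av; have [_ Bh Eh] := edgeP h.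
by apply: step_move => //; exact: neq_side.
Qed.

Lemma end_towards_eq h (u u' : T) : step (val h).1 u = step (val h).1 u' ->
  end_towards h u = end_towards h u'.
Proof. by rewrite /end_towards => ->. Qed.

(** Of a kept vertex and a piece, or of two pieces, at least one sees a given point
    where it sees the other one; this is [glued_across] in a symmetric form. *)
Lemma retract_bvertex h w z : z <> inl w ->
  step (val w) (vertex_of z) = step (val w) (val h).1 \/
  retract h z = retract h (inl w).
Proof.
move=> zw; have [Av Bh Eh] := edgeP h.
have [[i ->]|nz] := pselect (exists i, z = inr (h, i)); first by left.
have [e|n] := pselect (step (val w) (vertex_of z) = step (val w) (val h).1); [by left|right].
rewrite retract_other//= ; apply: end_towards_eq.
have wv : val w <> (val h).1 by move=> e; have := valP w; rewrite /= e Av.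
have zv : vertex_of z <> (val h).1 by move=> e; apply: n; rewrite e.
rewrite -step_vertex_bvertex//; last exact/nesym.
by apply: step_across => // /vertex_ofE.
Qed.

Lemma retract_edge h h' i i' z : h <> h' ->
  retract h z = retract h (inr (h', i')) \/ retract h' z = retract h' (inr (h, i)).
Proof.
move=> hh'; have [Av Bw vw] := edgeP h; have [Av' Bw' vw'] := edgeP h'.
have R : retract h (inr (h', i')) = end_towards h (val h').2.
  by rewrite retract_other// => -[j []] /nesym.
have R' : retract h' (inr (h, i)) = end_towards h' (val h).2.
  by rewrite retract_other// => -[j []].
have [[j ->]|nz] := pselect (exists j, z = inr (h, j)).
  by right; rewrite R' retract_other// => -[l []].
have [[j ->]|nz'] := pselect (exists j, z = inr (h', j)).
  by left; rewrite R retract_other// => -[l []] /nesym.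
rewrite R R' !retract_other//; set u := bvertex_of z.
have Bu : ~~ inA u by exact: bvertex_ofP.
have [e|n] := pselect (step (val h).1 u = step (val h).1 (val h').2).
  by left; exact: end_towards_eq.
have [vv|vv] := pselect ((val h).1 = (val h').1).
  have ww : (val h').2 <> (val h).2.
    by move=> ww; apply: hh'; exact: edge_eq.
  have [h1|h1] := pselect (step (val h).1 u = (val h).2).
    by right; apply: end_towards_eq; rewrite -vv h1 step_edge.
  left; rewrite /end_towards (introF eqP h1) vv step_edge//.
  by rewrite (introF eqP ww).
right; apply: end_towards_eq.
have s1 : step (val h).1 (val h').2 = step (val h).1 (val h').1.
  by apply/esym/step_move => //; exact: neq_side.
rewrite s1 in n.
rewrite (step_across vv _ n); last exact/nesym/neq_side.
by apply: step_move => //; [exact/nesym|exact: neq_side].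
Qed.

Lemma glued_across b c x : b <> c -> x <> b -> glued_dir b x <> glued_dir b c ->
  glued_dir c x = glued_dir c b.
Proof.
have vn w z : z <> inl w -> vertex_of z <> val w by move=> zw /vertex_ofE.
case: b => [w|[h i]]; case: c => [w'|[h' i']] bc xb /= n.
- have [xw'|xw'] := pselect (x = inl w'); first by rewrite xw' in n.
  suff : step (val w') (vertex_of x) = step (val w') (val w) by move=> ->.
  apply: step_across; first by move=> /val_inj e; apply: bc; rewrite e.
  + exact: vn.
  + by move=> e; apply: n; rewrite e.
- have [e|->//] := retract_bvertex h' xb.
  by rewrite e in n.
- have [xw'|xw'] := pselect (x = inl w'); first by rewrite xw' in n.
  have [->//|e] := retract_bvertex h xw'.
  by rewrite e in n.
- have [hh|hh] := pselect (h = h'); last first.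
    have [e|e] := retract_edge i i' x hh; first by rewrite e in n.
    by rewrite e.
  subst h'; rewrite eqxx in n; rewrite eqxx; apply: dir_across => //.
    by move=> e; apply: bc; congr (inr (_, _)); apply: val_inj.
  by move=> /retract_eq.
Qed.

Lemma bvertex_edge w (v : T) : E (val w) v -> exists h, val h = (v, val w).
Proof.
move=> wv; have H : inA v && E v (val w).
  by rewrite (adj_side wv) (valP w) (edge_sym tT).
by exists (Sub (v, val w) H).
Qed.

Lemma glued_separate x y : x <> y -> exists h, retract h x <> retract h y.
Proof.
move=> xy; case: x xy => [w|[h i]] xy; last first.
  by exists h; rewrite retract_self => /esym/retract_eq e; apply: xy; rewrite e.
case: y xy => [w'|[h i]] xy; last first.
  by exists h; rewrite retract_self => /retract_eq e; apply: xy; rewrite e.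
have ww : val w' <> val w by move=> /val_inj e; apply: xy; rewrite e.
have [wv _] := stepP tT ww; have [h hE] := bvertex_edge wv.
exists h; rewrite /= /end_towards hE /=.
rewrite step_edge ?eqxx; last by rewrite (edge_sym tT).
have Av : inA (step (val w) (val w')) by rewrite (adj_side wv) (valP w).
have n := @step_back _ _ tT _ _ ww; case: eqP => [e _|_]; last by exact/b01.
by apply: (n _ e); exact/nesym/neq_side/(valP w').
Qed.

Lemma glued_dense x y : x <> y ->
  exists b, [/\ b <> x, b <> y & glued_dir b x <> glued_dir b y].
Proof.
move=> /glued_separate[h n]; have [i [ix iy ni]] := dir_dense n.
have ii : inside b0 b1 i.
  exact: (inside_between (retract_region h x) (retract_region h y) ix iy ni).
exists (inr (h, Sub i ii : region)); split=> //= e.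
- by apply: ix; rewrite -e retract_self.
- by apply: iy; rewrite -e retract_self.
Qed.

(** The vertices of class A have degree two, which is what lets the dropped ends
    of the edges be cut points only, with no median among them. *)
Lemma two_neighbors (v : T) : inA v -> exists h1 h2,
  [/\ (val h1).1 = v, (val h2).1 = v, h1 <> h2 &
   forall u, E v u -> u = (val h1).2 \/ u = (val h2).2].
Proof.
move=> Av; have [w1 vw1 k1] := neighborA ord0 Av.
have [w2 vw2 k2] := neighborA ord_max Av.
have H1 : inA v && E v w1 by rewrite Av.
have H2 : inA v && E v w2 by rewrite Av.
exists (Sub (v, w1) H1), (Sub (v, w2) H2); split=> //=.
  by move=> /(congr1 val)/= [] e; move: k1; rewrite e k2.
move=> u vu; have [i ki] := colorA Av vu.
case: i ki => [[|[|i]] hi] // ki; [left|right].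
  by apply: (color_inj vu vw1); rewrite ki k1; congr inl; exact: val_inj.
by apply: (color_inj vu vw2); rewrite ki k2; congr inl; exact: val_inj.
Qed.

Lemma retract_b0 h z : retract h z = b0 ->
  vertex_of z <> (val h).1 /\ step (val h).1 (vertex_of z) = (val h).2.
Proof.
move=> e; have nz : ~ (exists i, z = inr (h, i)).
  by move=> [i ei]; move: e; rewrite ei retract_self => e; have [] := insideP (valP i).
move: e; rewrite retract_other// /end_towards; case: eqP => [e _|_ /esym//].
suff n : vertex_of z <> (val h).1.
  by split=> //; rewrite step_vertex_bvertex//; [exact/nesym|have [] := edgeP h].
case: z nz e => [w _ _ /= e|[h' i] nz /= e e'].
  by have [a _ _] := edgeP h; have := valP w; rewrite /= e a.
apply: nz; exists i; congr (inr (_, _)).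
have [_ _ E'] := edgeP h'.
by move: e; rewrite -e' step_edge// => /(edge_eq e').
Qed.

Lemma retract_b1 h z : retract h z = b1 ->
  bvertex_of z <> (val h).1 /\ step (val h).1 (bvertex_of z) <> (val h).2.
Proof.
move=> e; have nz : ~ (exists i, z = inr (h, i)).
  by move=> [i ei]; move: e; rewrite ei retract_self => e; have [] := insideP (valP i).
move: e; rewrite retract_other// /end_towards; case: eqP => [_ //|n _].
by split=> //; have [a _ _] := edgeP h; exact/nesym/neq_side/bvertex_ofP.
Qed.

(** Take the median [v] in [T].  If [v] is kept, it is the median.  Otherwise one of
    the two pieces at [v] contains the median of the retracted points: the median
    [b0] would contradict the choice of [v], and the median [b1] in both pieces
    would put one of the three points on both sides of [v]. *)
Lemma glued_median x y z : exists m,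
  [/\ btw glued_dir m x y, btw glued_dir m y z & btw glued_dir m x z].
Proof.
have [v [vxy vyz vxz]] := step_median tT (vertex_of x) (vertex_of y) (vertex_of z).
have [Av|Bv] := boolP (inA v); last first.
  pose w : bvertex := Sub v Bv.
  have H x' y' : btw step v (vertex_of x') (vertex_of y') -> btw glued_dir (inl w) x' y'.
    have [e _|nx] := pselect (v = vertex_of x').
      by apply: Or31; apply/esym/vertex_ofE.
    have [e _|ny] := pselect (v = vertex_of y').
      by apply: Or32; apply/esym/vertex_ofE.
    case=> // n; apply: Or33 => /= e; apply: n; apply: (omega_color_inj Bv) e.
      by have [] := stepP tT (nesym nx).
    by have [] := stepP tT (nesym ny).
  by exists (inl w); split; exact: H.
have [h1 [h2 [hv1 hv2 h12 two]]] := two_neighbors Av.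
have cell h : (val h).1 = v -> (exists m,
    [/\ btw glued_dir m x y, btw glued_dir m y z & btw glued_dir m x z]) \/
    [/\ retract h x = b1 \/ retract h y = b1, retract h y = b1 \/ retract h z = b1 &
        retract h x = b1 \/ retract h z = b1].
  move=> hv; have [m [m1 m2 m3]] := dir_median (retract h x) (retract h y) (retract h z).
  have cm : closed_region b0 b1 m.
    have [->|mx] := pselect (m = retract h x); first exact: retract_region.
    have [->|my] := pselect (m = retract h y); first exact: retract_region.
    case: m1 => // m1; apply: Or33.
    exact: (inside_between (retract_region h x) (retract_region h y) mx my m1).
  have ext b p q : (b = b0 \/ b = b1) -> closed_region b0 b1 p -> closed_region b0 b1 q ->
      btw (@dir M) b p q -> p = b \/ q = b.
    move=> hb cp cq; have [->|np] := pselect (p = b); first by left.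
    have [->|nq] := pselect (q = b); first by right.
    case=> [/esym//|/esym//|n]; case: n.
    case: hb => hb; subst b.
      have F u : closed_region b0 b1 u -> u <> b0 -> dir b0 u = dir b0 b1.
        by case=> [//|->//|/asboolP[]].
      by rewrite !F.
    have F u : closed_region b0 b1 u -> u <> b1 -> dir b1 u = dir b1 b0.
      by case=> [->//|//|/asboolP[]].
    by rewrite !F.
  case: cm => [m0|m0|im].
  - rewrite m0 in m1 m2 m3.
    have x1 := ext _ _ _ (or_introl erefl) (retract_region h x) (retract_region h y) m1.
    have x2 := ext _ _ _ (or_introl erefl) (retract_region h y) (retract_region h z) m2.
    have x3 := ext _ _ _ (or_introl erefl) (retract_region h x) (retract_region h z) m3.
    have C x' y' : retract h x' = b0 -> retract h y' = b0 ->
        btw step v (vertex_of x') (vertex_of y') -> False.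
      move=> /retract_b0; rewrite hv => -[n1 s1] /retract_b0; rewrite hv => -[n2 s2].
      by case=> [/esym//|/esym//|]; rewrite s1 s2.
    exfalso; case: x1 x2 x3 => e1 [] e2 [] e3;
      first [exact: (C _ _ e1 e2 vxy)|exact: (C _ _ e1 e3 vxz)|exact: (C _ _ e1 e2 vyz)|
             exact: (C _ _ e1 e3 vyz)|exact: (C _ _ e1 e2 vxz)|exact: (C _ _ e2 e3 vyz)|
             exact: (C _ _ e3 e1 vxy)|exact: (C _ _ e3 e2 vxz)|exact: (C _ _ e2 e1 vyz)].
  - rewrite m0 in m1 m2 m3; right; split.
    + exact: ext _ _ _ (or_intror erefl) (retract_region h x) (retract_region h y) m1.
    + exact: ext _ _ _ (or_intror erefl) (retract_region h y) (retract_region h z) m2.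
    + exact: ext _ _ _ (or_intror erefl) (retract_region h x) (retract_region h z) m3.
  - left; exists (inr (h, Sub m im : region)).
    have H x' y' : btw (@dir M) m (retract h x') (retract h y') ->
        btw glued_dir (inr (h, Sub m im : region)) x' y'.
      case=> [e|e|n]; [apply: Or31|apply: Or32|by apply: Or33].
        by apply/esym/retract_eq.
      by apply/esym/retract_eq.
    by split; exact: H.
have [//|[p1 p2 p3]] := cell h1 hv1.
have [//|[q1 q2 q3]] := cell h2 hv2.
have C x' : retract h1 x' = b1 -> retract h2 x' = b1 -> False.
  move=> /retract_b1; rewrite hv1 => -[n1 s1] /retract_b1; rewrite hv2 => -[n2 s2].
  by have [vu _] := stepP tT n1; case: (two _ vu).
exfalso; case: p1 p2 p3 q1 q2 q3 => e1 [] e2 [] e3 [] f1 [] f2 [] f3;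
  first [exact: (C _ e1 f1)|exact: (C _ e1 f2)|exact: (C _ e1 f3)|
         exact: (C _ e2 f1)|exact: (C _ e2 f2)|exact: (C _ e2 f3)|
         exact: (C _ e3 f1)|exact: (C _ e3 f2)|exact: (C _ e3 f3)].
Qed.

Lemma glued_surj b j : exists2 x, x <> b & glued_dir b x = j.
Proof.
case: b => [w|[h i]].
  have [v wv kv] := neighborB j (valP w); have [h hE] := bvertex_edge wv.
  have [i0 ii] := inside_exists b01.
  exists (inr (h, Sub i0 ii : region)) => //=.
  by rewrite hE /= step_edge// /omega_color kv.
have [Av Bw vw] := edgeP h; have [x xi dx] := dir_surj (val i) j.
pose w : glued := inl (Sub (val h).2 Bw).
have rw : retract h w = b0 by rewrite /= /end_towards step_edge// eqxx.
have [h1 [h2 [hv1 hv2 h12 two]]] := two_neighbors Av.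
have [h' [hv' hw']] : exists h' : edge, (val h').1 = (val h).1 /\ (val h').2 <> (val h).2.
  have [e|n] := pselect ((val h1).2 = (val h).2); last by exists h1.
  by exists h2; split=> // e2; apply: h12; apply: edge_eq; rewrite ?e ?e2// hv1 hv2.
have [Av' Bw' vw'] := edgeP h'.
pose w' : glued := inl (Sub (val h').2 Bw').
have rw' : retract h w' = b1.
  by rewrite /= /end_towards -hv' step_edge// (introF eqP hw').
have /asboolP[i0 i1 di0 di1] := valP i.
have [ii|ni] := boolP (inside b0 b1 x).
  exists (inr (h, Sub x ii : region)); last by rewrite /= eqxx.
  by move=> [] e; apply: xi; rewrite -e.
have [x0|x0] := pselect (dir (val i) x = dir (val i) b0).
  by exists w => //; rewrite -[LHS]/(dir (val i) (retract h w)) rw -x0.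
have [x1|x1] := pselect (dir (val i) x = dir (val i) b1).
  by exists w' => //; rewrite -[LHS]/(dir (val i) (retract h w')) rw' -x1.
exfalso; apply/negP: ni; apply/negPn/asboolP.
have n0 : x <> b0 by move=> e; apply: x0; rewrite e.
have n1 : x <> b1 by move=> e; apply: x1; rewrite e.
split=> //.
- rewrite -di0; apply: dir_across => //.
- rewrite -di1; apply: dir_across => //.
Qed.

Lemma glued_countable : exists f : glued -> nat, injective f.
Proof.
have [fT fTI] := colored_tree_countable T.
have [fM fMI] := planar_tree_countable M.
pose code z : option nat * (nat * nat) := match z with
  | inl w => (None, (fT (val w), 0%N))
  | inr (h, i) => (Some (fM (val i)), (fT (val h).1, fT (val h).2)) end.
have codeI : injective code.
  move=> [w|[h i]] [w'|[h' i']] // e; first by case: e => /fTI e; congr inl; exact: val_inj.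
  case: e => /fMI ei /fTI e1 /fTI e2.
  by congr (inr (_, _)); [exact: edge_eq|exact: val_inj].
by exists (fun z => pickle (code z)) => z z' /(pcan_inj pickleK)/codeI.
Qed.

Lemma glued_inhabited : inhabited glued.
Proof.
have [[v] _ _ _ _] := tT.
have [Av|Bv] := boolP (inA v); last by constructor; exact: inl (Sub v Bv).
have [h _] := two_neighbors Av.
have [i ii] := inside_exists b01.
by constructor; exact: inr (h, Sub i ii : region).
Qed.

Definition glued_tree : planar_tree :=
  PlanarTree glued_across glued_dense glued_median glued_surj
    glued_countable glued_inhabited.

End Glue.

(** * Components of the complement of a point *)

Section ComponentTheory.
Variable T : topologicalType.
Hypotheses (Thaus : hausdorff_space T) (Tconn : connected [set: T])
  (Tloc : is_locally_connected T).

Lemma component_out (b : T) : component b b = set0.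
Proof. by apply: connected_component_out => /=; apply. Qed.

Lemma component_neq (b x y : T) : component b x y -> x <> b /\ y <> b.
Proof.
move=> h; split=> e; first by move: h; rewrite e component_out.
by have /= := connected_component_sub h; rewrite e.
Qed.

Lemma component_refl (b x : T) : x <> b -> component b x x.
Proof. exact: connected_component_refl. Qed.

Lemma component_same (b x y : T) : component b x y -> component b x = component b y.
Proof. exact: same_connected_component. Qed.

Lemma component_eqP (b x y : T) : y <> b ->
  component b x = component b y <-> component b x y.
Proof.
by move=> yb; split=> [->|]; [exact: component_refl|exact: component_same].
Qed.

Lemma open_setC1 (b : T) : open (~` [set b]).
Proof.
exact/closed_openC/accessible_closed_set1/hausdorff_accessible.
Qed.

Lemma component_open (b x : T) : open (component b x).
Proof.
rewrite openE => y h; have [_ yb] := component_neq h.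
have N : nbhs y (~` [set b]) by apply: open_nbhs_nbhs; split=> //; exact: open_setC1.
have [V [oV cV Vy Vb]] := Tloc N.
apply: (filterS _ (open_nbhs_nbhs (conj oV Vy))).
by rewrite (component_same h); exact: connected_component_max.
Qed.

Lemma component_nbhs (b x y : T) : component b x y -> nbhs y (component b x).
Proof. by move=> h; apply: open_nbhs_nbhs; split=> //; exact: component_open. Qed.

Lemma component_closedU1 (b x : T) : closed (component b x `|` [set b]).
Proof.
rewrite -[X in closed X]setCK; apply: open_closedC.
rewrite openE => y /= /not_orP[h yb].
apply: filterS (component_nbhs (component_refl yb)) => z hz /= [h'|e].
  by apply: h; rewrite (component_same h') -(component_same hz); exact: component_refl.
by have [] := component_neq hz.
Qed.

Lemma closure_component (b x : T) : closure (component b x) `<=` component b x `|` [set b].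
Proof.
rewrite [X in _ `<=` X](closure_id _).1; last exact: component_closedU1.
by apply: closureS => z; left.
Qed.

(** Otherwise the component would be open and closed. *)
Lemma closure_component_vertex (b x : T) : x <> b -> closure (component b x) b.
Proof.
move=> xb; apply: contrapT => nb.
have cl : closed (component b x).
  rewrite closure_id; apply/seteqP; split; first exact: subset_closure.
  by move=> z hz; have [//|/= e] := closure_component hz; case: nb; rewrite -[X in closure _ X]e.
have e : component b x = setT.
  apply: Tconn; first by exists x; exact: component_refl.
  - by exists (component b x); [exact: component_open|rewrite setTI].
  - by exists (component b x); rewrite ?setTI.
have : component b x b by rewrite e.
by case/component_neq.
Qed.

(** The closure of the component of [x] is connected, contains [b] and avoids
    [c]. *)
Lemma component_across (b c x : T) : b <> c -> x <> b ->
  component b x <> component b c -> component c x = component c b.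
Proof.
move=> bc xb n; apply: component_same.
apply: (@connected_component_max _ _ (closure (component b x))).
- by apply: subset_closure; exact: component_refl.
- move=> z /closure_component[h /= e|/= -> //].
  by apply: n; apply: component_same; rewrite -e.
- exact/connected_closure/component_connected.
- exact: closure_component_vertex.
Qed.

Lemma component_sub (b c x y w : T) : ~ component b x c ->
  component b x w -> component c y w -> component b x `<=` component c y.
Proof.
move=> nc bw cw; rewrite (component_same cw).
apply: connected_component_max => //; last exact: component_connected.
by move=> z hz /= e; rewrite e in hz.
Qed.

End ComponentTheory.

(** * Compactness and the unit interval *)

(** A continuous map from a compact space to a Hausdorff space is closed. *)
Lemma compact_embedding (X Y : topologicalType) (f : X -> Y) :
  compact [set: X] -> hausdorff_space Y -> injective f -> continuous f ->
  topological_embedding f.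
Proof.
move=> cX hY fI fc; apply: initial_topological_embedding => // x U.
rewrite nbhsE => -[V [oV Vx] VU].
have cK : compact (~` V).
  by apply: subclosed_compact cX _ => //; exact: open_closedC.
have clK : closed (f @` (~` V)).
  apply: compact_closed => //; apply: continuous_compact => //.
  exact: continuous_subspaceT.
have N : nbhs (f x) (~` (f @` (~` V))).
  apply: open_nbhs_nbhs; split; first exact: closed_openC.
  by move=> [y nVy /fI e]; apply: nVy; rewrite e.
have N' := @initial_continuous _ _ f x _ N.
apply: (@filterS _ (nbhs (x : initial_topology f)) _ _ _ _ N') => y /= h.
by apply: VU; apply: contrapT => nVy; apply: h; exists y.
Qed.

Lemma topological_embedding_inj (X Y : topologicalType) (f : X -> Y) :
  topological_embedding f -> injective f.
Proof.
move=> [_ [g [gK _ _]]] x y e; rewrite -[x]gK -[y]gK.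
by congr (g _); apply: val_inj.
Qed.

Lemma topological_embedding_continuous (X Y : topologicalType) (f : X -> Y) :
  topological_embedding f -> continuous f.
Proof.
move=> [fc _] x; exact: (continuous_comp (fc x) (@set_val_continuous _ _ _)).
Qed.

Section UnitInterval.
Local Open Scope ring_scope.
Variable R : realType.

Definition clamp (t : R) : R := Num.min (Num.max t 0) 1.

Lemma clamp_in t : clamp t \in (`[0, 1]%classic : set R).
Proof.
apply/mem_set => /=; rewrite in_itv/= /clamp.
by rewrite ge_min lexx orbT andbT le_min le_max lexx orbT ler01.
Qed.

Lemma clampE t : 0 <= t <= 1 -> clamp t = t.
Proof. by move=> /andP[h0 h1]; rewrite /clamp max_l// min_l. Qed.

Lemma clamp_continuous : continuous clamp.
Proof.
move=> t; rewrite (_ : clamp = (id \max (fun=> 0 : R)) \min (fun=> 1 : R)); last first.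
  by apply/funext.
apply: (@continuous_min R R); last exact: cst_continuous.
by apply: (@continuous_max R R); [exact: cvg_id|exact: cst_continuous].
Qed.

Definition to_unit (t : R) : unit_interval R := SigSub (clamp_in t).

Lemma to_unit_continuous : continuous to_unit.
Proof. by apply: continuous_comp_initial; exact: clamp_continuous. Qed.

Lemma unit_itv (t : unit_interval R) : 0 <= val t <= 1.
Proof. by have /set_mem := valP t; rewrite /= in_itv. Qed.

Lemma to_unitK (t : unit_interval R) : to_unit (val t) = t.
Proof. by apply: val_inj; rewrite /= clampE// unit_itv. Qed.

Lemma unit_interval_compact : compact [set: unit_interval R].
Proof.
have -> : [set: unit_interval R] = to_unit @` `[0, 1]%classic.
  apply/seteqP; split=> // t _; exists (val t); last exact: to_unitK.
  by rewrite /= in_itv/= unit_itv.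
apply: continuous_compact; last exact: segment_compact.
exact/continuous_subspaceT/to_unit_continuous.
Qed.

End UnitInterval.

(** * Separation by branch points *)

Section Separation.
Variables (R : realType) (D : kaleidoscope R).
Local Notation T := (kspace D).

Lemma kspace_metrizable : is_metrizable R T.
Proof. by have [[]] := kspace_D_infty D. Qed.

Lemma kspace_compact : compact [set: T].
Proof. by have [[]] := kspace_D_infty D. Qed.

Lemma kspace_connected : connected [set: T].
Proof. by have [[]] := kspace_D_infty D. Qed.

Lemma kspace_locally_connected : is_locally_connected T.
Proof. by have [[]] := kspace_D_infty D. Qed.

Lemma kspace_hausdorff : hausdorff_space T.
Proof.
have [M [f [fc [g [fK gK gc]]]]] := kspace_metrizable.
move=> x y xy; apply: (can_inj fK); apply: (@metric_hausdorff R M) => A B fA fB.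
by have [z [Az Bz]] := xy _ _ (fc x _ fA) (fc y _ fB); exists (f z).
Qed.

Section Arcs.
Local Open Scope ring_scope.
Variable f : unit_interval R -> T.
Hypothesis fE : topological_embedding f.

Let F (t : R) : T := f (to_unit t).

Lemma arc_continuous : continuous F.
Proof.
move=> t; apply: continuous_comp; first exact: to_unit_continuous.
exact: (topological_embedding_continuous fE).
Qed.

Lemma arc_inj s t : 0 <= s <= 1 -> 0 <= t <= 1 -> F s = F t -> s = t.
Proof.
by move=> hs ht /(topological_embedding_inj fE)/(congr1 val)/=; rewrite !clampE.
Qed.

(** Reparametrize the middle third of [s, u], so that the branch point is not an
    end. *)
Lemma arc_branch s u : 0 <= s -> s < u -> u <= 1 ->
  exists2 t, s < t < u & branch_point (F t).
Proof.
move=> s0 su u1.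
pose s' := s + (u - s) / 3%:R; pose w := (u - s) / 3%:R.
have w0 : 0 < w by rewrite /w; lra.
pose f' (t : unit_interval R) := F (s' + w * val t).
have in01 (t : unit_interval R) : 0 <= s' + w * val t <= 1.
  have /andP[t0 t1] := unit_itv t; have h : w * val t <= w by rewrite ler_piMr// ltW.
  have h' : 0 <= w * val t by rewrite mulr_ge0// ltW.
  by move: h h'; rewrite /s' /w; lra.
have f'E : topological_embedding f'.
  apply: compact_embedding.
  - exact: unit_interval_compact.
  - exact: kspace_hausdorff.
  - move=> t t' /(arc_inj (in01 t) (in01 t')) /addrI /mulfI e.
    by apply: val_inj; apply: e; rewrite gt_eqF.
  - move=> t; apply: continuous_comp; last exact: arc_continuous.
    apply: continuousD; first exact: cst_continuous.
    by apply: continuousM; [exact: cst_continuous|exact: set_val_continuous].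
have [_ _ _ H] := kspace_D_infty D.
have [_ [[t _ <-] bt]] := H (F (s' + w * 0)) (F (s' + w * 1)) (range f')
  (ex_intro _ f' (And4 f'E erefl (fun t e => congr1 (fun v => F (s' + w * v)) e)
    (fun t e => congr1 (fun v => F (s' + w * v)) e))).
exists (s' + w * val t) => //.
have /andP[t0 t1] := unit_itv t; have h : w * val t <= w by rewrite ler_piMr// ltW.
have h' : 0 <= w * val t by rewrite mulr_ge0// ltW.
by move: w0 h h'; rewrite /s' /w; lra.
Qed.

Lemma arc_connected s u : connected (F @` `[s, u]).
Proof.
apply: connected_continuous_connected; last exact/continuous_subspaceT/arc_continuous.
exact: segment_connected.
Qed.

(** Between two interior branch points on the arc, the coloring provides a branch
    point that separates them.  It lies on the arc, because an arc is connected,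
    and then the two ends of the arc lie on different sides of it. *)
Lemma arc_separation : exists2 b, branch_point b &
  separates b (F 0) (F 1).
Proof.
have [t1 /andP[t1a t1b] B1] := @arc_branch 0 (1 / 2%:R) ltac:(lra) ltac:(lra) ltac:(lra).
have [t2 /andP[t2a t2b] B2] := @arc_branch (1 / 2%:R) 1 ltac:(lra) ltac:(lra) ltac:(lra).
have b12 : F t1 != F t2.
  apply/eqP => /arc_inj e; suff : t1 = t2 by move=> h; move: t1b t2a; rewrite h; lra.
  by apply: e; lra.
have [_ K] := kcolor_kaleidoscopic D.
have [j ji] := neq_Omega (qz 0).
have ij : qz 0 != j by apply/eqP => e; apply: ji.
have [b [Bb [b1 b2 sb] _ _]] := K _ _ (qz 0) j B1 B2 b12 ij.
have [t /= tb e] : (F @` `[t1, t2]) b.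
  apply: contrapT => nb; move/eqP: sb; apply.
  apply: component_same; suff : F @` `[t1, t2] `<=` component b (F t1).
    by apply; exists t2 => //=; rewrite in_itv/= lexx andbT; lra.
  apply: connected_component_max; last exact: arc_connected.
    by exists t1 => //=; rewrite in_itv/= lexx/=; lra.
  by move=> z h /= e; apply: nb; rewrite -e.
move: tb; rewrite in_itv/= => /andP[tb1 tb2].
have tn1 : t != t1 by apply: contra b1 => /eqP <-; apply/eqP.
have tn2 : t != t2 by apply: contra b2 => /eqP <-; apply/eqP.
have side u v : 0 <= u -> u <= v -> v <= 1 -> t < u \/ v < t ->
    forall r, u <= r <= v -> component b (F u) (F r).
  move=> u0 uv v1 h r hr.
  have H : F @` `[u, v] `<=` component b (F u).
    apply: connected_component_max; last exact: arc_connected.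
      by exists u => //=; rewrite in_itv/= lexx/=; lra.
    move=> _ [q /= hq <-] /= e'; move: hq; rewrite in_itv/= => /andP[q1 q2].
    suff : q = t by move=> eq; move: h q1 q2; rewrite eq; lra.
    by apply: arc_inj; rewrite ?e//; lra.
  by apply: H; exists r => //=; rewrite in_itv.
have t1t : t1 < t by rewrite lt_neqAle eq_sym tn1.
have tt2 : t < t2 by rewrite lt_neqAle tn2.
have S1 := @side 0 t1 (lexx _) (ltW t1a) ltac:(lra) (or_intror t1t).
have S2 := @side t2 1 ltac:(lra) (ltW t2b) (lexx _) (or_introl tt2).
have {}S1 : component b (F 0) (F t1) by apply: S1; lra.
have {}S2 : component b (F t2) (F 1) by apply: S2; lra.
exists b => //; split.
- by have [/eqP] := component_neq S1.
- by have [_ /eqP] := component_neq S2.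
- by rewrite (component_same S1) -(component_same S2).
Qed.

End Arcs.

Lemma separation (x y : T) : x != y -> exists2 b, branch_point b & separates b x y.
Proof.
move=> xy; have [[_ _ _ _ U] _ _ _] := kspace_D_infty D.
have [A [[f [fE _ f0 f1]] _]] := U _ _ xy.
have := arc_separation fE; rewrite f0 ?f1//=.
- by rewrite clampE// ler01 lexx.
- by rewrite clampE// ler01 lexx.
Qed.

End Separation.

(** * Density and medians of branch points *)

Lemma compact_finI (X : topologicalType) (I : choiceType) (A : set I)
    (f : I -> set X) : compact [set: X] -> (exists i, A i) ->
  (forall i, A i -> closed (f i)) -> finI A f -> exists p, forall i, A i -> f i p.
Proof.
move=> cX [i0 Ai0] fcl /finI_filter FF.
have [|p [_ clp]] := cX _ FF; first exact: filterT.
exists p => i Ai; apply: fcl => // B; apply: clp.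
by exists (f i); [exact: finI_from1|].
Qed.

Section BranchPoints.
Variables (R : realType) (D : kaleidoscope R).
Local Notation T := (kspace D).
Local Notation Br := (@branch_point T).
Let Th := @kspace_hausdorff R D.
Let Tc := @kspace_connected R D.
Let Tl := @kspace_locally_connected R D.

(** No point is isolated; a point [y] close to [x] and a branch point that separates
    them leave no room for the branch point outside a connected neighborhood. *)
Lemma branch_dense (x : T) (U : set T) : nbhs x U -> exists2 b, Br b & U b.
Proof.
move=> /Tl [V [oV cV Vx VU]].
have [y Vy yx] : exists2 y, V y & y != x.
  apply: contrapT => h.
  have Vx1 : V = [set x].
    apply/seteqP; split=> [y Vy|_ -> //]; apply: contrapT => /= n.
    by apply: h; exists y => //; exact/eqP.
  have [_ [a [b ab]] _ _] := kspace_D_infty D.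
  have e : V = setT.
    apply: Tc; first by exists x.
      by exists V => //; rewrite setTI.
    exists V; rewrite ?setTI // Vx1.
    exact/accessible_closed_set1/hausdorff_accessible.
  have : V a /\ V b by rewrite e.
  by rewrite Vx1 => -[/= ea eb]; move: ab; rewrite ea eb eqxx.
have [b Bb [yb xb /eqP sb]] := separation yx.
exists b => //; apply: VU; apply: contrapT => nb; apply: sb.
apply: component_same; apply: (@connected_component_max _ _ V) => // z Vz /= e.
by apply: nb; rewrite -e.
Qed.

Lemma component_branch (b x : T) : x <> b -> exists2 c, Br c & component b x c.
Proof.
by move=> xb; apply: (@branch_dense x); apply: component_nbhs => //; exact: component_refl.
Qed.

(** The points that are cut off from [p] together with [u] form an open and closed
    part of the component of [u]. *)
Lemma common_separation (p u v : T) : u <> p -> component p u v ->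
  exists2 b, Br b & [/\ b <> p, component b u v & ~ component b u p].
Proof.
move=> up; pose S := [set w | exists2 b, Br b & [/\ b <> p, component b u w & ~ component b u p]].
suff <- : S = component p u by [].
have sepp w : w <> p -> exists2 b, Br b & [/\ b <> p, component b w w & ~ component b w p].
  move=> /eqP wp; have [b Bb [/eqP wb /eqP pb /eqP sb]] := separation wp.
  exists b => //; split; [exact/nesym|exact: component_refl|].
  by move=> h; apply: sb; exact: component_same.
have SC : S `<=` component p u.
  move=> w [b Bb [bp h nb]]; apply: (component_sub nb _ (component_refl up) h).
  by have [ub _] := component_neq h; exact: component_refl.
have oS : open S.
  rewrite openE => w [b Bb [bp h nb]].
  by apply: filterS (component_nbhs Th Tl h) => z hz; exists b.
apply: (@component_connected T (~` [set p]) u).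
- by exists u; have [b Bb [? ? ?]] := sepp u up; exists b.
- by exists S => //; apply/seteqP; split=> [w Sw|w []//]; split=> //; exact: SC.
- exists (closure S); first exact: closed_closure.
  apply/seteqP; split=> [w Sw|w [Cw clw]].
    by split; [exact: SC|exact: subset_closure].
  have [_ wp] := component_neq Cw.
  have [b' Bb' [b'p ww nwp]] := sepp _ wp.
  have [w' [[b Bb [bp uw nup]] w'w]] := clw _ (component_nbhs Th Tl ww).
  (* the side of [u] at [b] and the side of [w] at [b'] meet and avoid [p] *)
  have [hb|hb] := pselect (component b' w b); last first.
    exists b => //; split=> //.
    exact: (component_sub hb w'w uw).
  have [hb'|hb'] := pselect (component b u b'); last first.
    exists b' => //; split => //.
    - suff h : component b' w u by rewrite -(component_same h).
      apply: (component_sub hb' uw w'w).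
      by have [n _] := component_neq uw; exact: component_refl.
    - suff h : component b' w u by rewrite -(component_same h).
      apply: (component_sub hb' uw w'w).
      by have [n _] := component_neq uw; exact: component_refl.
  exfalso; apply: nwp; have [_ n] := component_neq hb'.
  rewrite (component_same hb) -(component_across Th Tc Tl (nesym n) (nesym bp)).
    by apply: component_refl; exact/nesym.
  move=> e; apply: nup; rewrite (component_same hb') -e.
  by apply: component_refl; exact/nesym.
Qed.

(** [m] lies on the segment from [x] to [y], ends included. *)
Definition between (m x y : T) := [\/ m = x, m = y | component m x <> component m y].

Lemma notbetween (m x y : T) : ~ between m x y ->
  [/\ x <> m, y <> m & component m x y].
Proof.
move=> h; have xm : x <> m by move=> e; apply: h; rewrite e; apply: Or31.
have ym : y <> m by move=> e; apply: h; rewrite e; apply: Or32.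
split=> //; apply: contrapT => n; apply: h; apply: Or33.
by move=> e; apply: n; rewrite e; exact: component_refl.
Qed.

Lemma branch_point3 (p x y z : T) : x <> p -> y <> p -> z <> p ->
  component p x <> component p y -> component p y <> component p z ->
  component p x <> component p z -> Br p.
Proof.
move=> xp yp zp nxy nyz nxz.
pose f (i : nat) := component p (if i is 0 then x else if i is 1 then y else z).
have fI : {in (`I_3 : set nat) &, injective f}.
  move=> [|[|[|i]]] [|[|[|j]]] /set_mem h1 /set_mem h2 e //; exfalso; move: e;
    rewrite /f; first [exact: nxy|exact: nyz|exact: nxz|by []
      |by move/esym; first [exact: nxy|exact: nyz|exact: nxz]].
have /card_eqPle[_ h] := inj_card_eq fI.
apply: card_le_trans h _; apply: subset_card_le => _ [[|[|i]] _ <-]; rewrite /f.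
- by exists x.
- by exists y.
- by exists z.
Qed.

Section Median.
Import finmap.
Variables x y z : T.
Hypotheses (Bx : Br x) (By : Br y) (Bz : Br z).

Let two (C : set T) := [\/ C x /\ C y, C y /\ C z | C x /\ C z].

Let two_meet C C' : two C -> two C' -> exists w, C w /\ C' w.
Proof. by move=> [] [? ?] [] [? ?]; first [by exists x|by exists y|by exists z]. Qed.

(** Suppose there is no median.  Then at each branch point [b] some component
    [Maj b] contains two of the three points.  Finitely many of the closed sets
    [Maj b] with [b] added have a common point, namely the [b] with a minimal
    [Maj b]; a common point of all of them, which exists by compactness, is a
    median. *)
Lemma median_branch : exists2 m, Br m &
  [/\ between m x y, between m y z & between m x z].
Proof.
apply: contrapT => nom.
have maj b : Br b -> exists2 u, u <> b & two (component b u).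
  move=> Bb; have : ~ [/\ between b x y, between b y z & between b x z].
    by move=> h; apply: nom; exists b.
  move=> h; apply: contrapT => nu; apply: h; split; apply: contrapT => /notbetween[h1 h2 h3];
  apply: nu.
  - by exists x => //; apply: Or31; split=> //; exact: component_refl.
  - by exists y => //; apply: Or32; split=> //; exact: component_refl.
  - by exists x => //; apply: Or33; split=> //; exact: component_refl.
have /cid[mj mjP] : exists mj : T -> T, forall b, Br b -> mj b <> b /\ two (component b (mj b)).
  have H b : exists u, Br b -> u <> b /\ two (component b u).
    have [Bb|nb] := pselect (Br b); last by exists b.
    by have [u ? ?] := maj _ Bb; exists u.
  by exists (fun b => projT1 (cid (H b))) => b; exact: (projT2 (cid (H b))).
pose Maj b := component b (mj b).
have minimal (s : seq T) : s != [::] -> (forall b, b \in s -> Br b) ->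
    exists2 b1, b1 \in s & forall b, b \in s -> Maj b `<=` Maj b1 -> Maj b1 `<=` Maj b.
  elim: s => // b s IH _ sB; have [->|s0] := eqVneq s [::].
    by exists b; rewrite ?inE// => c; rewrite inE => /eqP ->.
  have [b1 b1s b1P] := IH s0 (fun c cs => sB c (mem_behead (s := _ :: _) cs)).
  have [h|h] := pselect (Maj b `<=` Maj b1).
    exists b; first by rewrite inE eqxx.
    move=> c; rewrite inE => /orP[/eqP->//|cs] cb.
    exact: subset_trans h (b1P _ cs (subset_trans cb h)).
  exists b1; first by rewrite inE b1s orbT.
  by move=> c; rewrite inE => /orP[/eqP->//|/b1P].
have [p pP] : exists p, forall b, Br b -> (Maj b `|` [set b]) p.
  apply: (@compact_finI _ _ Br (fun b => Maj b `|` [set b])) => //.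
  - exact: kspace_compact.
  - by exists x.
  - by move=> b Bb; exact: component_closedU1.
  move=> E EB; have [E0|E0] := eqVneq (finmap.enum_fset E) [::].
    by exists x => b /=; rewrite -[b \in E]/(b \in finmap.enum_fset E) E0.
  have [b bE|b1 b1E b1P] := minimal (finmap.enum_fset E) E0.
    exact/set_mem/EB.
  have Bb1 : Br b1 by apply/set_mem/EB.
  have [n1 t1] := mjP _ Bb1.
  exists b1 => b /= bE; have Bb : Br b by exact/set_mem/EB.
  have [nb tb] := mjP _ Bb.
  have [hb1|hb1] := pselect (Maj b b1); first by left.
  have [w [wb wb1]] := two_meet tb t1.
  have sub : Maj b `<=` Maj b1 by exact: (component_sub hb1 wb wb1).
  apply: (@closure_component _ Th Tl b (mj b)).
  exact: (closureS (b1P _ bE sub)) (closure_component_vertex Th Tc Tl n1).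
have pbtw u v : (forall C, two C -> C u \/ C v) ->
   (forall C : set T, C u -> C v -> two C) -> between p u v.
  move=> tuv tuv'; apply: contrapT => /notbetween[up vp uv].
  have [b Bb [bp buv nbp]] := common_separation up uv.
  have [nb tb] := mjP _ Bb.
  have [hp|/nesym//] := pP _ Bb.
  have buu : component b u u by have [? _] := component_neq buv; exact: component_refl.
  apply: nbp; case: (tuv _ tb) => h.
    by rewrite -(component_same h).
  by rewrite (component_same buv) -(component_same h).
have bxy : between p x y.
  by apply: pbtw => [C [] []|C ? ?]; [left|right|left|apply: Or31].
have byz : between p y z.
  by apply: pbtw => [C [] []|C ? ?]; [left|left|right|apply: Or32].
have bxz : between p x z.
  by apply: pbtw => [C [] []|C ? ?]; [left|right|left|apply: Or33].
apply: nom; exists p => //.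
have [->//|px] := pselect (p = x).
have [->//|py] := pselect (p = y).
have [->//|pz] := pselect (p = z).
apply: (@branch_point3 p x y z); try exact/nesym.
- by case: bxy.
- by case: byz.
- by case: bxz.
Qed.

End Median.

End BranchPoints.

(** * Directions and the extension of automorphisms *)

Section Directions.
Variables (R : realType) (D : kaleidoscope R).
Local Notation T := (kspace D).
Local Notation Br := (@branch_point T).
Let Th := @kspace_hausdorff R D.
Let Tc := @kspace_connected R D.
Let Tl := @kspace_locally_connected R D.

Definition direction (b x : T) : Omega := kcolor b (component b x).

Lemma direction_eq (b x y : T) : Br b -> x <> b -> y <> b ->
  direction b x = direction b y <-> component b x = component b y.
Proof.
move=> Bb xb yb; split=> [e|]; last by rewrite /direction => ->.
have [K _] := kcolor_kaleidoscopic D; have [_ Ki _] := K b Bb.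
by apply: Ki => //; apply/mem_set; [exists x|exists y].
Qed.

Lemma direction_surj (b : T) i : Br b -> exists2 x, Br x /\ x <> b & direction b x = i.
Proof.
move=> Bb; have [K _] := kcolor_kaleidoscopic D; have [_ _ Ks] := K b Bb.
have [C [y /= yb <-] e] := Ks i I.
have [c Bc h] := component_branch yb.
have [_ cb] := component_neq h.
by exists c; rewrite // /direction -(component_same h).
Qed.

(** At most one of three points lies on the side of [b'] at [b], and the other two
    lie in the same direction at [b']. *)
Lemma unique_trivalent (b b' u v w : T) :
  u <> b -> v <> b -> w <> b -> u <> b' -> v <> b' -> w <> b' ->
  component b u <> component b v -> component b v <> component b w ->
  component b u <> component b w ->
  component b' u <> component b' v -> component b' v <> component b' w ->
  component b' u <> component b' w -> b = b'.
Proof.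
move=> ub vb wb ub' vb' wb' uv vw uw uv' vw' uw'; apply: contrapT => bb'.
have A x : x <> b -> component b x <> component b b' -> component b' x = component b' b.
  exact: component_across.
have [eu|/(A u ub) eu] := pselect (component b u = component b b').
  have ev : component b' v = component b' b by apply: A => // e; rewrite e -eu in uv.
  have ew : component b' w = component b' b by apply: A => // e; rewrite e -eu in uw.
  by rewrite ev ew in vw'.
have [ev|/(A v vb) ev] := pselect (component b v = component b b').
  have ew : component b' w = component b' b by apply: A => // e; rewrite e -ev in vw.
  by rewrite eu ew in uw'.
by rewrite eu ev in uv'.
Qed.

Lemma kspace_countable_base : exists e : set T -> nat, exists B : set (set T),
  {in B &, injective e} /\
  forall x A, nbhs x A -> exists U, [/\ B U, U x & U `<=` A].
Proof.
have [M [f [fc [g [fK gK gc]]]]] := kspace_metrizable D.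
have [_ [a _] _ _] := kspace_D_infty D.
pose Mp : pseudoPMetricType R := HB.pack (Metric.sort M) (isPointed.Build (Metric.sort M) (f a)).
have cM : compact [set: Mp].
  have -> : [set: Mp] = f @` [set: T].
    by apply/seteqP; split=> // y _; exists (g y).
  apply: continuous_compact; last exact: kspace_compact.
  exact: (@continuous_subspaceT _ Mp).
have [B /countable_injP[e eI] [_ Bb]] := compact_second_countable cM.
exists (fun U => e (g @^-1` U)), (fun U => B (g @^-1` U)); split.
  move=> U V /set_mem BU /set_mem BV /eI; rewrite !inE => /(_ BU BV) /seteqP[h1 h2].
  by apply/seteqP; split=> x Ux; rewrite -[x]fK; [apply: h1|apply: h2]; rewrite /preimage /= fK.
move=> x A nA.
have /Bb [U [BU Ux] UA] : nbhs (f x) (g @^-1` A).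
  by apply: gc; rewrite fK.
exists (f @^-1` U); split=> //.
  have -> : g @^-1` (f @^-1` U) = U by apply/funext => y; rewrite /preimage /= gK.
  done.
by move=> y /UA; rewrite /preimage/= fK.
Qed.

(** A branch point is coded by three basic open sets that lie in components of three
    fixed colors. *)
Lemma branch_countable : exists h : T -> nat, {in Br &, injective h}.
Proof.
have [e [B [eI Bb]]] := kspace_countable_base.
pose third (i : 'I_3) := qz (i%:R / 3%:R)%R.
have thirdI : injective third.
  move=> i j /(congr1 qrep); have H (k : 'I_3) : qrep (third k) = (k%:R / 3%:R)%R.
    rewrite /third qzK// ?divr_ge0// ltr_pdivrMr// mul1r.
    by rewrite ltr_nat.
  rewrite !H => /mulIf => /(_ isT) /eqP; rewrite eqr_nat => /eqP; exact: val_inj.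
have H b (i : 'I_3) : exists U, Br b -> B U /\
    exists2 x, x <> b & U x /\ (U `<=` component b x /\ direction b x = third i).
  have [Bb'|nb] := pselect (Br b); last by exists setT.
  have [x [_ xb] dx] := direction_surj (third i) Bb'.
  have [U [BU Ux Uc]] := Bb _ _ (component_nbhs Th Tl (component_refl xb)).
  by exists U => _; split => //; exists x.
pose U b i := projT1 (cid (H b i)).
have UP b i : Br b -> B (U b i) /\ exists2 x, x <> b & U b i x /\
    (U b i `<=` component b x /\ direction b x = third i).
  exact: (projT2 (cid (H b i))).
exists (fun b => pickle [:: e (U b (inord 0)); e (U b (inord 1)); e (U b (inord 2))]).
move=> b b' /set_mem Bb1 /set_mem Bb2 /(pcan_inj pickleK) [e0 e1 e2].
have U3 (i : 'I_3) : [\/ i = inord 0, i = inord 1 | i = inord 2].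
  by case: i => [[|[|[|i]]] hi] //; [apply: Or31|apply: Or32|apply: Or33];
    apply: val_inj; rewrite /= inordK.
have eU i : U b i = U b' i.
  have [h1 _] := UP b i Bb1; have [h2 _] := UP b' i Bb2.
  by apply: eI; rewrite ?inE//; case: (U3 i) => ->.
have sP i : exists s, [/\ s <> b, s <> b', direction b s = third i & direction b' s = third i].
  have [_ [x xb [Ux [Uc dx]]]] := UP b i Bb1.
  have [_ [y yb [_ [Vc dy]]]] := UP b' i Bb2.
  have h := Uc _ Ux; rewrite -eU in Vc; have h' := Vc _ Ux.
  exists x; split=> //; first by have [_] := component_neq h'.
  by rewrite /direction -(component_same h').
have [u [ub ub' du du']] := sP (inord 0).
have [v [vb vb' dv dv']] := sP (inord 1).
have [w [wb wb' dw dw']] := sP (inord 2).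
have i01 : third (inord 0) <> third (inord 1).
  by move=> /thirdI/(congr1 val)/=; rewrite !inordK.
have i02 : third (inord 0) <> third (inord 2).
  by move=> /thirdI/(congr1 val)/=; rewrite !inordK.
have i12 : third (inord 1) <> third (inord 2).
  by move=> /thirdI/(congr1 val)/=; rewrite !inordK.
apply: (unique_trivalent ub vb wb ub' vb' wb').
- by move/(direction_eq Bb1 ub vb); rewrite du dv.
- by move/(direction_eq Bb1 vb wb); rewrite dw dv.
- by move/(direction_eq Bb1 ub wb); rewrite du dw.
- by move/(direction_eq Bb2 ub' vb'); rewrite du' dv'.
- by move/(direction_eq Bb2 vb' wb'); rewrite dw' dv'.
- by move/(direction_eq Bb2 ub' wb'); rewrite du' dw'.
Qed.

Section Extension.

Definition branch_morphism (a : T -> T) := 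
  (forall b, Br b -> Br (a b)) /\
  forall b c d, Br b -> Br c -> Br d -> component b c d -> component (a b) (a c) (a d).

(** [y] has the directions that the image of [x] under an extension of [a] has to
    have. *)
Definition extends (a : T -> T) (x y : T) :=
  forall b c, Br b -> Br c -> component b c x -> component (a b) (a c) y.

Section OneSide.
Variables a a' : T -> T.
Hypotheses (aM : branch_morphism a) (a'M : branch_morphism a').
Hypotheses (aK : forall b, Br b -> a' (a b) = b) (a'K : forall b, Br b -> a (a' b) = b).

Lemma extends_branchE b y : Br b -> extends a b y -> y = a b.
Proof.
move=> Bb P; apply: contrapT => /eqP /separation[d Bd [/eqP yd /eqP abd /eqP sd]].
have n : b <> a' d by move=> e; apply: abd; rewrite e a'K.
have := P (a' d) b (a'M.1 _ Bd) Bb (component_refl n).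
by rewrite a'K// => h; apply: sd; rewrite (component_same h).
Qed.

Lemma extends_direction x y d : Br d -> extends a x y -> x <> a' d ->
  exists2 c, Br c & [/\ component (a' d) c x & component d (a c) y].
Proof.
move=> Bd P xb; have [c Bc h] := component_branch xb.
have [_ cb] := component_neq h.
have h' : component (a' d) c x.
  by rewrite -(component_same h); exact: component_refl.
by exists c => //; split => //; rewrite -{1}(a'K Bd); apply: P => //; exact: a'M.1.
Qed.

Lemma extends_uniq x y y' : extends a x y -> extends a x y' -> y = y'.
Proof.
move=> P P'; apply: contrapT => /eqP /separation[d Bd [/eqP yd /eqP y'd /eqP sd]].
have [e|xb] := pselect (x = a' d).
  by move: P; rewrite e => /(extends_branchE (a'M.1 _ Bd)); rewrite a'K.
have [c Bc [h1 h2]] := extends_direction Bd P xb.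
have [_ cb] := component_neq h1.
have h3 : component d (a c) y'.
  by rewrite -{1}(a'K Bd); apply: P' => //; exact: a'M.1.
by apply: sd; rewrite -(component_same h2) (component_same h3).
Qed.

(** The images of the branch points near [x] accumulate somewhere by compactness.
    The accumulation point has the required directions; it is not the image of a
    branch point [b], as [b] and [x] are separated. *)
Lemma extends_exists x : exists y, extends a x y.
Proof.
pose F := [set S : set T | exists2 U, nbhs x U & forall b, Br b -> U b -> S (a b)].
have FF : ProperFilter F.
  split.
    by move=> [U nU H]; have [b Bb Ub] := branch_dense nU; exact: (H b).
  split.
  - by exists setT => //; exact: filterT.
  - move=> P Q [U nU HU] [V nV HV]; exists (U `&` V); first exact: filterI.
    by move=> b Bb [Ub Vb]; split; [exact: HU|exact: HV].
  - by move=> P Q PQ [U nU HU]; exists U => // b Bb Ub; apply: PQ; exact: HU.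
have [|y [_ cy]] := @kspace_compact R D F FF; first exact: filterT.
have H b c : Br b -> Br c -> component b c x -> (component (a b) (a c) `|` [set a b]) y.
  move=> Bb Bc h; apply: (@closure_component _ Th Tl) => B nB.
  apply: cy nB; exists (component b c); first exact: component_nbhs.
  by move=> d Bd hd; apply: aM.2.
exists y => b c Bb Bc h; have [//|/= e] := H b c Bb Bc h.
have [cb xb] := component_neq h.
have [d Bd [/eqP bd /eqP xd /eqP sd]] := separation (introN eqP (nesym xb)).
have [f Bf hf] := component_branch xd.
have hf' : component d f x by rewrite -(component_same hf); exact: component_refl.
have adab : a b <> a d by move=> /(congr1 a'); rewrite !aK.
have [hy|/= hy] := H d f Bd Bf hf'; last by case: adab; rewrite -e.
have [fd _] := component_neq hf'.
exfalso; apply: sd; rewrite -(component_same hf').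
rewrite e in hy; apply/esym/component_same.
by have := a'M.2 _ _ _ (aM.1 _ Bd) (aM.1 _ Bf) (aM.1 _ Bb) hy; rewrite !aK.
Qed.

End OneSide.

Lemma extends_inv a a' x y : branch_morphism a -> branch_morphism a' ->
  (forall b, Br b -> a' (a b) = b) -> (forall b, Br b -> a (a' b) = b) ->
  extends a x y -> extends a' y x.
Proof.
move=> aM a'M aK a'K P d f Bd Bf h; have [fd yd] := component_neq h.
have xb : x <> a' d.
  by move=> e; move: P; rewrite e => /(extends_branchE a'M a'K (a'M.1 _ Bd)); rewrite a'K.
have [c Bc [h1 h2]] := extends_direction a'M a'K Bd P xb.
have h3 : component d (a c) f.
  by rewrite (component_same h2) -(component_same h); exact: component_refl.
have := a'M.2 _ _ _ Bd (aM.1 _ Bc) Bf h3; rewrite aK// => /component_same <-.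
exact: h1.
Qed.

(** Any accumulation point of the images near [x] has the same directions as the
    image of [x]. *)
Lemma extends_continuous a a' (f : T -> T) : branch_morphism a -> branch_morphism a' ->
  (forall b, Br b -> a' (a b) = b) -> (forall b, Br b -> a (a' b) = b) ->
  (forall x, extends a x (f x)) -> continuous f.
Proof.
move=> aM a'M aK a'K fP x.
have sub : cluster (f @ x) `<=` [set f x].
  move=> y' cy; apply: contrapT => /eqP /separation[d Bd [/eqP y'd /eqP yd /eqP sd]].
  have [e|xb] := pselect (x = a' d).
    have := fP x; rewrite {1}e => /(extends_branchE a'M a'K (a'M.1 _ Bd)).
    by rewrite a'K.
  have [c Bc [h1 h2]] := extends_direction a'M a'K Bd (fP x) xb.
  have N : (f @ x) (component d (a c)).
    have N' := component_nbhs Th Tl h1.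
    apply: (filterS _ N') => z hz; rewrite -(a'K _ Bd).
    by apply: (fP z) => //; exact: a'M.1.
  have [z [z1 z2]] := cy _ _ N (component_nbhs Th Tl (component_refl y'd)).
  by apply: sd; rewrite -(component_same h2) (component_same z1) -(component_same z2).
apply: (compact_cluster_set1 Th (@kspace_compact R D) filterT _ filterT).
apply/seteqP; split=> // _ ->.
have [|y [_ cy]] := @kspace_compact R D (f @ x) _; first exact: filterT.
by rewrite -(sub _ cy).
Qed.

End Extension.

End Directions.

(** * The tree of branch points *)

Section BranchTree.
Variables (R : realType) (D : kaleidoscope R).
Local Notation T := (kspace D).
Local Notation Br := (@branch_point T).
Let Th := @kspace_hausdorff R D.
Let Tc := @kspace_connected R D.
Let Tl := @kspace_locally_connected R D.

Definition branch : choiceType := set_type Br.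

Definition branch_dir (b x : branch) : Omega := @direction R D (val b) (val x).

Lemma branchP (b : branch) : Br (val b). Proof. exact: set_mem (valP b). Qed.

Definition to_branch x (Bx : Br x) : branch := SigSub (mem_set Bx).

Lemma val_neq (b c : branch) : b <> c -> val b <> val c.
Proof. by move=> bc /val_inj. Qed.

Lemma branch_dir_eq (b x y : branch) : x <> b -> y <> b ->
  branch_dir b x = branch_dir b y <-> component (val b) (val x) = component (val b) (val y).
Proof.
by move=> xb yb; apply: direction_eq; [exact: branchP|exact: val_neq|exact: val_neq].
Qed.

Lemma branch_across (b c x : branch) : b <> c -> x <> b ->
  branch_dir b x <> branch_dir b c -> branch_dir c x = branch_dir c b.
Proof.
move=> bc xb n; have cb := nesym bc.
have xc : x <> c by move=> e; rewrite e in n.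
apply/(branch_dir_eq xc bc).
apply: component_across => //; try exact: val_neq.
by move/(branch_dir_eq xb cb).
Qed.

Lemma branch_separated (x y : branch) : x <> y ->
  exists b, [/\ b <> x, b <> y & branch_dir b x <> branch_dir b y].
Proof.
move=> /val_neq/eqP/separation[b Bb [/eqP xb /eqP yb /eqP n]].
have [nx ny] : to_branch Bb <> x /\ to_branch Bb <> y.
  by split=> e; [apply: xb|apply: yb]; rewrite -e.
exists (to_branch Bb); split=> //.
by move/(branch_dir_eq (nesym nx) (nesym ny)).
Qed.

Lemma branch_median (x y z : branch) : exists m,
  [/\ btw branch_dir m x y, btw branch_dir m y z & btw branch_dir m x z].
Proof.
have [m Bm [h1 h2 h3]] := median_branch (branchP x) (branchP y) (branchP z).
have H u v : between m (val u) (val v) -> btw branch_dir (to_branch Bm) u v.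
  have [e _|nu] := pselect (to_branch Bm = u); first exact: Or31.
  have [e _|nv] := pselect (to_branch Bm = v); first exact: Or32.
  case=> [e|e|n].
  - by case: nu; apply: val_inj.
  - by case: nv; apply: val_inj.
  - by apply: Or33; move/(branch_dir_eq (nesym nu) (nesym nv)).
by exists (to_branch Bm); split; exact: H.
Qed.

Lemma branch_surj (b : branch) i : exists2 x, x <> b & branch_dir b x = i.
Proof.
have [x [Bx xb] e] := direction_surj i (branchP b).
by exists (to_branch Bx) => // e'; apply: xb; rewrite -e'.
Qed.

Lemma branch_type_countable : exists h : branch -> nat, injective h.
Proof.
have [h hI] := branch_countable D; exists (fun b => h (val b)) => b c e.
by apply: val_inj; apply: hI => //; exact: valP.
Qed.

Lemma branch_inhabited : inhabited branch.
Proof.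
have [_ [x _] _ _] := kspace_D_infty D.
by have [b Bb _] := @branch_dense R D x setT filterT; constructor; exact: to_branch Bb.
Qed.

Definition branch_tree : planar_tree :=
  PlanarTree branch_across branch_separated branch_median branch_surj
    branch_type_countable branch_inhabited.

Section Extension.
Variables a a' : branch -> branch.
Hypotheses (aK : cancel a a') (a'K : cancel a' a).
Hypothesis aF : forall b, exists2 s : sym Omega, AutO s &
  forall x, x <> b -> branch_dir (a b) (a x) = s (branch_dir b x).

Lemma inverse_aligned b : exists2 s : sym Omega, AutO s &
  forall x, x <> b -> branch_dir (a' b) (a' x) = s (branch_dir b x).
Proof.
have [s sO sP] := aF (a' b); exists s^-1%g; first exact: permgroupV.
move=> x xb; apply: (can_inj (symK s)); rewrite -sP; last by move=> /(can_inj a'K).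
by rewrite !a'K symVE sym_invK.
Qed.

(** The value outside the branch points is arbitrary. *)
Definition total_branch (f : branch -> branch) (x : T) : T :=
  match pselect (Br x) with left h => val (f (to_branch h)) | right _ => x end.

Lemma total_branchE f (b : branch) : total_branch f (val b) = val (f b).
Proof.
rewrite /total_branch; case: pselect => [h|]; last by case; exact: branchP.
by congr (val (f _)); apply: val_inj.
Qed.

Lemma total_branchP f : (forall x y, f x = f y -> x = y) ->
  (forall b, exists2 s : sym Omega, AutO s &
    forall x, x <> b -> branch_dir (f b) (f x) = s (branch_dir b x)) ->
  branch_morphism (total_branch f).
Proof.
move=> fI fF; split=> [b Bb|b c d Bb Bc Bd].
  by rewrite -[b]/(val (to_branch Bb)) total_branchE; exact: branchP.
move=> h; have [cb db] := component_neq h.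
rewrite -[b]/(val (to_branch Bb)) -[c]/(val (to_branch Bc)) -[d]/(val (to_branch Bd)).
have nc : to_branch Bc <> to_branch Bb by move=> /(congr1 val).
have nd : to_branch Bd <> to_branch Bb by move=> /(congr1 val).
have nfc : f (to_branch Bc) <> f (to_branch Bb) by move=> /fI.
have nfd : f (to_branch Bd) <> f (to_branch Bb) by move=> /fI.
rewrite !total_branchE; apply/component_eqP; first exact: val_neq.
apply/(branch_dir_eq nfc nfd); have [s _ sP] := fF (to_branch Bb).
by rewrite !sP//; congr (s _); apply/(branch_dir_eq nc nd); exact: component_same.
Qed.

(** A point of the dendrite is determined by its directions at the branch points,
    and these are permuted by [a]. *)
Lemma extend_automorphism : exists2 g : sym T, is_kaleidoscopic_homeo AutO g &
  forall b : branch, g (val b) = val (a b).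
Proof.
have A := total_branchP (can_inj aK) aF.
have A' := total_branchP (can_inj a'K) inverse_aligned.
have tK b : Br b -> total_branch a' (total_branch a b) = b.
  by move=> Bb; rewrite -[b]/(val (to_branch Bb)) !total_branchE aK.
have tK' b : Br b -> total_branch a (total_branch a' b) = b.
  by move=> Bb; rewrite -[b]/(val (to_branch Bb)) !total_branchE a'K.
pose g x := projT1 (cid (extends_exists A A' tK x)).
have gP x : extends (total_branch a) x (g x) by exact: (projT2 (cid (extends_exists A A' tK x))).
pose g' x := projT1 (cid (extends_exists A' A tK' x)).
have g'P x : extends (total_branch a') x (g' x).
  exact: (projT2 (cid (extends_exists A' A tK' x))).
have gK : cancel g g'.
  move=> x; apply: (extends_uniq A tK (g'P (g x))).
  exact: (extends_inv A A' tK tK' (gP x)).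
have g'K : cancel g' g.
  move=> x; apply: (extends_uniq A' tK' (gP (g' x))).
  exact: (extends_inv A' A tK' tK (g'P x)).
have gE (b : branch) : g (val b) = val (a b).
  by rewrite (extends_branchE A' tK' (branchP b) (gP (val b))) total_branchE.
have gh : is_homeo (Defs.Sym gK g'K : sym T).
  split; first exact: (extends_continuous A A' tK tK' gP).
  exact: (extends_continuous A' A tK' tK g'P).
exists (Defs.Sym gK g'K) => //; split=> // b Bb.
have [s sO sP] := aF (to_branch Bb); exists s => // C [x /= xb <-].
have [c Bc xc] := component_branch xb; have [_ cb] := component_neq xc.
have e : g @` component b c = component (g b) (g c) := homeo_component gh cb.
rewrite (component_same xc) [X in kcolor _ X = _]e.
have n : to_branch Bc <> to_branch Bb by move=> /(congr1 val).
have := sP _ n; rewrite /branch_dir /direction /= => <-.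
by rewrite -!gE.
Qed.

End Extension.

Lemma kaleidoscopic_ext (g h : sym T) : is_kaleidoscopic_homeo AutO g ->
  is_kaleidoscopic_homeo AutO h -> (forall b : branch, g (val b) = h (val b)) -> g = h.
Proof.
move=> [[gc _] _] [[hc _] _] gh; apply: sym_ext => x; apply: Th => A B gA hB.
have N : nbhs x ((g @^-1` A) `&` (h @^-1` B)) by apply: filterI; [exact: gc|exact: hc].
have [b Bb [/= Ab Bb']] := branch_dense N.
by exists (g b); split => //; have := gh (to_branch Bb) => /= ->.
Qed.

End BranchTree.

(** * From the basilica to the airplane *)

Section GluedAction.
Variables (T : colored_tree 2) (M : planar_tree) (b0 b1 : M).
Hypothesis b01 : b0 <> b1.
Local Notation glued := (glued T b0 b1).
Local Notation gdir := (@glued_dir T M b0 b1).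

Section OneAutomorphism.
Variables (F1 : permgroup 'I_2) (F2 : permgroup Omega) (g : sym T).
Hypothesis gU : is_universal F1 F2 g.
Let tT := adj_tree T.
Let gE : forall x y, adj (g x) (g y) = adj x y.
Proof. by case: gU. Qed.
Let gA : forall x, inA (g x) = inA x.
Proof. by case: gU. Qed.

Lemma act_bvertex_proof (w : bvertex T) : ~~ inA (g (val w)).
Proof. by rewrite gA (valP w). Qed.

Definition act_bvertex (w : bvertex T) : bvertex T :=
  exist (fun w : T => is_true (~~ inA w)) (g (val w)) (act_bvertex_proof w).
Definition act (z : glued) : glued :=
  match z with inl w => inl (act_bvertex w) | inr (h, i) => inr (act_edge gU h, i) end.

Lemma vertex_of_act z : vertex_of (act z) = g (vertex_of z).
Proof. by case: z => [w|[h i]]. Qed.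

Lemma retract_act h z : retract (act_edge gU h) (act z) = retract h z.
Proof.
have E (u : T) : ~~ inA u ->
    end_towards b0 b1 (act_edge gU h) (g u) = end_towards b0 b1 h u.
  move=> Bu; rewrite /end_towards /= step_morph//; last first.
    by have [a _ _] := edgeP h; exact/nesym/neq_side.
  by rewrite (can_eq (symK g)).
case: z => [w|[h' i]] /=; first by apply: E; exact: (valP w).
rewrite (inj_eq (@act_edge_inj _ _ _ _ _ gU)); case: eqP => // _; apply: E.
by have [] := edgeP h'.
Qed.

Lemma glued_act_aligned b : (forall f, F2 f -> AutO f) -> exists2 s : sym Omega, AutO s &
  forall x, x <> b -> gdir (act b) (act x) = s (gdir b x).
Proof.
move=> F2O; case: b => [w|[h i]]; last first.
  exists 1%g; first exact: permgroup1.
  by move=> x _; rewrite sym1E -[LHS]/(dir (val i) (retract (act_edge gU h) (act x))) retract_act.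
have [_ _ _ /(_ (val w) (valP w)) [s sO sP]] := gU.
exists s; first exact: F2O.
move=> x xw; rewrite /= vertex_of_act.
have n : vertex_of x <> val w by move=> /vertex_ofE.
rewrite step_morph//; have [wv _] := stepP tT n.
have [c kc] := colorB (valP w) wv.
by rewrite /omega_color kc (sP _ _ wv kc).
Qed.

End OneAutomorphism.

End GluedAction.

Section RabbitToAirplane.
Variables (R : realType) (T : colored_tree 2) (D : kaleidoscope R).
Variables (b0 b1 : branch D).
Hypothesis b01 : b0 <> b1.

Let M := branch_tree D.
Let glue : planar_tree := @glued_tree T M b0 b1 b01.

Let actg (g : Homeo_plus_rabbit T) : glue -> glue := @act T M b0 b1 _ _ _ (rabbitP g).

Lemma actgM g h z : actg (g * h)%g z = actg g (actg h z).
Proof.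
case: z => [w|[e i]]; first by congr inl; apply: val_inj.
by congr (inr (_, _)); apply: val_inj.
Qed.

Lemma actg1 z : actg 1%g z = z.
Proof.
case: z => [w|[e i]]; first by congr inl; apply: val_inj.
by congr (inr (_, _)); apply: val_inj; rewrite /= -surjective_pairing.
Qed.

Lemma actgK g : cancel (actg g) (actg g^-1%g).
Proof. by move=> z; rewrite -actgM mulVg actg1. Qed.

Lemma actgVK g : cancel (actg g^-1%g) (actg g).
Proof. by move=> z; rewrite -actgM mulgV actg1. Qed.

(** Conjugate the action on the glued tree to the branch points of [D]. *)
Lemma basilica_embeds_airplane :
  embeds_as_topological_group (Homeo_plus_rabbit T) (Homeo_plus_airplane D).
Proof.
have [f [f' [fK f'K fF]]] := planar_tree_unique glue M.
pose a g (b : branch D) : branch D := f (actg g (f' b)).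
have aK g : cancel (a g) (a g^-1%g).
  by move=> b; rewrite /a fK actgK f'K.
have aVK g : cancel (a g^-1%g) (a g).
  by move=> b; rewrite /a fK actgVK f'K.
have aF g b : exists2 s : sym Omega, AutO s &
    forall x, x <> b -> branch_dir (a g b) (a g x) = s (branch_dir b x).
  have [s sO sP] := fF (f' b).
  have [t tO tP] := fF (actg g (f' b)).
  have [u uO uP] := @glued_act_aligned T M b0 b1 _ _ _ (rabbitP g) (f' b) (fun _ => id).
  exists (t * u * s^-1)%g.
    apply: (permgroupM (p := AutO)); last exact: (permgroupV (p := AutO)).
    exact: (permgroupM (p := AutO)).
  move=> x xb; have n : f' x <> f' b by move=> /(can_inj f'K).
  have n' : actg g (f' x) <> actg g (f' b) by move=> /(can_inj (actgK g)).
  rewrite /a -[LHS]/(dir (f (actg g (f' b))) (f (actg g (f' x)))) tP//.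
  rewrite !symME symVE; congr (t _).
  rewrite -[LHS]/(glued_dir (actg g (f' b)) (actg g (f' x))) uP//; congr (u _).
  apply: (can_inj (symK s)); rewrite sym_invK.
  by rewrite -[glued_dir _ _]/(@dir glue (f' b) (f' x)) -sP// !f'K.
have ext g := extend_automorphism (aK g) (aVK g) (aF g).
pose P g := projT1 (cid2 (ext g)).
have PK g : kaleidoscopic_permgroup D AutO (P g) by rewrite /P; case: cid2.
have PE g b : P g (val b) = val (a g b) by rewrite /P; case: cid2.
pose Phi (g : Homeo_plus_rabbit T) : Homeo_plus_airplane D := SigSub (mem_set (PK g)).
have PhiE g b : val (Phi g) (val b) = val (a g b) by exact: PE.
exists Phi; apply: (@pointwise_embedding T D _ _ [set: T] _ _ _ Phi).
- move=> y By; set z := f' (to_branch By).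
  have E g : val (Phi g) y = val (f (actg g z)).
    by rewrite -[y]/(val (to_branch By)) PhiE.
  case: z E => [w|[h i]] E.
    exists [:: val w] => // g g' gg'; rewrite !E; congr (val (f _)); congr inl.
    by apply: val_inj; apply: gg'; rewrite inE.
  exists [:: (val h).1; (val h).2] => // g g' gg'; rewrite !E; congr (val (f _)).
  congr (inr (_, _)); apply: val_inj => /=.
  by rewrite !gg'// !inE eqxx ?orbT.
- move=> v _.
  have [z zP] : exists z : glue, forall g g' : Homeo_plus_rabbit T,
      actg g z = actg g' z -> val g v = val g' v.
    have [Av|Bv] := boolP (inA v); last first.
      by exists (inl (Sub v Bv)) => g g' /(congr1 (@vertex_of T M b0 b1)).
    have [h1 [_ [hv _ _ _]]] := two_neighbors Av.
    have [i ii] := inside_exists (b01 : (b0 : M) <> b1).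
    exists (inr (h1, Sub i ii)) => g g'; rewrite -hv.
    by move/(congr1 (@vertex_of T M b0 b1)).
  exists (val (f z)); first exact: branchP.
  by move=> g g'; rewrite !PhiE /a fK => /val_inj/(can_inj fK)/zP.
- by move=> g h gh; apply: val_inj; apply: sym_ext => v; exact: gh.
move=> g h; apply: val_inj; apply: kaleidoscopic_ext.
- exact: PK.
- exact: (permgroupM (PK g) (PK h)).
- by move=> b; rewrite PhiE valM symME !PhiE /a actgM fK.
Qed.

End RabbitToAirplane.

Theorem corollary4p19 (R : realType) (n m : nat)
    (Tn : colored_tree n) (Tm : colored_tree m) (T2 : colored_tree 2)
    (D : kaleidoscope R) :
  (2 <= n)%N -> (2 <= m)%N -> (n %| m)%N ->
  [/\ embeds_as_topological_group (Homeo_plus_rabbit Tn) (Homeo_plus_rabbit Tm),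
      embeds_as_topological_group (Homeo_plus_rabbit Tm) (Homeo_plus_rabbit T2) &
      embeds_as_topological_group (Homeo_plus_rabbit T2) (Homeo_plus_airplane D)].
Proof.
move=> n2 m2 nm; split.
- by apply: rabbit_embeds_dvdn => //; exact: ltnW.
- by apply: rabbit_embeds_basilica; exact: ltnW.
- have [b0] := branch_inhabited D; have [b1 b10 _] := branch_surj b0 (qz 0).
  exact: basilica_embeds_airplane T2 D b1 b0 b10.
Qed.
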